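(* Let $n\ge 3$, let $R$ be a commutative ring with $1$, let $A$ be a quasi-finite $R$-algebra with identity, and let $I_0,\dots,I_m$ ($m\ge 0$) be two-sided ideals of $A$. Let $G_0,\dots,G_m$ be subgroups of $\operatorname{GL}_n(A)$ such that $$E_n(A,I_i)\subseteq G_i\subseteq \operatorname{GL}_n(A,I_i)\quad\text{for } i=0,\dots,m.$$ If there is an index $j$ such that $G_j=E_n(A,I_j)$, then, for every arrangement of commutator brackets $\llbracket\,\cdot\,\rrbracket$ on $m+1$ ordered entries (the same arrangement on both sides), $$\llbracket G_0,G_1,\ldots,G_m\rrbracket=\llbracket E_n(A,I_0),E_n(A,I_1),\ldots,E_n(A,I_m)\rrbracket.$$
   Context: Rings are associative with $1$. An $R$-algebra $A$ is module finite over $R$ if it is finitely generated as an $R$-module; $A$ is quasi-finite over $R$ if there is a direct system of module finite $R$-subalgebras $A_i$ of $A$ with $\varinjlim A_i=A$. For $1\le i\ne j\le n$ and $a\in A$, $e_{i,j}(a)\in\operatorname{GL}_n(A)$ is the elementary matrix with $1$'s on the diagonal, $a$ in position $(i,j)$, and $0$ elsewhere. $E_n(A)$ is the subgroup of $\operatorname{GL}_n(A)$ generated by all $e_{i,j}(a)$, $a\in A$. For a two-sided ideal $I$ of $A$: $\operatorname{GL}_n(A,I)=\ker(\operatorname{GL}_n(A)\to\operatorname{GL}_n(A/I))$; $E_n(I)$ is the subgroup generated by all $e_{i,j}(\alpha)$ with $\alpha\in I$, $i\ne j$; and $E_n(A,I)$ is the normal closure of $E_n(I)$ in $E_n(A)$.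 For group elements, $[x,y]=xyx^{-1}y^{-1}$; for subgroups $H,K$, $[H,K]$ is the subgroup generated by all $[h,k]$, $h\in H$, $k\in K$. For a finite sequence of subgroups $H_0,\dots,H_m$, the notation $\llbracket H_0,\dots,H_m\rrbracket$ denotes any meaningful multi-commutator expression obtained by inserting binary commutator brackets $[\_,\_]$ into the sequence, keeping the order. Recursively: for one subgroup, $\llbracket H_0\rrbracket=H_0$; for $m\ge1$, $\llbracket H_0,\dots,H_m\rrbracket=\big[\llbracket H_0,\dots,H_k\rrbracket,\llbracket H_{k+1},\dots,H_m\rrbracket\big]$ for some $0\le k<m$ and some arrangements on the two parts. For example, $[[H_0,[H_1,H_2]],H_3]$ and $[[H_0,H_1],[H_2,H_3]]$ are two arrangements for $m=3$. *)

(* Defs.v *)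
From HB Require Import structures.
From mathcomp Require Import all_boot all_order all_algebra.
From mathcomp Require Import boolp classical_sets.

Set Implicit Arguments.
Unset Strict Implicit.
Unset Printing Implicit Defensive.

Import GRing.Theory.

Local Open Scope classical_set_scope.
Local Open Scope ring_scope.
Local Open Scope quotient_scope.

(* An R-algebra, given by its structure map: a ring morphism from R to the
   centre of A, the scalar action being k . x = alg_map k * x. The library's
   [algType R] is not used because it excludes the zero ring. *)
Record algebra (R : comPzRingType) : Type := Algebra {
  alg_ring :> pzRingType;
  alg_map : {rmorphism R -> alg_ring};
  alg_mapC : forall (k : R) (x : alg_ring), alg_map k * x = x * alg_map k
}.

Section QuasiFinite.
Variables (R : comPzRingType) (A : algebra R).

Definition is_subalgebra (B : set A) : Prop :=
  [/\ B 1, forall x y, B x -> B y -> B (x - y),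
      forall x y, B x -> B y -> B (x * y) &
      forall (k : R) x, B x -> B (alg_map A k * x)].

Definition module_finite (B : set A) : Prop :=
  exists (d : nat) (v : 'I_d -> A),
    B = [set x | exists c : 'I_d -> R, x = \sum_(i < d) alg_map A (c i) * v i].

(* The transition maps of the system are the inclusions, so its direct limit
   is the union. *)
Definition quasi_finite : Prop :=
  exists (J : Type) (le : J -> J -> Prop) (B : J -> set A),
    [/\ [/\ inhabited J, forall i, le i i,
            forall i j k, le i j -> le j k -> le i k &
            forall i j, exists k, le i k /\ le j k],
        forall i, is_subalgebra (B i) /\ module_finite (B i),
        forall i j, le i j -> B i `<=` B j &
        \bigcup_i B i = [set: A]].

End QuasiFinite.

HB.mixin Record isTwoSided (A : pzRingType) (I : A -> bool) := {
  ideal_mull : forall a x : A, x \in I -> a * x \in I;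
  ideal_mulr : forall a x : A, x \in I -> x * a \in I
}.

#[short(type="twoSidedIdeal")]
HB.structure Definition TwoSidedIdeal (A : pzRingType) :=
  {I of GRing.ZmodClosed A I & isTwoSided A I}.

(* A/I; the library's quotient ring needs a commutative ring and a proper
   ideal. *)
Section IdealQuotient.
Variables (A : pzRingType) (I : twoSidedIdeal A).

Definition ideal_quot : Type := {ideal_quot I}.
HB.instance Definition _ := GRing.Zmodule.on ideal_quot.
HB.instance Definition _ := EqQuotient.on ideal_quot.
HB.instance Definition _ := ZmodQuotient.on ideal_quot.

Definition quot_proj (x : A) : ideal_quot := \pi_ideal_quot x.

Lemma quot_projE x y : quot_proj x = quot_proj y <-> x - y \in I.
Proof.
rewrite /quot_proj; split=> [/eqP|h]; first by rewrite -Quotient.idealrBE.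
by apply/eqP; rewrite -Quotient.idealrBE.
Qed.

Definition quot_one : ideal_quot := quot_proj 1.
Definition quot_mul (u v : ideal_quot) : ideal_quot :=
  quot_proj (repr u * repr v).

Lemma quot_projK (u : ideal_quot) : quot_proj (repr u) = u.
Proof. exact: reprK. Qed.

Lemma repr_projB x : repr (quot_proj x) - x \in I.
Proof. by apply/quot_projE; rewrite quot_projK. Qed.

Lemma quot_projM x y : quot_proj (x * y) = quot_mul (quot_proj x) (quot_proj y).
Proof.
apply/esym/quot_projE.
set x' := repr _; set y' := repr _.
have -> : x' * y' - x * y = (x' - x) * y' + x * (y' - y).
  by rewrite mulrBl mulrBr addrA subrK.
by apply: rpredD; [apply: ideal_mulr|apply: ideal_mull]; apply: repr_projB.
Qed.

Lemma quot_projD x y : quot_proj (x + y) = quot_proj x + quot_proj y.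
Proof. by rewrite /quot_proj piE. Qed.

Lemma quot_projP (P : ideal_quot -> Prop) :
  (forall x, P (quot_proj x)) -> forall u, P u.
Proof. by move=> h u; rewrite -(quot_projK u). Qed.

Lemma quot_mulA : associative quot_mul.
Proof.
elim/quot_projP=> x; elim/quot_projP=> y; elim/quot_projP=> z.
by rewrite -!quot_projM mulrA.
Qed.
Lemma quot_mul1l : left_id quot_one quot_mul.
Proof. by elim/quot_projP=> x; rewrite -quot_projM mul1r. Qed.
Lemma quot_mul1r : right_id quot_one quot_mul.
Proof. by elim/quot_projP=> x; rewrite -quot_projM mulr1. Qed.
Lemma quot_mulDl : left_distributive quot_mul +%R.
Proof.
elim/quot_projP=> x; elim/quot_projP=> y; elim/quot_projP=> z.
by rewrite -quot_projD -!quot_projM mulrDl quot_projD.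
Qed.
Lemma quot_mulDr : right_distributive quot_mul +%R.
Proof.
elim/quot_projP=> x; elim/quot_projP=> y; elim/quot_projP=> z.
by rewrite -quot_projD -!quot_projM mulrDr quot_projD.
Qed.

HB.instance Definition _ := GRing.Zmodule_isPzRing.Build ideal_quot
  quot_mulA quot_mul1l quot_mul1r quot_mulDl quot_mulDr.

Lemma quot_proj_zmod : zmod_morphism quot_proj.
Proof. by move=> x y; rewrite /quot_proj !piE. Qed.
Lemma quot_proj_monoid : monoid_morphism quot_proj.
Proof. by split=> // x y; rewrite quot_projM. Qed.

HB.instance Definition _ :=
  GRing.isZmodMorphism.Build A ideal_quot quot_proj quot_proj_zmod.
HB.instance Definition _ :=
  GRing.isMonoidMorphism.Build A ideal_quot quot_proj quot_proj_monoid.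

End IdealQuotient.

Section GeneralLinear.
Variables (n : nat) (A : pzRingType).

(* [unitmx] is available over commutative rings only. An element of GL_n(A)
   is a matrix together with its (unique) two-sided inverse. *)
Definition inverse_pair : pred ('M[A]_n * 'M[A]_n) :=
  fun p => (p.1 *m p.2 == 1%:M) && (p.2 *m p.1 == 1%:M).

Record GL : Type := MkGL {
  GLpair : 'M[A]_n * 'M[A]_n;
  GLpairP : inverse_pair GLpair
}.

HB.instance Definition _ := [isSub for GLpair].
HB.instance Definition _ := [Choice of GL by <:].

Definition GLmx (g : GL) : 'M[A]_n := (GLpair g).1.
Definition GLmxV (g : GL) : 'M[A]_n := (GLpair g).2.

Lemma GLmxK (g : GL) : GLmx g *m GLmxV g = 1%:M.
Proof. by case/andP: (GLpairP g) => /eqP. Qed.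
Lemma GLmxVK (g : GL) : GLmxV g *m GLmx g = 1%:M.
Proof. by case/andP: (GLpairP g) => _ /eqP. Qed.

Lemma GLmx_inj : injective GLmx.
Proof.
move=> g h e; apply: val_inj; rewrite /= [GLpair g]surjective_pairing.
rewrite [GLpair h]surjective_pairing; congr pair => //.
rewrite -[_.2]/(GLmxV g) -[RHS]/(GLmxV h).
by rewrite -[LHS]mulmx1 -(GLmxK h) -e mulmxA GLmxVK mul1mx.
Qed.

Definition GLmake (g h : 'M[A]_n) (gh : g *m h = 1%:M) (hg : h *m g = 1%:M) :
    GL.
Proof. by exists (g, h); apply/andP; split; apply/eqP. Defined.

Definition GL1 : GL := GLmake (mulmx1 1%:M) (mulmx1 1%:M).
Definition GLinv (g : GL) : GL := GLmake (GLmxVK g) (GLmxK g).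

Lemma GLmul_subproof1 (g h : GL) :
  (GLmx g *m GLmx h) *m (GLmxV h *m GLmxV g) = 1%:M.
Proof. by rewrite mulmxA -(mulmxA (GLmx g)) GLmxK mulmx1 GLmxK. Qed.
Lemma GLmul_subproof2 (g h : GL) :
  (GLmxV h *m GLmxV g) *m (GLmx g *m GLmx h) = 1%:M.
Proof. by rewrite mulmxA -(mulmxA (GLmxV h)) GLmxVK mulmx1 GLmxVK. Qed.
Definition GLmul (g h : GL) : GL :=
  GLmake (GLmul_subproof1 g h) (GLmul_subproof2 g h).

Lemma GLmulA : associative GLmul.
Proof. by move=> x y z; apply: GLmx_inj; rewrite /GLmx /= mulmxA. Qed.
Lemma GLmul1l : left_id GL1 GLmul.
Proof. by move=> x; apply: GLmx_inj; rewrite /GLmx /= mul1mx. Qed.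
Lemma GLmul1r : right_id GL1 GLmul.
Proof. by move=> x; apply: GLmx_inj; rewrite /GLmx /= mulmx1. Qed.
Lemma GLmulVl : left_inverse GL1 GLinv GLmul.
Proof. by move=> x; apply: GLmx_inj; rewrite /GLmx /= GLmxVK. Qed.
Lemma GLmulVr : right_inverse GL1 GLinv GLmul.
Proof. by move=> x; apply: GLmx_inj; rewrite /GLmx /= GLmxK. Qed.

HB.instance Definition _ :=
  isGroup.Build GL GLmulA GLmul1l GLmul1r GLmulVl GLmulVr.

Definition elem_mx (i j : 'I_n) (a : A) : 'M[A]_n :=
  \matrix_(k, l) (if k == l then 1 else if (k == i) && (l == j) then a else 0).

Lemma elem_mxE i j a : i != j -> elem_mx i j a = 1%:M + a *: delta_mx i j.
Proof.
move=> ij; apply/matrixP => k l; rewrite !mxE.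
case: eqVneq => [<-|_]; last first.
  by case: ifP => _; rewrite ?mulr1 ?mulr0 add0r.
case: eqVneq => [->|_]; last by rewrite mulr0 addr0.
by rewrite (negPf ij) mulr0 addr0.
Qed.

Lemma elem_mxK i j a : i != j -> elem_mx i j a *m elem_mx i j (- a) = 1%:M.
Proof.
move=> ij; rewrite !elem_mxE // mulmxDl mul1mx mulmxDr mulmx1.
rewrite [X in _ + (_ + X)](_ : _ = 0) ?addr0; last first.
  apply/matrixP=> k l; rewrite !mxE big1 // => s _; rewrite !mxE.
  case: (eqVneq s j) => [->|]; last by rewrite andbF mulr0 mul0r.
  by rewrite [j == i]eq_sym (negPf ij) mulr0 mulr0.
by rewrite scaleNr -addrA addNr addr0.
Qed.

Lemma elem_mxKr i j a : i != j -> elem_mx i j (- a) *m elem_mx i j a = 1%:M.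
Proof. by move=> ij; rewrite -{2}[a]opprK elem_mxK. Qed.

Definition elem (i j : 'I_n) (ij : i != j) (a : A) : GL :=
  GLmake (elem_mxK a ij) (elem_mxKr a ij).

End GeneralLinear.

Section GLmap.
Variables (n : nat) (A B : pzRingType) (f : {rmorphism A -> B}).

Lemma GLmap_subproof1 (g : GL n A) :
  map_mx f (GLmx g) *m map_mx f (GLmxV g) = 1%:M.
Proof. by rewrite -map_mxM GLmxK map_mx1. Qed.
Lemma GLmap_subproof2 (g : GL n A) :
  map_mx f (GLmxV g) *m map_mx f (GLmx g) = 1%:M.
Proof. by rewrite -map_mxM GLmxVK map_mx1. Qed.

Definition GLmap (g : GL n A) : GL n B :=
  GLmake (GLmap_subproof1 g) (GLmap_subproof2 g).
End GLmap.

Section Subgroups.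
Variable T : groupType.
Local Open Scope group_scope.

Definition is_subgroup (H : set T) : Prop :=
  [/\ H 1, forall x y, H x -> H y -> H (x * y) & forall x, H x -> H x^-1].

Definition generated (X : set T) : set T := smallest is_subgroup X.

Definition is_normal_in (K N : set T) : Prop :=
  [/\ is_subgroup N, N `<=` K &
      forall k x, K k -> N x -> N (k * x * k^-1)].

(* Meaningful for a subset X of the subgroup K. *)
Definition normal_closure (K X : set T) : set T := smallest (is_normal_in K) X.

(* The library's [~ x, y] is x^-1 * y^-1 * x * y. *)
Definition commutator (x y : T) : T := x * y * x^-1 * y^-1.

Definition commutator_subgroup (H K : set T) : set T :=
  generated [set commutator h k | h in H & k in K].

End Subgroups.

(* [bracketing p]: the ways to bracket a sequence of p >= 1 entries. *)
Inductive bracketing : nat -> Type :=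
| Entry : bracketing 1
| Bracket p q : bracketing p -> bracketing q -> bracketing (p + q).

Fixpoint multicommutator (T : groupType) p (t : bracketing p) :
    ('I_p -> set T) -> set T :=
  match t in bracketing p return ('I_p -> set T) -> set T with
  | Entry => fun H => H ord0
  | Bracket p q t1 t2 => fun H =>
      commutator_subgroup (multicommutator t1 (fun i => H (lshift q i)))
                          (multicommutator t2 (fun i => H (rshift p i)))
  end.

Section Relative.
Variables (n : nat) (A : pzRingType).

Definition elem_gen (X : set A) : set (GL n A) :=
  generated [set g | exists (i j : 'I_n) (ij : i != j) (a : A),
                       X a /\ g = elem ij a].

Definition En : set (GL n A) := elem_gen [set: A].

Definition En_ideal (I : twoSidedIdeal A) : set (GL n A) :=
  elem_gen [set a | a \in I].

Definition En_rel (I : twoSidedIdeal A) : set (GL n A) :=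
  normal_closure En (En_ideal I).

Definition GL_rel (I : twoSidedIdeal A) : set (GL n A) :=
  [set g | GLmap (quot_proj I) g = 1%g].

End Relative.
Arguments En_rel n {A} I.
Arguments GL_rel n {A} I.

(* Main.v *)
(* The idea is to prove, for two-sided ideals K, L, J with K o L = KL + LK,
     [E(K), GL(J)] <= [E(K), E(J)]                             (1)
     [[E(K), E(L)], GL(J)] <= [E(K o L), E(J)]                 (2)
   By induction on the arrangement, (1) and (2) give the inclusion
   [V, GL(J)] <= [E(X), E(J)], where V is the multi-commutator of the
   E(A, I_i) and X the corresponding iterated product o of the I_i. Any
   multi-commutator of the G_i lies between E(X) and GL(X), so in an outermost
   bracket the part containing the index j equals V by induction, and bracketing
   it with the other part does not leave [E(X'), E(X'')].

   For (1) and (2), g in GL(J) becomes the matrix (g, 1) over the double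
   {(x, x') | x - x' in J}. The elementary subgroups of ideals of the double are
   normalized by (g, 1), and comparing the two components of such a conjugate
   produces commutators in [E(K), E(J)]. By Vaserstein's theorem
   [E(K), E(L)] is generated modulo E(K o L) by the conjugates of
   [e_ij(a), e_ji(b)], so that (2) reduces to these.

   That (g, 1) behaves well is a local-global argument: for each maximal ideal m
   of R, the entries of g lie in a module finite subalgebra, which has stable
   rank 1 at m, so that up to elements of R outside m the matrix g is a product of
   elementary matrices and a diagonal matrix diag(1, .., 1, c). Denominators are
   not inverted: an equation P Q = Q P = t replaces the inverse of P. The scalars r
   for which conjugates of e_ij(r x) behave as desired form an ideal contained in
   no maximal ideal. *)
Require Import Defs.
From HB Require Import structures.
From mathcomp Require Import all_boot all_order all_algebra.
From mathcomp Require Import perm.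
From mathcomp Require Import boolp classical_sets ring.
Set Implicit Arguments.
Unset Strict Implicit.
Unset Printing Implicit Defensive.
Import GRing.Theory.
Local Open Scope classical_set_scope.
Local Open Scope ring_scope.

(** The obstacle is that [[E(K), E(J)]] can be larger than [E(K o J)] and need not be the elementary
    subgroup of an ideal of A, whereas the local-global argument controls only elementary subgroups
    of ideals. Over the double this is repaired: pairs in K whose difference lies in [K o J] form an
    ideal, and the two components of an element of its elementary subgroup differ by an element of
    [[E(K), E(J)]].

    Two rings occur side by side. Elimination takes place in a module finite subring containing the
    entries of (g, 1) and of its inverse; the ideals are those of the whole double.

    Denominators are kept because scalars outside m may be zero divisors on A, and without a
    Noetherian hypothesis the kernel of localization is out of control.

    The element [[e_12(a), e_21(b)]] is not additive in a, and conjugation preserves it only up to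
    an elementary factor. It is supported on the indices 1, 2, while the diagonal matrix left by
    elimination differs from a scalar only at the last index. For n >= 3 these do not meet, so the
    two commute. *)

(** * Identities in noncommutative rings *)

(* A decision procedure for identities in noncommutative rings: both sides are
   expanded to signed words in the atoms, which must cancel in pairs. *)
Inductive nc_expr :=
  | NcVar of nat | NcZero | NcOne
  | NcAdd of nc_expr & nc_expr | NcOpp of nc_expr | NcMul of nc_expr & nc_expr.

Section NcEval.
Variables (B : pzRingType) (env : seq B).

Fixpoint nc_eval e : B := match e with
  | NcVar k => nth 0 env k
  | NcZero => 0
  | NcOne => 1
  | NcAdd e f => nc_eval e + nc_eval f
  | NcOpp e => - nc_eval e
  | NcMul e f => nc_eval e * nc_eval f
  end.

Definition nc_word (t : bool * seq nat) : B :=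
  (-1) ^+ t.1 * \prod_(k <- t.2) nth 0 env k.
Definition nc_neg (t : bool * seq nat) := (~~ t.1, t.2).

Fixpoint nc_norm e : seq (bool * seq nat) := match e with
  | NcVar k => [:: (false, [:: k])]
  | NcZero => [::]
  | NcOne => [:: (false, [::])]
  | NcAdd e f => nc_norm e ++ nc_norm f
  | NcOpp e => map nc_neg (nc_norm e)
  | NcMul e f => [seq (t.1 (+) u.1, t.2 ++ u.2) | t <- nc_norm e, u <- nc_norm f]
  end.

(** [m] is fuel: every step removes a word together with its negative, so the number of words is
    enough. *)
Fixpoint nc_cancel m (s : seq (bool * seq nat)) := match m, s with
  | m.+1, t :: s => (nc_neg t \in s) && nc_cancel m (rem (nc_neg t) s)
  | _, s => nilp s
  end.

Lemma nc_negE t : nc_word (nc_neg t) = - nc_word t.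
Proof.
by case: t => [[] w]; rewrite /nc_word /= ?expr0 ?expr1 ?mulN1r ?mul1r ?opprK.
Qed.

Lemma nc_normE e : nc_eval e = \sum_(t <- nc_norm e) nc_word t.
Proof.
elim: e => [k|||e IHe f IHf|e IHe|e IHe f IHf] /=.
- by rewrite big_seq1 /nc_word big_seq1 mul1r.
- by rewrite big_nil.
- by rewrite big_seq1 /nc_word big_nil mul1r.
- by rewrite big_cat IHe IHf.
- by rewrite big_map IHe -sumrN; apply: eq_bigr => t _; rewrite nc_negE.
rewrite big_allpairs_dep IHe IHf mulr_suml; apply: eq_bigr => t _.
rewrite mulr_sumr; apply: eq_bigr => u _.
rewrite /nc_word /= big_cat signr_addb !mulrA; congr (_ * _).
rewrite -!mulrA; congr (_ * _).
by case: u.1; rewrite ?expr1 ?expr0 ?mulN1r ?mulrN1 ?mul1r ?mulr1.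
Qed.

Lemma nc_cancelP m s : nc_cancel m s -> \sum_(t <- s) nc_word t = 0.
Proof.
elim: m s => [|m IH] [|t s] //=; rewrite ?big_nil // => /andP[ts /IH st].
by rewrite big_cons (perm_big _ (perm_to_rem ts)) big_cons nc_negE addrA subrr add0r.
Qed.

Lemma nc_eqP e f : (let s := nc_norm (NcAdd e (NcOpp f)) in nc_cancel (size s) s) ->
  nc_eval e = nc_eval f.
Proof.
by move=> /nc_cancelP; rewrite -nc_normE => /eqP; rewrite /= subr_eq0 => /eqP.
Qed.
End NcEval.

Ltac nc_mem x l := match l with
  | nil => constr:(false)
  | cons x _ => constr:(true)
  | cons _ ?t => nc_mem x t
  end.
Ltac nc_idx x l := match l with
  | cons x _ => constr:(0%N)
  | cons _ ?t => let k := nc_idx x t in constr:(S k)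
  end.
(** Square matrices are treated as elements of the matrix ring: [*m] and [1%:M] are quoted as its
    product and one, and the final [refine] identifies them by conversion. *)
Ltac nc_atoms t l := match t with
  | (?a + ?b)%R => let l := nc_atoms a l in nc_atoms b l
  | (?a * ?b)%R => let l := nc_atoms a l in nc_atoms b l
  | (?a *m ?b)%R => let l := nc_atoms a l in nc_atoms b l
  | (- ?a)%R => nc_atoms a l
  | 0%R => l
  | 1%R => l
  | (1%:M)%R => l
  | _ => match nc_mem t l with true => l | false => constr:(cons t l) end
  end.
Ltac nc_quote t l := match t with
  | (?a + ?b)%R => let a := nc_quote a l in let b := nc_quote b l in constr:(NcAdd a b)
  | (?a * ?b)%R => let a := nc_quote a l in let b := nc_quote b l in constr:(NcMul a b)
  | (?a *m ?b)%R => let a := nc_quote a l in let b := nc_quote b l in constr:(NcMul a b)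
  | (- ?a)%R => let a := nc_quote a l in constr:(NcOpp a)
  | 0%R => constr:(NcZero)
  | 1%R => constr:(NcOne)
  | (1%:M)%R => constr:(NcOne)
  | _ => let k := nc_idx t l in constr:(NcVar k)
  end.
Ltac ncring := match goal with
  | |- @eq ?T ?x ?y =>
    let l := nc_atoms x (@nil T) in let l := nc_atoms y l in
    let e := nc_quote x l in let f := nc_quote y l in
    refine (@nc_eqP _ l e f _); vm_compute; reflexivity
  end.

(** * Elementary matrices and relative elementary subgroups *)

(* Locked: otherwise unification identifies it with other scalings. *)
HB.lock Definition munit (n : nat) (A : pzRingType) (i j : 'I_n) (a : A) :
  'M[A]_n := a *: delta_mx i j.
Arguments munit {n A} i j a.

Section MatrixUnits.
Variables (n : nat) (A : pzRingType).
Implicit Types (i j k l : 'I_n) (a b : A).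

Lemma munitE i j a k l :
  munit i j a k l = if (k == i) && (l == j) then a else 0.
Proof.
by rewrite munit.unlock !mxE; case: (_ && _); rewrite ?mulr1 ?mulr0.
Qed.

Lemma munitM i j k l a b :
  munit i j a *m munit k l b = if j == k then munit i l (a * b) else 0.
Proof.
apply/matrixP=> s t; rewrite munit.unlock mxE.
rewrite (bigD1 j) //= big1 => [|u /negPf uj]; last first.
  by rewrite !mxE uj andbF mulr0 mul0r.
rewrite !mxE eqxx andbT addr0.
case: (eqVneq j k) => _ /=; rewrite ?mxE /=; last by rewrite !mulr0.
by case: (s == i); case: (t == l); rewrite ?mulr1 ?mulr0 ?mul0r.
Qed.

Lemma munitD i j a b : munit i j (a + b) = munit i j a + munit i j b.
Proof. by rewrite munit.unlock scalerDl. Qed.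
Lemma munitN i j a : munit i j (- a) = - munit i j a.
Proof. by rewrite munit.unlock scaleNr. Qed.
Lemma munit0 i j : munit i j 0 = 0 :> 'M[A]_n.
Proof. by rewrite munit.unlock scale0r. Qed.

(* Total in [i] and [j]: the junk value for [i = j] is [1]. *)
Definition el i j a : GL n A :=
  match @idP (i != j) with
  | ReflectT h => elem h a
  | ReflectF _ => 1%g
  end.

Lemma elE i j (ij : i != j) a : el i j a = elem ij a.
Proof.
by rewrite /el; case: {-}_ / idP => // h; congr (elem _ _); apply: bool_irrelevance.
Qed.

Lemma GLmx_el i j a : i != j -> GLmx (el i j a) = 1%:M + munit i j a.
Proof. by move=> ij; rewrite (elE ij) munit.unlock; apply: elem_mxE. Qed.

Lemma GLmxM (g h : GL n A) : GLmx (g * h)%g = GLmx g *m GLmx h.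
Proof. by []. Qed.

Lemma el_diag i a : el i i a = 1%g.
Proof. by rewrite /el; case: {-}_ / idP => // h; exfalso; rewrite eqxx in h. Qed.

Lemma el0 i j : el i j 0 = 1%g.
Proof.
rewrite /el; case: {-}_ / idP => // h.
by apply: GLmx_inj; rewrite -(elE h) GLmx_el // munit0 addr0.
Qed.

Lemma elD i j a b : (el i j a * el i j b)%g = el i j (a + b).
Proof.
case: (eqVneq i j) => [->|ij].
  by rewrite !el_diag mulg1.
apply: GLmx_inj; rewrite GLmxM !GLmx_el // mulmxDl mul1mx mulmxDr mulmx1.
by rewrite munitM eq_sym (negPf ij) addr0 munitD addrA addrAC -!addrA.
Qed.

Lemma elN i j a : el i j (- a) = ((el i j a)^-1)%g.
Proof. by apply: (mulgI (el i j a)); rewrite elD subrr el0 mulgV. Qed.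

End MatrixUnits.

Section Conjugation.
Variable T : groupType.
Implicit Types x y z : T.
Local Open Scope group_scope.

(* Restated at [groupType]: rewriting with the library versions leaves coercions
   of weaker structures behind that block further rewriting. *)
Lemma gmulA x y z : x * (y * z) = x * y * z. Proof. exact: mulgA. Qed.
Lemma ginvM x y : (x * y)^-1 = y^-1 * x^-1. Proof. exact: invgM. Qed.
Lemma ginvK x : x^-1^-1 = x. Proof. exact: invgK. Qed.
Lemma gmulVK x y : x * y^-1 * y = x. Proof. exact: mulgVK. Qed.
Lemma gmulK x y : x * y * y^-1 = x. Proof. exact: mulgK. Qed.
Lemma gmul1 x : x * 1 = x. Proof. exact: mulg1. Qed.
Lemma g1mul x : 1 * x = x. Proof. exact: mul1g. Qed.
Lemma gmulV x : x * x^-1 = 1. Proof. exact: mulgV. Qed.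
Lemma gmulVg x : x^-1 * x = 1. Proof. exact: mulVg. Qed.
Lemma ginv1 : 1^-1 = 1 :> T. Proof. exact: invg1. Qed.
Definition gsimpE :=
  (ginvM, ginvK, ginv1, gmulA, gmulVK, gmulK, gmul1, g1mul, gmulV, gmulVg).

Definition cj x y := x * y * x^-1.

Lemma cjM x y z : cj x (y * z) = cj x y * cj x z.
Proof. by rewrite /cj !mulgA mulgVK. Qed.
Lemma cj1 x : cj x 1 = 1.
Proof. by rewrite /cj mulg1 mulgV. Qed.
Lemma cj1g y : cj 1 y = y.
Proof. by rewrite /cj mul1g invg1 mulg1. Qed.
Lemma cjV x y : cj x y^-1 = (cj x y)^-1.
Proof. by rewrite /cj !invgM invgK mulgA. Qed.
Lemma cjMl x y z : cj (x * y) z = cj x (cj y z).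
Proof. by rewrite /cj invgM !mulgA. Qed.
Lemma cjVK x y : cj x (cj x^-1 y) = y.
Proof. by rewrite -cjMl mulgV cj1g. Qed.
Lemma cjP x y z : x * y = z * x -> cj x y = z.
Proof. by rewrite /cj => ->; rewrite mulgK. Qed.
Lemma cj_comm x y z : cj x (commutator y z) = commutator (cj x y) (cj x z).
Proof. by rewrite /commutator !cjM !cjV. Qed.
Lemma cj_cj x y z : cj x (cj y z) = cj (cj x y) (cj x z).
Proof. by rewrite /cj !gsimpE. Qed.
Lemma commutatorE x y : commutator x y = cj x y * y^-1.
Proof. by []. Qed.
Lemma commutatorV x y : (commutator x y)^-1 = commutator y x.
Proof. by rewrite /commutator !invgM !invgK !mulgA. Qed.

End Conjugation.

Section ElementaryRelations.
Variables (n : nat) (A : pzRingType).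
Implicit Types (i j k l p q : 'I_n) (a b c : A).
Local Open Scope group_scope.

Lemma cj_el_id p q i j c a : p != q -> i != j -> q != i -> p != j ->
  cj (el p q c) (el i j a) = el i j a :> GL n A.
Proof.
move=> pq ij qi pj; apply: cjP; apply: GLmx_inj; rewrite !GLmxM !GLmx_el //.
rewrite !(mulmxDl, mulmxDr, mul1mx, mulmx1) !munitM (negPf qi) eq_sym (negPf pj).
rewrite !addr0; exact: addrAC.
Qed.

Lemma cj_el_l p i j c a : p != i -> i != j -> p != j ->
  cj (el p i c) (el i j a) = el p j (c * a)%R * el i j a :> GL n A.
Proof.
move=> pi ij pj; apply: cjP; apply: GLmx_inj; rewrite !GLmxM !GLmx_el //.
rewrite !(mulmxDl, mulmxDr, mul1mx, mulmx1) !munitM eqxx.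
rewrite ![j == _]eq_sym (negPf pj) (negPf ij) !(mul0mx, addr0).
rewrite addrA; exact: addrAC.
Qed.

Lemma cj_el_r q i j c a : j != q -> i != j -> i != q ->
  cj (el j q c) (el i j a) = el i j a * el i q (- (a * c))%R :> GL n A.
Proof.
move=> jq ij iq; apply: cjP; apply: GLmx_inj; rewrite !GLmxM !GLmx_el //.
rewrite !(mulmxDl, mulmxDr, mul1mx, mulmx1) !munitM !eqxx.
rewrite ![q == _]eq_sym ![j == i]eq_sym (negPf iq) (negPf ij) (negPf jq).
rewrite !(mul0mx, addr0) munitN.
by rewrite [X in _ = X + _]addrAC addrA [X in _ = X + _]addrAC subrK.
Qed.

Lemma comm_el i j k a b : i != j -> j != k -> i != k ->
  commutator (el i j a) (el j k b) = el i k (a * b)%R :> GL n A.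
Proof. by move=> ij jk ik; rewrite commutatorE cj_el_l // mulgK. Qed.

End ElementaryRelations.

Section SubgroupTheory.
Variable T : groupType.
Implicit Types (x y z h : T) (H K N X : set T).
Local Open Scope group_scope.

Definition normalizes X N := forall h x, X h -> N x -> N (cj h x).

Lemma subgroup_bigcap (F : set (set T)) :
  F `<=` @is_subgroup T -> is_subgroup (\bigcap_(H in F) H).
Proof.
move=> hF; split=> [H /hF[] //|x y xF yF H FH|x xF H FH].
- by case: (hF _ FH) => _ + _; apply; [apply: xF|apply: yF].
- by case: (hF _ FH) => _ _; apply; apply: xF.
Qed.

Lemma generated_group X : is_subgroup (generated X).
Proof. by apply: subgroup_bigcap => H []. Qed.

Lemma generated_min X H : is_subgroup H -> X `<=` H -> generated X `<=` H.
Proof. exact: smallest_sub. Qed.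

Lemma mem_generated X : X `<=` generated X.
Proof. exact: sub_gen_smallest. Qed.

Lemma commutator_group H K : is_subgroup (commutator_subgroup H K).
Proof. exact: generated_group. Qed.

Lemma mem_commutator H K x y :
  H x -> K y -> commutator_subgroup H K (commutator x y).
Proof. by move=> Hx Ky; apply: mem_generated; exists x => //; exists y. Qed.

Lemma commutator_min H K N : is_subgroup N ->
  (forall x y, H x -> K y -> N (commutator x y)) ->
  commutator_subgroup H K `<=` N.
Proof.
by move=> gN hN; apply: generated_min => // _ [x Hx [y Ky <-]]; apply: hN.
Qed.

Lemma commutatorS H K H' K' : H `<=` H' -> K `<=` K' ->
  commutator_subgroup H K `<=` commutator_subgroup H' K'.
Proof.
move=> sH sK; apply: commutator_min => [|x y /sH Hx /sK Ky].
  exact: commutator_group.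
exact: mem_commutator.
Qed.

Lemma commutator_subC H K :
  commutator_subgroup H K `<=` commutator_subgroup K H.
Proof.
apply: commutator_min => [|x y Hx Ky]; first exact: commutator_group.
have [_ _ V] := commutator_group K H.
by rewrite -commutatorV; apply: V; apply: mem_commutator.
Qed.

Lemma commutator_norm X H K : normalizes X H -> normalizes X K ->
  normalizes X (commutator_subgroup H K).
Proof.
move=> nH nK h x Xh; have [o m v] := commutator_group H K.
apply: (@commutator_min _ _ (fun x => commutator_subgroup H K (cj h x))).
  split=> [|y z Hy Hz|y Hy]; rewrite ?cj1 ?cjM ?cjV //; [exact: m|exact: v].
move=> y z Hy Kz; rewrite cj_comm; apply: mem_commutator.
  exact: nH.
exact: nK.
Qed.

Lemma subgroup_normalizes H : is_subgroup H -> normalizes H H.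
Proof. by case=> _ m v h x Hh Hx; rewrite /cj; apply: (m) (v _ Hh); apply: m. Qed.

Section CommutingModulo.
Variables (E Q : set T).
Hypotheses (gE : is_subgroup E) (gQ : is_subgroup Q) (nQ : normalizes E Q).
Let Q1 : Q 1. Proof. by case: gQ. Qed.
Let QM x y : Q x -> Q y -> Q (x * y). Proof. by case: gQ => _ + _; apply. Qed.
Let QV x : Q x -> Q x^-1. Proof. by case: gQ => _ _; apply. Qed.

(** [Q] is normalized by [E] only, so the rules below ask that the factor conjugating a commutator
    lie in [E]. The other argument may be any element of the group, later one of a congruence
    subgroup. *)
Definition commute_mod x y := Q (commutator x y).

Lemma commute_modC x y : commute_mod x y -> commute_mod y x.
Proof. by rewrite /commute_mod -commutatorV => /QV; rewrite invgK. Qed.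

Lemma commute_modMr x y z :
  E y -> commute_mod x y -> commute_mod x z -> commute_mod x (y * z).
Proof.
move=> Ey xy xz; rewrite /commute_mod.
have -> : commutator x (y * z) = commutator x y * cj y (commutator x z).
  by rewrite /commutator /cj !gsimpE.
by apply: QM => //; apply: nQ.
Qed.

Lemma commute_modVr x y : E y -> commute_mod x y -> commute_mod x y^-1.
Proof.
move=> Ey xy; rewrite /commute_mod.
have -> : commutator x y^-1 = cj y^-1 (commutator x y)^-1.
  by rewrite commutatorV /commutator /cj !gsimpE.
by apply/nQ/QV => //; case: gE => _ _; apply.
Qed.

Lemma commute_modMl x y z :
  E x -> commute_mod x z -> commute_mod y z -> commute_mod (x * y) z.
Proof. by move=> Ex /commute_modC xz /commute_modC yz; apply/commute_modC/commute_modMr. Qed.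

Lemma commute_modVl x y : E x -> commute_mod x y -> commute_mod x^-1 y.
Proof. by move=> Ex /commute_modC xz; apply/commute_modC/commute_modVr. Qed.

Lemma commute_mod_cj h x y :
  E h -> commute_mod x y -> commute_mod (cj h x) (cj h y).
Proof. by move=> Eh xy; rewrite /commute_mod -cj_comm; apply: nQ. Qed.

Lemma commute_mod_cjl h x y :
  E h -> commute_mod x (cj h^-1 y) -> commute_mod (cj h x) y.
Proof. by move=> Eh /(commute_mod_cj Eh); rewrite cjVK. Qed.

End CommutingModulo.

End SubgroupTheory.

Section RelativeElementary.
Variables (n : nat) (A : pzRingType).
Implicit Types (i j k l p q h : 'I_n) (a b c x : A) (X : set A).
Notation G := (GL n A).

Definition elementaries X : set G :=
  [set g | exists i j x, [/\ i != j, X x & g = el i j x]].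

Definition elem_stable (H : set G) :=
  forall p q c g, p != q -> H g -> H (cj (el p q c) g).

(** [En_rel] for a plain set, so that products of ideals and ideals of the double need not be
    bundled. Stability under the generators [el p q c] replaces normality in [En]; the two agree by
    [En_relE]. *)
Definition rel_elem X : set G :=
  smallest (fun H => is_subgroup H /\ elem_stable H) (elementaries X).

Lemma rel_elem_group X : is_subgroup (rel_elem X).
Proof. by apply: subgroup_bigcap => H [[]]. Qed.

Lemma rel_elem_stable X : elem_stable (rel_elem X).
Proof.
move=> p q c g pq gX H hH; have [[_ sH] _] := hH.
by apply: (sH _ _ _ _ pq); exact: gX.
Qed.

Lemma mem_rel_elem X i j x : i != j -> X x -> rel_elem X (el i j x).
Proof. by move=> ij Xx; apply: sub_gen_smallest; exists i, j, x. Qed.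

Lemma rel_elem_min X H : is_subgroup H -> elem_stable H ->
  (forall i j x, i != j -> X x -> H (el i j x)) -> rel_elem X `<=` H.
Proof.
by move=> gH sH XH; apply: smallest_sub => // _ [i [j [x [ij Xx ->]]]]; apply: XH.
Qed.

Lemma EnE : @En n A = generated (elementaries setT).
Proof.
congr generated; apply/seteqP; split=> g.
  by case=> i [j [ij [a [_ ->]]]]; exists i, j, a; rewrite (elE ij).
by case=> i [j [a [ij _ ->]]]; exists i, j, ij, a; rewrite (elE ij).
Qed.

Lemma En_group : is_subgroup (@En n A).
Proof. exact: generated_group. Qed.

Lemma mem_En i j a : @En n A (el i j a).
Proof.
case: (eqVneq i j) => [->|ij]; first by rewrite el_diag; case: En_group.
by rewrite EnE; apply: mem_generated; exists i, j, a.
Qed.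

Lemma En_normalizes (N : set G) :
  is_subgroup N -> elem_stable N -> normalizes (@En n A) N.
Proof.
move=> gN sN h x + Nx; rewrite EnE => Eh.
suff [] : N (cj h x) /\ N (cj (h^-1)%g x) by [].
(* Both [u] and its inverse are recorded so that this set is closed under inverses. *)
pose P := [set u : G | forall y : G, N y -> N (cj u y) /\ N (cj (u^-1)%g y)].
suff: P h by move=> /(_ x Nx).
apply: generated_min Eh => [|g [i [j [a [ij _ ->]]]] y Ny]; last first.
  by rewrite -elN; split; apply: sN.
split=> [y Ny|g k Pg Pk y Ny|g Pg y Ny]; first by rewrite invg1 cj1g.
  rewrite invgM !cjMl; split.
    by apply: (Pg _ _).1; apply: (Pk _ _).1.
  by apply: (Pk _ _).2; apply: (Pg _ _).2.
by rewrite invgK; case: (Pg _ Ny).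
Qed.

Lemma rel_elem_En X : rel_elem X `<=` @En n A.
Proof.
apply: rel_elem_min => [|p q c g pq Eg|i j x ij _]; first exact: En_group.
  by apply: (subgroup_normalizes En_group) => //; apply: mem_En.
exact: mem_En.
Qed.

Lemma En_relE (I : twoSidedIdeal A) : En_rel n I = rel_elem [set a | a \in I].
Proof.
apply/seteqP; split.
  apply: smallest_sub.
    split; [exact: rel_elem_group|exact: rel_elem_En|].
    exact: (En_normalizes (@rel_elem_group _) (@rel_elem_stable _)).
  apply: generated_min; first exact: rel_elem_group.
  by move=> g [i [j [ij [a [aI ->]]]]]; rewrite -elE; apply: mem_rel_elem.
apply: rel_elem_min => [|p q c g pq gI N hN|i j x ij xI].
- by rewrite /En_rel /normal_closure; apply: subgroup_bigcap => N [[]].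
- by have [[_ _ nN] _] := hN; apply: nN; [apply: mem_En|exact: gI].
- apply: sub_gen_smallest; apply: mem_generated.
  by exists i, j, ij, x; rewrite (elE ij).
Qed.

End RelativeElementary.

(** * Commutators of relative elementary subgroups *)

Lemma third_index n (i j : 'I_n) : (2 < n)%N -> exists h, h != i /\ h != j.
Proof.
move=> n3; have : (0 < #|[predC [:: i; j]]|)%N.
  rewrite -(ltn_add2l #|[:: i; j]|) cardC addn0 card_ord.
  by apply: (leq_ltn_trans (card_size [:: i; j])); exact: n3.
by case/card_gt0P=> h; rewrite !inE negb_or => /andP[]; exists h.
Qed.

Definition is_ideal (A : pzRingType) (X : set A) :=
  [/\ X 0, forall x y, X x -> X y -> X (x - y),
      forall a x, X x -> X (a * x) & forall a x, X x -> X (x * a)].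

Lemma ideal_of (A : pzRingType) (I : twoSidedIdeal A) :
  is_ideal [set a | a \in I].
Proof.
split=> [|x y xI yI|a x xI|a x xI] /=; [exact: rpred0|exact: rpredB| |].
- exact: ideal_mull.
- exact: ideal_mulr.
Qed.

Section IdealTheory.
Variables (A : pzRingType) (X : set A).
Hypothesis iX : is_ideal X.
Lemma tideal0 : X 0. Proof. by case: iX. Qed.
Lemma tidealB x y : X x -> X y -> X (x - y). Proof. by case: iX => _ + _ _; apply. Qed.
Lemma tidealN x : X x -> X (- x).
Proof. by move=> Xx; rewrite -sub0r; apply: tidealB => //; apply: tideal0. Qed.
Lemma tidealD x y : X x -> X y -> X (x + y).
Proof. by move=> Xx /tidealN Xy; rewrite -[y]opprK; apply: tidealB. Qed.
Lemma tidealMl a x : X x -> X (a * x). Proof. by case: iX => _ _ + _; apply. Qed.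
Lemma tidealMr a x : X x -> X (x * a). Proof. by case: iX => _ _ _; apply. Qed.
End IdealTheory.

Section Vaserstein.
Variables (n : nat) (A : pzRingType).
Hypothesis n3 : (2 < n)%N.
Implicit Types (i j k l p q h : 'I_n) (a b c x : A) (X K L : set A).
Notation G := (GL n A).
Local Open Scope group_scope.

(** The generators z_ij(a, c) of Suslin and Vaserstein. *)
Definition el_conj i j a c : G := cj (el j i c) (el i j a).

Definition el_conjs X : set G :=
  generated [set g | exists i j a c, [/\ i != j, X a & g = el_conj i j a c]].

Section Stability.
Variable X : set A.
Hypothesis iX : is_ideal X.
Let Z := el_conjs X.
Let gZ : is_subgroup Z. Proof. exact: generated_group. Qed.
Let ZM u v : Z u -> Z v -> Z (u * v). Proof. by case: gZ => _ + _; apply. Qed.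
Let ZV u : Z u -> Z u^-1. Proof. by case: gZ => _ _; apply. Qed.

Lemma mem_el_conjs i j a c : i != j -> X a -> Z (el_conj i j a c).
Proof. by move=> ij Xa; apply: mem_generated; exists i, j, a, c. Qed.

Lemma el_el_conjs i j a : X a -> Z (el i j a).
Proof.
case: (eqVneq i j) => [->|ij] Xa; first by rewrite el_diag; case: gZ.
by have := mem_el_conjs 0%R ij Xa; rewrite /el_conj el0 cj1g.
Qed.

Lemma cj_el_el_conjs p q i j c a : p != q -> i != j -> X a ->
  Z (cj (el p q c) (el i j a)).
Proof.
move=> pq ij Xa.
have [qi|qi] := eqVneq q i; have [pj|pj] := eqVneq p j; subst.
- exact: mem_el_conjs.
- by rewrite cj_el_l //; apply: ZM; apply: el_el_conjs => //; apply: tidealMl.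
- rewrite cj_el_r //; last by rewrite eq_sym.
  by apply: ZM; apply: el_el_conjs => //; apply: tidealN => //; apply: tidealMr.
- by rewrite cj_el_id //; apply: el_el_conjs.
Qed.

Let hi_stable h i j a c d : i != j -> h != i -> h != j -> X a ->
  Z (cj (el h i d) (el_conj i j a c)).
Proof.
move=> ij hi hj Xa; rewrite /el_conj cj_cj.
rewrite (@cj_el_id _ _ h i j i) // 1?eq_sym // cj_el_l // cjM.
apply: ZM; last exact: mem_el_conjs.
by apply: cj_el_el_conjs => //; [rewrite eq_sym | apply: tidealMl].
Qed.

Let jh_stable h i j a c d : i != j -> h != i -> h != j -> X a ->
  Z (cj (el j h d) (el_conj i j a c)).
Proof.
move=> ij hi hj Xa; rewrite /el_conj cj_cj.
rewrite (@cj_el_id _ _ j h j i) // 1?[j == _]eq_sym // cj_el_r // 1?eq_sym // cjM.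
apply: ZM; first exact: mem_el_conjs.
apply: cj_el_el_conjs; rewrite // 1?eq_sym //.
by apply: tidealN => //; apply: tidealMr.
Qed.

Let el_conj_stable p q i j a c d : p != q -> i != j ->
  (p, q) != (i, j) -> X a -> Z (cj (el p q d) (el_conj i j a c)).
Proof.
move=> pq ij; rewrite xpair_eqE negb_and => pqij Xa.
have [qi|qi] := eqVneq q i; have [pj|pj] := eqVneq p j; subst.
- by rewrite /el_conj -cjMl elD; apply: mem_el_conjs.
- exact: hi_stable.
- by apply: jh_stable => //; rewrite eq_sym.
have [pi|pi] := eqVneq p i.
  subst; rewrite eqxx /= in pqij.
  rewrite /el_conj cj_cj cj_el_r // 1?eq_sym // (@cj_el_id _ _ i q i j) //.
  rewrite cjMl cj_el_r // 1?eq_sym // cjM; apply: ZM; first exact: mem_el_conjs.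
  apply: cj_el_el_conjs; rewrite // 1?eq_sym //.
  by apply: tidealN => //; apply: tidealMr.
have [qj|qj] := eqVneq q j.
  subst; rewrite /el_conj cj_cj cj_el_l // 1?eq_sym // (@cj_el_id _ _ p j i j) //.
  by rewrite cjMl; apply: hi_stable.
rewrite /el_conj cj_cj (@cj_el_id _ _ p q j i) // 1?eq_sym //.
by rewrite (@cj_el_id _ _ p q i j) //; apply: mem_el_conjs.
Qed.

(* Writing [el i j a] as a commutator through a third index [h] turns the
   conjugate by [el i j d * el j i c] into conjugates by row matrices. *)
Let el_conj_stable_same i j a c d : i != j -> X a ->
  Z (cj (el i j d) (el_conj i j a c)).
Proof.
move=> ij Xa; have [h [hi hj]] := third_index i j n3.
have ih : i != h by rewrite eq_sym.
have jh : j != h by rewrite eq_sym.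
have ji : j != i by rewrite eq_sym.
have comm r s : el h j r * el h i s = el h i s * el h j r :> G.
  by rewrite -[LHS](gmulVK _ (el h j r)) -/(cj _ _) cj_el_id.
have row k b r s : k \in [:: i; j] -> X b ->
    Z (cj (el h j r * el h i s) (el k h b)).
  rewrite !inE => /orP[] /eqP -> Xb.
    by rewrite cjMl; apply: (@el_conj_stable h j i h) => //; rewrite xpair_eqE (negPf hi).
  by rewrite comm cjMl; apply: (@el_conj_stable h i j h) => //; rewrite xpair_eqE (negPf hj).
have Xca e : X (e * a)%R by apply: tidealMl.
rewrite /el_conj -cjMl -[a]mulr1 -(comm_el a 1%R ih hj ij) cj_comm.
have -> u v : commutator u v = u * (cj v u)^-1 :> G.
  by rewrite /commutator /cj !gsimpE.
have -> : cj (el i j d * el j i c) (el h j 1%R) =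
    el h j (1 - - (1 * c) * d)%R * el h i (- (1 * c))%R.
  rewrite cjMl cj_el_r // cjM (@cj_el_id _ _ i j h j) // cj_el_r //.
  by rewrite -comm gmulA elD.
have -> : cj (el i j d * el j i c) (el i h a) =
    el i h (d * (c * a))%R * el j h (c * a)%R * el i h a.
  by rewrite cjMl cj_el_l // cjM cj_el_l // (@cj_el_id _ _ i j i h).
have Xd : X (d * (c * a))%R by apply: tidealMl.
apply: ZM; first by do !apply: ZM; apply: el_el_conjs.
by apply: ZV; rewrite !cjM; apply: (ZM (ZM _ _) _); apply: row; rewrite // !inE eqxx ?orbT.
Qed.

(** The group generated by the z_ij(a, c) is already stable under elementary conjugation. The only
    case beyond the Steinberg relations is conjugation of z_ij by e_ij, settled in
    [el_conj_stable_same]. *)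
Lemma rel_elem_conjs : rel_elem X `<=` Z.
Proof.
apply: rel_elem_min => // [p q d g pq|i j x ij Xx]; last exact: el_el_conjs.
apply: (@generated_min _ _ (fun g => Z (cj (el p q d) g))).
  split=> [|u v Zu Zv|u Zu]; rewrite ?cj1 ?cjM ?cjV; [by case: gZ| exact: ZM|exact: ZV].
move=> _ [i [j [a [c [ij Xa ->]]]]].
have [[-> ->]|pqij] := eqVneq (p, q) (i, j); first exact: el_conj_stable_same.
exact: el_conj_stable.
Qed.
End Stability.

(** Steinberg relations express the commutator of two elementary matrices through [a * b] or
    [b * a], except for opposite positions, which are therefore assumed. Vaserstein's generators
    carry this over from elementary matrices to [rel_elem X1], and stability carries it to
    [rel_elem X2]. *)
Lemma commutator_rel_elem X1 X2 (Q : set G) : is_ideal X1 -> is_ideal X2 ->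
  is_subgroup Q -> elem_stable Q ->
  (forall i j a b, i != j -> X1 a -> X2 b ->
     [/\ Q (el i j (a * b)%R), Q (el i j (b * a)%R) &
         Q (commutator (el i j a) (el j i b))]) ->
  forall u v, rel_elem X1 u -> rel_elem X2 v -> Q (commutator u v).
Proof.
move=> iX1 iX2 gQ sQ hQ.
have gE : is_subgroup (@En n A) := @En_group n A.
have nQ : normalizes (@En n A) Q by apply: En_normalizes.
have Ee i j a : @En n A (el i j a) by apply: mem_En.
have Q1 : Q 1 by case: gQ.
have QV (u : G) : Q u -> Q u^-1 by case: gQ => _ _; apply.
have comm1 i j k l a b : i != j -> k != l -> X1 a -> X2 b ->
    commute_mod Q (el i j a) (el k l b).
  move=> ij kl X1a X2b; rewrite /commute_mod commutatorE.
  have [jk|jk] := eqVneq j k; have [il|il] := eqVneq i l; subst.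
  - by have [] := hQ l k a b ij X1a X2b.
  - by rewrite cj_el_l // gmulK; have [] := hQ i l a b il X1a X2b.
  - rewrite -commutatorE -commutatorV commutatorE cj_el_l // 1?eq_sym // gmulK; apply: QV.
    by have [] := hQ k j a b _ X1a X2b; rewrite 1?eq_sym.
  - by rewrite cj_el_id // gmulV.
have comm2 i j a c k l b : i != j -> k != l -> X1 a -> X2 b ->
    commute_mod Q (el_conj i j a c) (el k l b).
  move=> ij kl X1a X2b; have ji : j != i by rewrite eq_sym.
  apply: (commute_mod_cjl nQ) => //; rewrite -elN.
  have [ik|ik] := eqVneq i k; have [jl|jl] := eqVneq j l; subst.
  (* The conjugate of [el k l b] by the opposite elementary matrix is written as [[x, y]], where [x]
     has its entries in [X2]. In [x * (cj y x)^-1] the conjugation by [y] is shifted onto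
     [el k l a], which becomes a product of two elementary matrices over [X1]. *)
  - have [h [hi hj]] := third_index k l n3.
    have kh : k != h by rewrite eq_sym.
    have lh : l != h by rewrite eq_sym.
    set d := (- c)%R; rewrite -[b]mulr1 -(comm_el b 1%R kh hj ij) cj_comm.
    rewrite cj_el_l // cj_el_r //; set x := _ * _; set s := (- _)%R.
    set y := _ * _.
    have Ex : @En n A x by case: gE => _ + _; apply.
    have Ey : @En n A y by case: gE => _ + _; apply.
    have cx i j e : i != j -> X1 e -> commute_mod Q (el i j e) x.
      move=> ij' X1e; apply: (commute_modMr gQ nQ) => //; apply: comm1 => //.
      exact: tidealMl.
    have -> : commutator x y = x * (cj y x)^-1 by rewrite /commutator /cj !gsimpE.
    apply: (commute_modMr gQ nQ) => //; first exact: cx.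
    apply: (commute_modVr gE gQ nQ).
      by apply: (subgroup_normalizes gE).
    rewrite -[el k l a](cjVK y); apply: (commute_mod_cj nQ) => //.
    rewrite /y ginvM -!elN cjMl (@cj_el_id _ _ h l k l) // 1?eq_sym // cj_el_l //.
    apply: (commute_modMl gQ nQ) => //; apply: cx => //.
    exact: tidealMl.
  - rewrite cj_el_l // 1?eq_sym //; apply: (commute_modMr gQ nQ) => //.
      by apply: comm1 => //; apply: tidealMl.
    exact: comm1.
  - rewrite cj_el_r // 1?eq_sym //; apply: (commute_modMr gQ nQ) => //.
      exact: comm1.
    by apply: comm1; rewrite // 1?eq_sym //; apply: tidealN => //; apply: tidealMr.
  - by rewrite cj_el_id // 1?eq_sym //; apply: comm1.
have comm3 u k l b : rel_elem X1 u -> k != l -> X2 b ->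
    commute_mod Q u (el k l b).
  move=> + kl X2b => /(rel_elem_conjs iX1) Zu.
  suff [] : [set u | @En n A u /\ commute_mod Q u (el k l b)] u by [].
  apply: generated_min Zu => [|_ [i [j [a [c [ij X1a ->]]]]]]; last first.
    by split; [apply: (subgroup_normalizes gE)|apply: comm2].
  case: (gE) => E1 EM EV; split=> [|v w [Ev Qv] [Ew Qw]|v [Ev Qv]]; split.
  - by [].
  - by rewrite /commute_mod /commutator ginv1 gmul1 g1mul gmulV.
  - exact: EM.
  - exact: (commute_modMl gQ nQ).
  - exact: EV.
  - exact: (commute_modVl gE gQ nQ).
move=> u v Xu Xv.
suff: forall u, rel_elem X1 u -> commute_mod Q u v by apply.
have /= [] // : [set v | @En n A v /\
   forall u, rel_elem X1 u -> commute_mod Q u v] v.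
apply: rel_elem_min Xv.
- case: (gE) => E1 EM EV; split=> [|w z [Ew Qw] [Ez Qz]|w [Ew Qw]]; split=> //.
  + by move=> z _; rewrite /commute_mod /commutator ginv1 !gmul1 gmulV.
  + exact: EM.
  + by move=> t Xt; apply: (commute_modMr gQ nQ) => //; [apply: Qw|apply: Qz].
  + exact: EV.
  + by move=> t Xt; apply: (commute_modVr gE gQ nQ) => //; apply: Qw.
- move=> p q c w pq [Ew Qw]; split; first exact: (subgroup_normalizes gE).
  (* The conjugation is undone on [t], which stays in [rel_elem X1]. *)
  move=> t Xt; rewrite -[t](cjVK (el p q c)); apply: (commute_mod_cj nQ) => //.
  by apply: Qw; rewrite -elN; apply: rel_elem_stable.
- by move=> i j x ij Xx; split=> // t Xt; apply: comm3.
Qed.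
End Vaserstein.

(** * Conjugation with denominators *)

Section Denominators.
Variables (R : comPzRingType) (D : pzRingType) (phi : {rmorphism R -> D}).
Hypothesis phiC : forall r x, phi r * x = x * phi r.
Variable n : nat.
Hypothesis n3 : (2 < n)%N.
Implicit Types (r s t u : R) (i j k l p q h : 'I_n) (a b c x : D) (X Y : set D).
Implicit Types (z w P Q : 'M[D]_n).

Definition sc r z : 'M[D]_n := phi r *: z.

Lemma sc_mull r z w : sc r z *m w = sc r (z *m w).
Proof. by rewrite /sc scalemxAl. Qed.
Lemma sc_mulr r z w : z *m sc r w = sc r (z *m w).
Proof.
apply/matrixP=> i j; rewrite !mxE mulr_sumr; apply: eq_bigr => k _.
by rewrite !mxE mulrA -phiC mulrA.
Qed.
Lemma scA r s z : sc r (sc s z) = sc (r * s) z.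
Proof. by rewrite /sc scalerA rmorphM. Qed.
Lemma sc1 z : sc 1 z = z.
Proof. by rewrite /sc rmorph1 scale1r. Qed.
Lemma scDr r z w : sc r (z + w) = sc r z + sc r w.
Proof. exact: scalerDr. Qed.
Lemma scN r z : sc r (- z) = - sc r z.
Proof. exact: scalerN. Qed.
Lemma sc0 r : sc r 0 = 0.
Proof. exact: scaler0. Qed.
Lemma sc_munit r i j x : sc r (munit i j x) = munit i j (phi r * x).
Proof. by rewrite /sc munit.unlock scalerA. Qed.
Definition scE := (scDr, scN, sc_mull, sc_mulr, scA, sc0).
Definition mulE := (@mulmxDl, @mulmxDr, @mulNmx, @mulmxN, @mul1mx, @mulmx1).

(* A matrix [z] at level [s] stands for the group element [1 + s z]; keeping
   [z] rather than [1 + s z] avoids dividing by [s], which may be a zero divisor. *)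
Inductive deep X s : 'M[D]_n -> Prop :=
| deep_gen i j x of i != j & X x : deep X s (munit i j x)
| deep_circ z w of deep X s z & deep X s w : deep X s (z + w + sc s (z *m w))
| deep_conj p q c z of p != q & deep X s z :
    deep X s ((1%:M + sc s (munit p q c)) *m z *m (1%:M - sc s (munit p q c))).

Definition lvl s z : 'M[D]_n := 1%:M + sc s z.

Lemma lvl_circ s z w : lvl s (z + w + sc s (z *m w)) = lvl s z *m lvl s w.
Proof. by rewrite /lvl !(mulE, scE); ncring. Qed.

Lemma munitMM i j k l a b : j != k -> munit i j a *m munit k l b = 0 :> 'M[D]_n.
Proof. by move=> jk; rewrite munitM (negPf jk). Qed.

Lemma munit_sq i j a b : i != j -> munit i j a *m munit i j b = 0 :> 'M[D]_n.
Proof. by move=> ij; rewrite munitMM // eq_sym. Qed.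

Section Ideal.
Variable X : set D.
Hypothesis iX : is_ideal X.

Lemma deep_rel_elem s z :
  deep X s z -> exists2 g : GL n D, rel_elem X g & GLmx g = lvl s z.
Proof.
have [_ gM _] := @rel_elem_group n D X.
elim=> [i j x ij Xx|{}z w _ [g Xg eg] _ [h Xh eh]|p q c {}z pq _ [g Xg eg]].
- exists (el i j (phi s * x)); last by rewrite GLmx_el // /lvl sc_munit.
  by apply: mem_rel_elem => //; apply: tidealMl.
- by exists (g * h)%g; [apply: gM | rewrite GLmxM eg eh lvl_circ].
- exists (cj (el p q (phi s * c)) g); first exact: rel_elem_stable.
  rewrite /cj -elN !GLmxM !GLmx_el // eg munitN /lvl -sc_munit.
  set e := sc s (munit p q c).
  have ee : e *m e = 0 by rewrite /e !scE munit_sq // sc0.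
  rewrite -[RHS]/(_ + _) -sc_mull -sc_mulr.
  by rewrite !mulE -[X in _ = X + _]addr0 -{1}[0]oppr0 -ee; ncring.
Qed.

Lemma deep0 s : deep X s 0.
Proof.
have [h [hi _]] := third_index (Ordinal (ltnW (ltnW n3))) (Ordinal (ltnW (ltnW n3))) n3.
by rewrite -(munit0 D h (Ordinal (ltnW (ltnW n3)))); apply: deep_gen => //; apply: tideal0.
Qed.

(** [z] at level [s * t] and [sc t z] at level [s] stand for the same element [1 + s t z]. *)
Lemma deep_sc s t z : deep X (s * t) z -> deep X s (sc t z).
Proof.
elim=> [i j x ij Xx|{}z w _ IHz _ IHw|p q c {}z pq _ IHz].
- by rewrite sc_munit; apply: deep_gen => //; apply: tidealMl.
- have -> : sc t (z + w + sc (s * t) (z *m w)) =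
      sc t z + sc t w + sc s (sc t z *m sc t w).
    by rewrite !scE; congr (_ + sc _ _); ring.
  exact: deep_circ.
- have := deep_conj (phi t * c) pq IHz.
  by rewrite -sc_munit scA sc_mulr sc_mull.
Qed.

Lemma deepD s z w : z *m w = 0 -> deep X s z -> deep X s w -> deep X s (z + w).
Proof. by move=> zw Xz /(deep_circ Xz); rewrite zw sc0 addr0. Qed.

(** Matrix units in one row, off the diagonal, multiply to zero, so that for them the circle
    composition of [deep] is addition. *)
Lemma deep_row s p z : (forall k l, k != p -> z k l = 0) -> z p p = 0 ->
  (forall k l, X (z k l)) -> deep X s z.
Proof.
move=> zrow zp Xz; have -> : z = \sum_(l < n) munit p l (z p l).
  apply/matrixP=> k l; rewrite munit.unlock summxE (bigD1 l) //= big1 => [|m /negPf ml].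
    rewrite !mxE eqxx andbT addr0; case: (eqVneq k p) => [->|/zrow->] /=.
      by rewrite mulr1.
    by rewrite mulr0.
  by rewrite !mxE [l == m]eq_sym ml andbF mulr0.
suff [] : deep X s (\sum_(l < n) munit p l (z p l)) /\
  forall k a, k != p -> munit p k a *m (\sum_(l < n) munit p l (z p l)) = 0 by [].
apply: (big_rec (fun w => deep X s w /\
  forall k a, k != p -> munit p k a *m w = 0)) => [|l w _ [Xw w0]].
  by split=> [|k a _]; [exact: deep0|rewrite mulmx0].
have [->|lp] := eqVneq l p; first by rewrite zp munit0 add0r.
split=> [|k a kp]; last by rewrite mulmxDr w0 // munitMM // addr0.
by apply: deepD; rewrite ?w0 //; apply: deep_gen; rewrite // eq_sym.
Qed.

Lemma deep_col s p z : (forall k l, l != p -> z k l = 0) -> z p p = 0 ->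
  (forall k l, X (z k l)) -> deep X s z.
Proof.
move=> zcol zp Xz; have -> : z = \sum_(k < n) munit k p (z k p).
  apply/matrixP=> k l; rewrite munit.unlock summxE (bigD1 k) //= big1 => [|m /negPf mk].
    rewrite !mxE eqxx addr0; case: (eqVneq l p) => [->|/zcol->] /=.
      by rewrite mulr1.
    by rewrite mulr0.
  by rewrite !mxE [k == m]eq_sym mk mulr0.
suff [] : deep X s (\sum_(k < n) munit k p (z k p)) /\
  forall k a, k != p -> (\sum_(k < n) munit k p (z k p)) *m munit k p a = 0 by [].
apply: (big_rec (fun w => deep X s w /\
  forall k a, k != p -> w *m munit k p a = 0)) => [|l w _ [Xw w0]].
  by split=> [|k a _]; [exact: deep0|rewrite mul0mx].
have [->|lp] := eqVneq l p; first by rewrite zp munit0 add0r.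
split=> [|k a kp]; last by rewrite mulmxDl w0 // munitMM 1?eq_sym // addr0.
by rewrite addrC; apply: deepD; rewrite ?w0 //; apply: deep_gen.
Qed.
End Ideal.

Lemma deep_unit_conj X s z : deep setT s z -> exists z',
  [/\ lvl s z *m z' = 1%:M, z' *m lvl s z = 1%:M &
      forall w, deep X s w -> deep X s (lvl s z *m w *m z')].
Proof.
elim=> [i j x ij _|{}z w _ [z' [zz z'z cz]] _ [w' [ww w'w cw]]|
        p q c {}z pq _ [z' [zz z'z cz]]].
- exists (1%:M - sc s (munit i j x)).
  have ee : sc s (munit i j x) *m sc s (munit i j x) = 0.
    by rewrite !scE munit_sq // !sc0.
  split=> [||w Xw]; [rewrite /lvl !mulE ee; ncring..|].
  exact: deep_conj.
- exists (w' *m z'); rewrite lvl_circ; split=> [||t Xt].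
  + by rewrite mulmxA -(mulmxA (lvl s z)) ww mulmx1.
  + by rewrite mulmxA -(mulmxA w') z'z mulmx1.
  + by have := cz _ (cw _ Xt); rewrite !mulmxA.
- set e := sc s (munit p q c).
  have ee : e *m e = 0 by rewrite /e !scE munit_sq // !sc0.
  have ep : (1%:M + e) *m (1%:M - e) = 1%:M by rewrite !mulE ee; ncring.
  have em : (1%:M - e) *m (1%:M + e) = 1%:M by rewrite !mulE ee; ncring.
  have -> : lvl s ((1%:M + e) *m z *m (1%:M - e)) = (1%:M + e) *m lvl s z *m (1%:M - e).
    by rewrite /lvl -{1}ep -sc_mull -sc_mulr -mulmxDl; ncring.
  exists ((1%:M + e) *m z' *m (1%:M - e)); split=> [||w Xw].
  + by rewrite !mulmxA -(mulmxA _ (1%:M - e)) em mulmx1 -(mulmxA (1%:M + e)) zz mulmx1.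
  + by rewrite !mulmxA -(mulmxA _ (1%:M - e)) em mulmx1 -(mulmxA (1%:M + e)) z'z mulmx1.
  + have Xw' : deep X s ((1%:M - e) *m w *m (1%:M + e)).
      have := deep_conj (- c) pq Xw.
      by rewrite munitN scN opprK.
    have := deep_conj c pq (cz _ Xw').
    by rewrite !mulmxA.
Qed.

Definition inv_mod t P Q := P *m Q = sc t 1%:M /\ Q *m P = sc t 1%:M.

(* If [P Q = Q P = t], conjugation by [P] sends level [s * t * u] to level [s]
   via [z |-> u P z Q]. *)
Lemma deep_Ad X P Q s t u : is_ideal X -> inv_mod t P Q ->
  (forall Y, is_ideal Y -> forall i j x, i != j -> Y x ->
     deep Y s (sc u (P *m munit i j x *m Q))) ->
  forall z, deep X (s * t * u) z -> deep X s (sc u (P *m z *m Q)).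
Proof.
move=> iX [PQ QP] gen z; elim=> [i j x ij Xx|{}z w _ IHz _ IHw|p q c {}z pq _ IHz].
- exact: gen.
- have -> : sc u (P *m (z + w + sc (s * t * u) (z *m w)) *m Q) =
    sc u (P *m z *m Q) + sc u (P *m w *m Q) +
    sc s (sc u (P *m z *m Q) *m sc u (P *m w *m Q)).
    rewrite !(mulE, scE) !mulmxA -(mulmxA _ Q P) QP !(mulE, scE).
    by congr (_ + sc _ _); ring.
  exact: deep_circ.
set U := munit p q c.
have iT : is_ideal [set: D] by [].
have UU : U *m U = 0 by rewrite munit_sq.
(* Since [P (1 + s t u U) = (1 + s w) P], the inner conjugation by [U] becomes conjugation by
   [lvl s w]. This is admissible because [w] is deep over the unit ideal; its inverse is [1 - s w]
   because [U U = 0]. *)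
set w := sc u (P *m U *m Q).
have [w' [ww' w'w cw]] := deep_unit_conj X (gen _ iT p q c pq I).
have {w'w} ww2 : (1%:M - sc s w) *m lvl s w = 1%:M.
  rewrite /lvl !(mulE, scE) !mulmxA -(mulmxA _ Q P) QP !(mulE, scE).
  by rewrite -(mulmxA _ U U) UU mulmx0 mul0mx !sc0; ncring.
have ew' : w' = 1%:M - sc s w by rewrite -[w']mul1mx -{1}ww2 -mulmxA ww' mulmx1.
set e := sc (s * t * u) U.
have stu : s * u * t = s * t * u by rewrite mulrAC.
have Pe : P *m (1%:M + e) = lvl s w *m P.
  by rewrite /lvl !(mulE, scE) -!mulmxA QP !(mulE, scE) stu.
have eQ : (1%:M - e) *m Q = Q *m (1%:M - sc s w).
  by rewrite /e -stu !(mulE, scE) !mulmxA QP !(mulE, scE).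
have := cw _ IHz; rewrite ew'.
suff -> : lvl s w *m sc u (P *m z *m Q) *m (1%:M - sc s w) =
  sc u (P *m ((1%:M + e) *m z *m (1%:M - e)) *m Q) by [].
by rewrite sc_mulr sc_mull -!mulmxA -eQ !mulmxA -Pe.
Qed.

(* The conjugate of [munit i j x] by [r + c e_ji] is, up to the factor [s],
   a commutator through a third index. *)
Lemma deep_Ad_el X p q c r s i j x : is_ideal X -> p != q -> i != j -> X x ->
  deep X s (sc s ((sc r 1%:M + munit p q c) *m munit i j x *m
                  (sc r 1%:M - munit p q c))).
Proof.
move=> iX pq ij Xx; have ji : j != i by rewrite eq_sym.
have Xl a y : X y -> X (a * y) by apply: tidealMl.
have Xr b y : X y -> X (y * b) by apply: tidealMr.
have [qi|qi] := eqVneq q i; have [pj|pj] := eqVneq p j; subst.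
- have [h [hi hj]] := third_index i j n3.
  have ih : i != h by rewrite eq_sym.
  have jh : j != h by rewrite eq_sym.
  (* Chosen so that [k z] is the conjugate in question while [z k = 0]. Conjugating [z] by [1 + s k]
     then gives [z + s k z], and composing with [- z] leaves [s k z], whence the factor [s]. *)
  set k := munit i h (phi r) + munit j h c.
  set z := munit h j (phi r * x) - munit h i (x * c).
  have Xxc : X (x * c) by apply: Xr.
  have zk : z *m k = 0.
    rewrite !mulE !munitM eqxx (negPf ij) (negPf ji).
    by rewrite !eqxx -[x * c * phi r]phiC mulrA; ncring.
  have zz : z *m z = 0 by rewrite !mulE !munitMM // -?[i == h]eq_sym; ncring.
  have kk : k *m k = 0 by rewrite !mulE !munitMM //; ncring.
  have Xz y : X y -> deep X s (munit h j (phi r * y) - munit h i (y * c)).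
    move=> Xy; rewrite -munitN; apply: deepD.
    + by rewrite munitMM // eq_sym.
    + by apply: deep_gen => //; apply: Xl.
    + by apply: deep_gen => //; apply: tidealN => //; apply: Xr.
  have ek : k = munit i h (phi r) + munit j h c by [].
  have ez : munit h j (phi r * x) - munit h i (x * c) = z by [].
  clearbody k z.
  have Xkz : deep X s ((1%:M + sc s k) *m z *m (1%:M - sc s k)).
    have := deep_conj c jh (deep_conj (phi r) ih (Xz x Xx)); rewrite ez.
    set a := sc s (munit i h _); set b := sc s (munit j h _).
    have ab : a *m b = 0 by rewrite /a /b !scE munitMM // !sc0.
    have ba : b *m a = 0 by rewrite /a /b !scE munitMM // !sc0.
    rewrite ek scDr -/a -/b !mulmxA.
    have -> : (1%:M + b) *m (1%:M + a) = 1%:M + (a + b).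
      by rewrite !mulE ba; ncring.
    rewrite -!(mulmxA _ (1%:M - a)).
    have -> // : (1%:M - a) *m (1%:M - b) = 1%:M - (a + b).
    by rewrite !mulE ab; ncring.
  have Xnz : deep X s (- z).
    by have := Xz _ (tidealN iX Xx); rewrite mulrN mulNr !munitN -opprD ez.
  have ezk : (1%:M + sc s k) *m z *m (1%:M - sc s k) = z + sc s (k *m z).
    by rewrite !(mulE, scE) -mulmxA zk mulmx0 !sc0; ncring.
  have := deep_circ Xkz Xnz.
  have -> : (1%:M + sc s k) *m z *m (1%:M - sc s k) - z +
      sc s ((1%:M + sc s k) *m z *m (1%:M - sc s k) *m - z) = sc s (k *m z).
    by rewrite ezk !(mulE, scE) -mulmxA zz mulmx0 !(sc0, oppr0); ncring.
  congr (deep _ _ (sc _ _)).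
  rewrite ek -ez !(mulE, scE) !(munitM, sc_munit) ?eqxx.
  rewrite !sc_munit munitM eqxx rmorphM !mulrA -[c * phi r]phiC.
  by ncring.
- have pU : munit p i c *m munit i j x *m munit p i c = 0.
    by rewrite -mulmxA munitMM ?mulmx0 // eq_sym.
  have -> : sc s ((sc r 1%:M + munit p i c) *m munit i j x *m
      (sc r 1%:M - munit p i c)) = munit i j (phi (s * r * r) * x) +
      munit p j (phi (s * r) * (c * x)).
    rewrite !(mulE, scE) pU (munitMM _ _ x c (_ : j != p)) 1?eq_sym //.
    by rewrite munitM eqxx !sc_munit !sc0; ncring.
  apply: deepD; first by rewrite munitMM // 1?eq_sym.
    by apply: deep_gen => //; apply: Xl.
  by apply: deep_gen => //; apply: (Xl); apply: Xl.
- have pU : munit j q c *m munit i j x = 0 by rewrite munitMM.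
  have -> : sc s ((sc r 1%:M + munit j q c) *m munit i j x *m
      (sc r 1%:M - munit j q c)) = munit i q (phi (s * r) * (- (x * c))) +
      munit i j (phi (s * r * r) * x).
    rewrite !(mulE, scE) pU mul0mx munitM eqxx !sc_munit !sc0 mulrN munitN.
    by ncring.
  apply: deepD; first by rewrite munitMM.
    by apply: deep_gen; rewrite // 1?eq_sym //; apply: Xl; apply: tidealN => //; apply: Xr.
  by apply: deep_gen => //; apply: Xl.
- have pU : munit p q c *m munit i j x = 0 by rewrite munitMM.
  have Up : munit i j x *m munit p q c = 0 by rewrite munitMM // eq_sym.
  rewrite !(mulE, scE) pU Up mul0mx !sc0 oppr0 !addr0 sc_munit.
  by apply: deep_gen => //; apply: Xl.
Qed.

Lemma inv_mod_el p q c r : p != q ->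
  inv_mod (r * r) (sc r 1%:M + munit p q c) (sc r 1%:M - munit p q c).
Proof. by move=> pq; split; rewrite !(mulE, scE) munit_sq //; ncring. Qed.

Lemma munit_mulE p q c z k l :
  (munit p q c *m z) k l = if k == p then c * z q l else 0.
Proof.
rewrite munit.unlock mxE (bigD1 q) //= big1 => [|m /negPf mq]; last first.
  by rewrite !mxE mq andbF mulr0 mul0r.
by rewrite !mxE eqxx andbT addr0; case: (k == p); rewrite ?mulr1 ?mulr0 ?mul0r.
Qed.

Lemma mul_munitE p q c z k l :
  (z *m munit p q c) k l = if l == q then z k p * c else 0.
Proof.
rewrite munit.unlock mxE (bigD1 p) //= big1 => [|m /negPf mp]; last first.
  by rewrite !mxE mp mulr0 mulr0.
by rewrite !mxE eqxx addr0; case: (l == q); rewrite /= ?mulr1 ?mulr0.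
Qed.

Lemma lvl_sc s t z : lvl s (sc t z) = lvl (s * t) z.
Proof. by rewrite /lvl scA. Qed.

(** The matrices are diag(r, .., x, .., r) and diag(r', .., x', .., r') with the exceptional entry
    at [h], written as scalar plus matrix unit like the elementary factors. *)
Lemma inv_mod_diag h x x' r r' :
  x * x' = phi (r * r') -> x' * x = phi (r * r') ->
  inv_mod (r * r') (sc r 1%:M + munit h h (x - phi r))
                   (sc r' 1%:M + munit h h (x' - phi r')).
Proof.
move=> xx' x'x.
have hh a b : munit h h a *m munit h h b = munit h h (a * b) :> 'M[D]_n.
  by rewrite munitM eqxx.
have e1 : sc r (munit h h (x' - phi r')) + sc r' (munit h h (x - phi r)) +
    munit h h (x - phi r) *m munit h h (x' - phi r') = 0.
  rewrite hh !sc_munit -!munitD -(munit0 D h h); congr munit.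
  transitivity (phi r' * x - x * phi r' + (x * x' - phi r' * phi r)); first by ncring.
  by rewrite xx' rmorphM !(phiC r') !subrr addr0.
have e2 : sc r (munit h h (x' - phi r')) + sc r' (munit h h (x - phi r)) +
    munit h h (x' - phi r') *m munit h h (x - phi r) = 0.
  rewrite hh !sc_munit -!munitD -(munit0 D h h); congr munit.
  transitivity (phi r * x' - x' * phi r + (x' * x - phi r * phi r')); first by ncring.
  by rewrite x'x rmorphM phiC !subrr addr0.
split; rewrite !(mulE, scE).
  by rewrite -[RHS]addr0 -e1; ncring.
have er : r' * r = r * r' by ring.
by rewrite -[RHS]addr0 -e2 er; ncring.
Qed.

Section Good.
Variables (J : set D) (M : R -> Prop) (i0 i1 : 'I_n).
Hypotheses (iJ : is_ideal J) (M1 : M 1).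
Hypothesis MM : forall r s, M r -> M s -> M (r * s).

Definition corner z := (forall k l, J (z k l)) /\
  forall k l, (k \notin [:: i0; i1]) || (l \notin [:: i0; i1]) -> z k l = 0.

(** Models [[e_ij(a), e_ji(b)]] for the indices [i0], [i1], with the inverse at the same level. *)
Definition corner_unit s z := corner z /\ exists z',
  [/\ corner z', lvl s z *m lvl s z' = 1%:M & lvl s z' *m lvl s z = 1%:M].

Lemma corner_sc r z : corner z -> corner (sc r z).
Proof.
case=> Jz z0; split=> k l; rewrite !mxE; first exact: tidealMl.
by move=> kl; rewrite z0 // mulr0.
Qed.

Lemma corner_unit_sc s t z : corner_unit (s * t) z -> corner_unit s (sc t z).
Proof.
case=> cz [z' [cz' zz z'z]]; split; first exact: corner_sc.
by exists (sc t z'); rewrite !lvl_sc; split=> //; apply: corner_sc.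
Qed.

(* With [Q] standing for [t / P], conjugation by [P] sends elementary matrices of
   sufficiently deep level into [E(J)], and multiplies corner matrices of
   sufficiently deep level by elements of [E(J)] only. *)
Definition good P Q t := [/\ M t, inv_mod t P Q & forall s, M s ->
  exists2 u, M u &
    (forall z, deep J (s * t * u) z -> deep J s (sc u (P *m z *m Q))) /\
    (forall z, corner_unit (s * t * u) z -> exists2 d, deep J s d &
       sc u (P *m z *m Q) = d *m lvl (s * t * u) z + sc (t * u) z)].

Lemma good_mul P Q t P' Q' t' :
  good P Q t -> good P' Q' t' -> good (P *m P') (Q' *m Q) (t * t').
Proof.
case=> Mt [PQ QP] gP [Mt' [PQ' QP'] gP']; split; first exact: MM.
  split.
    by rewrite -mulmxA (mulmxA P') PQ' !(mulE, scE) PQ scE mulrC.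
  by rewrite -mulmxA (mulmxA Q) QP !(mulE, scE) QP' scE.
move=> s Ms; have [u Mu [dP cP]] := gP s Ms.
(* [P'] acts first, so it has to land at the level [s * t * u] from which [P] starts. *)
have [u' Mu' [dP' cP']] := gP' _ (MM (MM Ms Mt) Mu).
have Lev : s * (t * t') * (u * u') = s * t * u * t' * u' by ring.
exists (u * u'); first exact: MM.
rewrite Lev; split=> z.
  by move=> /dP' /dP; rewrite !(mulE, scE) !mulmxA.
move=> cz; have [d' Jd' ed'] := cP' z cz.
have cz1 : corner_unit (s * t * u) (sc (t' * u') z).
  by apply: corner_unit_sc; rewrite mulrA.
have [d Jd ed] := cP _ cz1.
rewrite lvl_sc mulrA in ed.
set L := lvl _ z in ed ed' *.
exists (sc u (P *m d' *m Q) + d + sc s (sc u (P *m d' *m Q) *m d)).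
  by apply: deep_circ => //; apply: dP.
set z1 := sc (t' * u') z in ed ed' cz1.
have eL : L = 1%:M + sc (s * t * u) z1 by rewrite /L /lvl /z1 scA mulrA.
have -> : sc (t * t' * (u * u')) z = sc (t * u) z1.
  by rewrite /z1 scA; congr sc; ring.
have -> : sc (u * u') (P *m P' *m z *m (Q' *m Q)) =
    sc u (P *m (d' *m L + z1) *m Q).
  by rewrite -ed' !(mulE, scE) !mulmxA.
clearbody z1 L; set e := sc u (P *m d' *m Q).
have -> : sc u (P *m (d' *m L + z1) *m Q) =
    e *m (1%:M + sc s (sc u (P *m z1 *m Q))) + sc u (P *m z1 *m Q).
  rewrite eL /e !(mulE, scE) !mulmxA -(mulmxA _ Q P) QP !(mulE, scE).
  by congr (_ + sc _ _ + _); ring.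
have -> : 1%:M + sc s (sc u (P *m z1 *m Q)) = (1%:M + sc s d) *m L.
  rewrite ed scDr scA mulrA mulmxDl mul1mx sc_mull.
  by rewrite [in X in _ = X + _]eL; ncring.
by rewrite ed -[sc s (e *m d)]sc_mulr; ncring.
Qed.

Lemma good_up_l (a : R) P Q t : M a -> good P Q t -> good (sc a P) Q (a * t).
Proof.
move=> Ma [Mt [PQ QP] gP]; split; first exact: MM.
  by split; rewrite !scE ?PQ ?QP !scE.
move=> s Ms; have [u Mu [dP cP]] := gP s Ms; exists u => //.
have -> : s * (a * t) * u = s * t * u * a by ring.
split=> z.
  by move=> /(deep_sc iJ) /dP; rewrite !scE.
move=> /corner_unit_sc /cP[d Jd]; rewrite lvl_sc !scE => ed.
exists d => //; rewrite ed; congr (_ + sc _ _); ring.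
Qed.

Lemma good_up_r (a : R) P Q t : M a -> good P Q t -> good P (sc a Q) (a * t).
Proof.
move=> Ma [Mt [PQ QP] gP]; split; first exact: MM.
  by split; rewrite !scE ?PQ ?QP !scE.
move=> s Ms; have [u Mu [dP cP]] := gP s Ms; exists u => //.
have -> : s * (a * t) * u = s * t * u * a by ring.
split=> z.
  by move=> /(deep_sc iJ) /dP; rewrite !scE.
move=> /corner_unit_sc /cP[d Jd]; rewrite lvl_sc !scE => ed.
exists d => //; rewrite ed; congr (_ + sc _ _); ring.
Qed.

Lemma good_down (a b : R) P Q t : M a -> M b -> M t -> inv_mod t P Q ->
  good (sc a P) (sc b Q) (a * b * t) -> good P Q t.
Proof.
move=> Ma Mb Mt PQ [_ _ gP]; split=> // s Ms.
have [u Mu [dP cP]] := gP s Ms; exists (u * (a * b)).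
  by apply: MM => //; apply: MM.
have -> : s * t * (u * (a * b)) = s * (a * b * t) * u by ring.
split=> z.
  by move=> /dP; rewrite !scE; congr (deep _ _ (sc _ _)); ring.
move=> /cP[d Jd]; rewrite !scE => ed; exists d => //.
have -> : u * (a * b) = u * b * a by ring.
by rewrite ed; congr (_ + sc _ _); ring.
Qed.

(** Goodness depends on [P] only up to scalars in [M]: [t] and [P] determine the quasi-inverse up to
    such scalars, so it may be rescaled along with [P]. Identities between matrices are therefore
    needed only after multiplication by a scalar. *)
Lemma good_ext (a b : R) P Q t P' Q' t' : M a -> M b -> M t' -> good P Q t ->
  inv_mod t' P' Q' -> sc a P = sc b P' -> good P' Q' t'.
Proof.
move=> Ma Mb Mt' gP PQ' eP; have [Mt [PQ QP] _] := gP.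
apply: (@good_down b (a * t)) => //; first exact: MM.
have -> : b * (a * t) * t' = b * t' * (a * t) by ring.
rewrite -eP; have -> : sc (a * t) Q' = sc (b * t') Q.
  case: PQ' => PQ' QP'.
  have : Q *m sc a P *m Q' = Q *m sc b P' *m Q' by rewrite eP.
  by rewrite !scE -!mulmxA PQ' !(mulE, scE) mulmxA QP !(mulE, scE).
by apply: good_up_r; [apply: MM|apply: good_up_l].
Qed.

Lemma good_el_off p q c r : p != q -> M r ->
  (p \notin [:: i0; i1]) || (q \notin [:: i0; i1]) ->
  good (sc r 1%:M + munit p q c) (sc r 1%:M - munit p q c) (r * r).
Proof.
move=> pq Mr pqi; split; [exact: MM|exact: inv_mod_el|].
move=> s Ms; exists s => //; split=> z.
  apply: deep_Ad => //; first exact: inv_mod_el.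
  by move=> Y iY i j x ij Yx; apply: deep_Ad_el.
case=> [[Jz z0] [z' [[Jz' z'0] zz z'z]]].
set U := munit p q c; set L := s * (r * r) * s in zz z'z *.
have er : r * r * s = s * r * r by ring.
have zU : p \notin [:: i0; i1] -> z *m U = 0.
  move=> pi; apply/matrixP=> k l; rewrite mul_munitE mxE.
  by case: ifP => // _; rewrite z0 ?mul0r // pi orbT.
have Uz : q \notin [:: i0; i1] -> U *m z = 0.
  move=> qi; apply/matrixP=> k l; rewrite munit_mulE mxE.
  by case: ifP => // _; rewrite z0 ?mulr0 // qi.
have [pi|pi] := boolP (p \in [:: i0; i1]).
  rewrite pi /= in pqi.
  exists (- sc (s * r) (z *m U)).
    apply: (@deep_col J iJ s q) => [k l lq||k l].
    - by rewrite 2!mxE mul_munitE (negPf lq) mulr0 oppr0.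
    - by rewrite 2!mxE mul_munitE eqxx z0 ?mul0r ?mulr0 ?oppr0 // pqi.
    - rewrite 2!mxE mul_munitE; apply: tidealN => //; apply: tidealMl => //.
      by case: ifP => _; [apply: tidealMr|apply: tideal0].
  rewrite /lvl !(mulE, scE) -(mulmxA z U z) Uz // mulmx0 mul0mx !sc0 er.
  by ncring.
(* The extra term is [s r U z], which has to be written as [d] times [lvl L z]; hence the inverse
   [lvl L z']. Column [p] of [z] and of [z'] vanishes, so [d] has no diagonal entry. *)
exists (sc (s * r) (U *m z *m lvl L z')).
  have colz k : (z *m lvl L z') k p = 0.
    rewrite /lvl !(mulE, scE) !mxE z0 ?pi ?orbT // add0r big1 ?mulr0 // => m _.
    by rewrite z'0 ?pi ?orbT // mulr0.
  have Jzz k l : J ((z *m lvl L z') k l).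
    rewrite mxE; apply: (big_ind J) => [||m _]; first exact: tideal0.
      exact: tidealD.
    exact: tidealMr.
  apply: (@deep_row J iJ s p) => [k l kp||k l]; rewrite -mulmxA mxE munit_mulE.
  - by rewrite (negPf kp) mulr0.
  - by rewrite eqxx colz !mulr0.
  - apply: tidealMl => //.
    by case: ifP => _; [apply: tidealMl|apply: tideal0].
rewrite sc_mull -(mulmxA _ (lvl L z')) z'z mulmx1.
rewrite !(mulE, scE) -(mulmxA U z U) zU // mulmx0 !sc0 er.
by ncring.
Qed.

Lemma good_el p q c r : p != q -> M r ->
  good (sc r 1%:M + munit p q c) (sc r 1%:M - munit p q c) (r * r).
Proof.
move=> pq Mr.
have [h [hp hq]] := third_index p q n3.
have ph : p != h by rewrite eq_sym.
have [|] := boolP ((p \notin [:: i0; i1]) || (q \notin [:: i0; i1])).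
  exact: good_el_off.
rewrite negb_or !negbK => /andP[pi qi].
have hi : h \notin [:: i0; i1].
  move: pi qi; rewrite !inE => /orP[] /eqP ep /orP[] /eqP eq; subst;
  by rewrite ?eqxx in pq *; rewrite negb_or ?hp ?hq.
have g1 e : good (sc r 1%:M + munit p h e) (sc r 1%:M - munit p h e) (r * r).
  by apply: good_el_off; rewrite // hi orbT.
have g2 e : good (sc 1 1%:M + munit h q e) (sc 1 1%:M - munit h q e) (1 * 1).
  by apply: good_el_off; rewrite // hi.
(* This commutator through [h], cleared of denominators, is [r] times the required matrix. *)
have := good_mul (good_mul (g1 c) (g2 1)) (good_mul (g1 (- c)) (g2 (- 1))).
move/(good_ext M1 Mr (MM Mr Mr)); apply; first exact: inv_mod_el.
rewrite !sc1 !munitN; set x := munit p h c; set y := munit h q 1.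
have xy : x *m y = munit p q c by rewrite /x /y munitM eqxx mulr1.
have yx : y *m x = 0 by rewrite /x /y munitMM // eq_sym.
have xx : x *m x = 0 by rewrite /x munitMM.
have yy : y *m y = 0 by rewrite /y munitMM // eq_sym.
rewrite -xy !(mulE, scE) !mulmxA.
have xyy : x *m y *m y = 0 by rewrite -mulmxA yy mulmx0.
have xyx : x *m y *m x = 0 by rewrite -mulmxA yx mulmx0.
rewrite xyy xyx yy yx xx !mul0mx !sc0; ncring.
Qed.

(** A diagonal matrix sends matrix units to matrix units, and with [h] outside the corner it
    multiplies corner matrices by the scalar [r * r'] only, so that [u = 1] and [d = 0] serve. *)
Lemma good_diag h x x' r r' : h \notin [:: i0; i1] -> M (r * r') ->
  x * x' = phi (r * r') -> x' * x = phi (r * r') ->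
  good (sc r 1%:M + munit h h (x - phi r))
       (sc r' 1%:M + munit h h (x' - phi r')) (r * r').
Proof.
move=> hi Mt xx' x'x; have PQ := inv_mod_diag h xx' x'x.
split=> // s Ms; exists 1 => //; rewrite !mulr1; split=> z.
  rewrite -[s * _]mulr1; apply: deep_Ad => //.
  move=> Y iY i j y ij Yy; rewrite sc1.
  have -> : (sc r 1%:M + munit h h (x - phi r)) *m munit i j y *m
      (sc r' 1%:M + munit h h (x' - phi r')) =
      munit i j ((if i == h then x else phi r) * y * (if j == h then x' else phi r')).
    have -> : (sc r 1%:M + munit h h (x - phi r)) *m munit i j y =
        munit i j ((if i == h then x else phi r) * y).
      rewrite mulmxDl sc_mull mul1mx munitM sc_munit.
      have [->|_] := eqVneq i h; last by rewrite addr0.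
      by rewrite -munitD mulrBl addrC subrK.
    rewrite mulmxDr sc_mulr mulmx1 munitM sc_munit phiC.
    have [->|_] := eqVneq j h; last by rewrite addr0.
    by rewrite -munitD mulrBr addrC subrK.
  by apply: deep_gen => //; apply: tidealMr => //; apply: tidealMl.
case=> [[Jz z0] _]; exists 0; first exact: deep0.
have -> : (sc r 1%:M + munit h h (x - phi r)) *m z = sc r z.
  rewrite mulmxDl sc_mull mul1mx -[RHS]addr0; congr (_ + _).
  apply/matrixP=> k l; rewrite munit_mulE mxE.
  by case: ifP => // _; rewrite z0 ?hi // mulr0.
rewrite mul0mx add0r mulmxDr sc_mulr mulmx1 sc1 scA [r' * r]mulrC -[RHS]addr0.
congr (_ + _); rewrite sc_mull -[RHS](sc0 r); congr sc.
apply/matrixP=> k l; rewrite mul_munitE mxE.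
by case: ifP => // _; rewrite z0 ?hi ?orbT // mul0r.
Qed.

Lemma good_cj (g : GL n D) : good (GLmx g) (GLmxV g) 1 -> exists2 u, M u &
  (forall i j x, i != j -> J x -> rel_elem J (cj g (el i j (phi u * x)))) /\
  (forall z y, corner_unit u z -> GLmx y = lvl u z ->
     exists2 e, rel_elem J e & cj g y = (e * y)%g).
Proof.
case=> _ _ /(_ 1 M1) [u Mu]; rewrite !mul1r => -[dP cP]; exists u => //.
split=> [i j x ij Jx|z y cz ey].
  have [e Je ee] := deep_rel_elem iJ (dP _ (deep_gen _ ij Jx)).
  suff <- : e = cj g (el i j (phi u * x)) by [].
  apply: GLmx_inj; rewrite ee /cj !GLmxM GLmx_el // /lvl sc1 -sc_munit.
  rewrite mulmxDr mulmxDl mulmx1 -[GLmx g^-1%g]/(GLmxV g) GLmxK.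
  by rewrite sc_mulr sc_mull.
have [d Jd ed] := cP z cz.
have [e Je ee] := deep_rel_elem iJ Jd; exists e => //.
apply: GLmx_inj; rewrite /cj !GLmxM ee ey -[GLmx g^-1%g]/(GLmxV g).
rewrite {1}/lvl mulmxDr mulmxDl mulmx1 GLmxK sc_mulr sc_mull ed /lvl sc1.
by ncring.
Qed.
End Good.
End Denominators.

(** * Stable rank at a maximal ideal *)

Section IdealOfSet.
Variables (A : pzRingType) (X : set A).

(** The proof is an argument so that the closure instances can be found from the term itself. *)
Definition ideal_pred of is_ideal X : A -> bool := fun x => `[< X x >].

Variable iX : is_ideal X.

Lemma ideal_predP x : reflect (X x) (x \in ideal_pred iX).
Proof. exact: asboolP. Qed.

Lemma ideal_pred_closed : zmod_closed (ideal_pred iX).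
Proof.
split=> [|x y]; first by apply/ideal_predP; apply: tideal0.
by move=> /ideal_predP Xx /ideal_predP Xy; apply/ideal_predP; apply: tidealB.
Qed.
HB.instance Definition _ :=
  GRing.isZmodClosed.Build A (ideal_pred iX) ideal_pred_closed.

Lemma ideal_pred_mull a x : x \in ideal_pred iX -> a * x \in ideal_pred iX.
Proof. by move=> /ideal_predP Xx; apply/ideal_predP; apply: tidealMl. Qed.
Lemma ideal_pred_mulr a x : x \in ideal_pred iX -> x * a \in ideal_pred iX.
Proof. by move=> /ideal_predP Xx; apply/ideal_predP; apply: tidealMr. Qed.
HB.instance Definition _ :=
  isTwoSided.Build A (ideal_pred iX) ideal_pred_mull ideal_pred_mulr.

Definition ideal_set : twoSidedIdeal A := HB.pack_for (twoSidedIdeal A) (ideal_pred iX).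

End IdealOfSet.

Section LeftIdeals.
Variable F : pzRingType.
Definition is_left_ideal (P : set F) :=
  [/\ P 0, forall x y, P x -> P y -> P (x + y) & forall a x, P x -> P (a * x)].
End LeftIdeals.

(** * Rings of finite length have stable rank 1 *)

Section Artinian.
Variables (R : comPzRingType) (F : pzRingType) (psi : {rmorphism R -> F}).
Hypothesis psiC : forall r x, psi r * x = x * psi r.

Definition is_submod (P : set F) :=
  [/\ P 0, forall x y, P x -> P y -> P (x + y) & forall r x, P x -> P (psi r * x)].

(* A bounded length on the submodules of [F] replaces both chain conditions. *)
Variables (len : set F -> nat) (d : nat).
Hypothesis len_le : forall P, (len P <= d)%N.
Hypothesis len_eq : forall P Q, is_submod P -> is_submod Q -> P `<=` Q ->
  (len Q <= len P)%N -> Q `<=` P.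

Lemma submod_left P : is_left_ideal P -> is_submod P.
Proof. by case=> P0 PD PM; split=> // r x; apply: PM. Qed.

Lemma ascending_stable (P : nat -> set F) :
  (forall j, is_submod (P j)) -> (forall j, P j `<=` P j.+1) ->
  exists j, P j.+1 `<=` P j.
Proof.
move=> sP incP; apply: contrapT => noj.
suff H j : (j <= len (P j))%N by have := leq_trans (H d.+1) (len_le _); rewrite ltnn.
elim: j => // j IH; apply: leq_ltn_trans IH _; rewrite ltnNge; apply/negP => le.
by apply: noj; exists j; apply: len_eq le.
Qed.

Lemma descending_stable (P : nat -> set F) :
  (forall j, is_submod (P j)) -> (forall j, P j.+1 `<=` P j) ->
  exists j, P j `<=` P j.+1.
Proof.
move=> sP incP; apply: contrapT => noj.
suff H j : (len (P j) + j <= d)%N.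
  by have := leq_trans (leq_addl _ _) (H d.+1); rewrite ltnn.
elim: j => [|j IH]; first by rewrite addn0.
apply: leq_trans IH; rewrite addnS ltn_add2r ltnNge; apply/negP => le.
by apply: noj; exists j; apply: len_eq le.
Qed.

Lemma exists_maximal (T : Type) (S : set T) (P : T -> set F) t0 : S t0 ->
  (forall t, is_submod (P t)) ->
  exists2 t, S t & forall t', S t' -> P t `<=` P t' -> P t' `<=` P t.
Proof.
move=> St0 sP.
have ex : exists k, `[< exists2 t, S t & len (P t) = k >].
  by exists (len (P t0)); apply/asboolP; exists t0.
have ub k : `[< exists2 t, S t & len (P t) = k >] -> (k <= d)%N.
  by move=> /asboolP[t _ <-].
case: (ex_maxnP ex ub) => k /asboolP[t St <-] kmax; exists t => // t' St' PP'.
by apply: len_eq => //; apply: kmax; apply/asboolP; exists t'.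
Qed.

(** The Jacobson radical. *)
Definition rad : set F := [set x | forall c, exists d, d * (1 - c * x) = 1].

Lemma rad_left : is_left_ideal rad.
Proof.
split=> [c|x y rx ry c|a x rx c].
- by exists 1; rewrite mulr0 subr0 mulr1.
- have [e ee] := rx c; have [e' ee'] := ry (e * c).
  exists (e' * e); rewrite -mulrA.
  have -> : e * (1 - c * (x + y)) = e * (1 - c * x) - e * c * y by ncring.
  by rewrite ee.
- by rewrite mulrA; apply: rx.
Qed.

Lemma radMr x a : rad x -> rad (x * a).
Proof.
move=> rx c; have [e ee] := rx (a * c).
(* The geometric series of [1 - c x a], regrouped around the inverse [e] of [1 - a c x]. *)
exists (1 + c * x * e * a).
have -> : (1 + c * x * e * a) * (1 - c * (x * a)) =
  1 - c * x * a + c * x * (e * (1 - a * c * x)) * a by ncring.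
by rewrite ee; ncring.
Qed.

Lemma left_power_stable (p : F) : exists j, forall k i, (j <= k)%N ->
  exists c, p ^+ k = c * p ^+ (k + i).
Proof.
have [j /(_ (p ^+ j))[]] : exists j,
    [set x : F | exists c, x = c * p ^+ j] `<=` [set x | exists c, x = c * p ^+ j.+1].
  apply: (@descending_stable (fun j => [set x | exists c, x = c * p ^+ j])) => j.
    apply: submod_left; split=> [|x y [c ->] [c' ->]|a x [c ->]].
    - by exists 0; rewrite mul0r.
    - by exists (c + c'); rewrite mulrDl.
    - by exists (a * c); rewrite mulrA.
  by move=> x [c ->]; exists (c * p); rewrite exprS mulrA.
  by exists 1; rewrite mul1r.
move=> c e; exists j => k i jk.
suff [b eb] : exists b, p ^+ j = b * p ^+ (j + i).
  by exists b; rewrite -(subnKC jk) exprD eb -mulrA -exprD addnAC.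
elim: i => [|i [b eb]]; first by exists 1; rewrite addn0 mul1r.
exists (b * c); rewrite {1}eb exprD {1}e.
by rewrite -!mulrA -exprD addSn addnS.
Qed.

Lemma right_power_stable (p : F) : exists j, forall k i, (j <= k)%N ->
  exists c, p ^+ k = p ^+ (k + i) * c.
Proof.
have [j /(_ (p ^+ j))[]] : exists j,
    [set x : F | exists c, x = p ^+ j * c] `<=` [set x | exists c, x = p ^+ j.+1 * c].
  apply: (@descending_stable (fun j => [set x | exists c, x = p ^+ j * c])) => j.
    split=> [|x y [c ->] [c' ->]|r x [c ->]].
    - by exists 0; rewrite mulr0.
    - by exists (c + c'); rewrite mulrDr.
    - by exists (psi r * c); rewrite mulrA psiC mulrA.
  by move=> x [c ->]; exists (p * c); rewrite exprSr mulrA.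
  by exists 1; rewrite mulr1.
move=> c e; exists j => k i jk.
suff [b eb] : exists b, p ^+ j = p ^+ (j + i) * b.
  by exists b; rewrite -(subnK jk) exprD eb mulrA -exprD addnA.
elim: i => [|i [b eb]]; first by exists 1; rewrite addn0 mulr1.
exists (c * b); rewrite {1}eb (addnC j i) exprD {1}e !mulrA -exprD.
by rewrite addnS addnC -addnS.
Qed.

(** As in Fitting's lemma: some power [q] of [p] satisfies [q = c q q = q q c'], hence [c q = q c'],
    and this element is idempotent. *)
Lemma idempotent_power (p : F) : exists k f c,
  [/\ f = c * p ^+ k.+1, f * f = f & f * p ^+ k.+1 = p ^+ k.+1].
Proof.
have [j1 l1] := left_power_stable p; have [j2 l2] := right_power_stable p.
exists (j1 + j2)%N.
have [c] := l1 (j1 + j2).+1 (j1 + j2).+1 (leqW (leq_addr _ _)).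
have [c'] := l2 (j1 + j2).+1 (j1 + j2).+1 (leqW (leq_addl _ _)).
rewrite exprD; set q := p ^+ _ => ec' ec.
have ef : c * q = q * c' by rewrite {1}ec' mulrA -ec.
exists (c * q), c; split=> //; last by rewrite -mulrA -ec.
by rewrite {2}ef mulrA -(mulrA c) -ec -ef.
Qed.

(** Bass' theorem. Among the elements of [x + B] take [y] with [F y + rad] maximal. Right
    multiplication by [y] is then injective modulo [rad], and the descending chain condition makes
    [y] left invertible. *)
Lemma artinian_sr1 (x : F) (B : set F) : is_left_ideal B ->
  (exists a b, B b /\ a * x + b = 1) ->
  exists y, B (y - x) /\ exists z, z * y = 1.
Proof.
move=> [B0 BD BM] [a0 [b0 [Bb0 e0]]].
have [rad0 radD radM] := rad_left.
have BN b : B b -> B (- b) by rewrite -mulN1r; apply: BM.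
have radN b : rad b -> rad (- b) by rewrite -[- b]mulN1r; apply: radM.
pose P y := [set t : F | exists c r, rad r /\ t = c * y + r].
have lP y : is_left_ideal (P y).
  split=> [|t u [c [r [rr ->]]] [c' [r' [rr' ->]]]|e t [c [r [rr ->]]]].
  - by exists 0, 0; split; rewrite // mul0r add0r.
  - by exists (c + c'), (r + r'); split; [apply: radD|ncring].
  - by exists (e * c), (e * r); split; [apply: radM|ncring].
have [y Bxy ymax] := @exists_maximal _ [set y | B (y - x)] P x
  (eq_ind_r B B0 (subrr x)) (fun y => submod_left (lP y)).
exists y; split=> //.
have [P0 PD PM] := lP y.
have e1 : exists b, B b /\ a0 * y + b = 1.
  exists (b0 - a0 * (y - x)); split; first by apply: BD => //; apply/BN/BM.
  by rewrite -[RHS]e0; ncring.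
(* An element killed by [y] modulo [rad] but outside [rad] has an idempotent
   multiple [f], and the maximality of [y] forces [f F] into [F y + rad]. *)
have inj p : rad (p * y) -> rad p.
  move=> rpy c; apply: contrapT => nd.
  pose q := c * p.
  have rqy : rad (q * y) by rewrite /q -mulrA; apply: radM.
  rewrite -/q in nd; clearbody q.
  have [k [f [e [ef ff fq]]]] := idempotent_power q.
  have rfy : rad (f * y) by rewrite ef exprSr -!mulrA; apply: (radM); apply: radM.
  (* An idempotent in the radical is zero; then [q] would be nilpotent and [1 - q] left
     invertible. *)
  have nrf : ~ rad f.
    move=> /(_ 1) [g]; rewrite mul1r => eg.
    have f0 : f = 0 by rewrite -[f]mul1r -eg -mulrA mulrBl mul1r ff subrr mulr0.
    have qk : q ^+ k.+1 = 0 by rewrite -fq f0 mul0r.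
    have geo i : exists d, d * (1 - q) = 1 - q ^+ i.
      elim: i => [|i [d' ed']]; first by exists 0; rewrite mul0r expr0 subrr.
      exists (d' + q ^+ i); rewrite mulrDl ed' exprSr; ncring.
    by case: (geo k.+1) => d'; rewrite qk subr0 => ed'; apply: nd; exists d'.
  (* Passing to [y' = y + f r z] loses nothing modulo [rad], because [(1 - f) y' = (1 - f) y] and
     [f y] lies in [rad]. By maximality nothing is gained either, so [f y'] belongs to [P y]. *)
  have Pfz r z : B z -> P y (f * r * z).
    move=> Bz; pose y' := y + f * r * z.
    have Byy' : B (y' - x).
      have -> : y' - x = (y - x) + f * r * z by rewrite /y'; ncring.
      by apply: BD => //; apply: BM.
    apply: (ymax y') => // [t [e' [r' [rr' ->]]]|].
      exists (e' * (1 - f)), (e' * (f * y) + r'); split.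
        by apply: radD => //; apply: radM.
      have -> : e' * (1 - f) * y' + (e' * (f * y) + r') =
        e' * y + r' + e' * (f - f * f) * r * z by rewrite /y'; ncring.
      by rewrite ff subrr mulr0 !mul0r addr0.
    exists f, (- (f * y)); split; first exact: radN.
    by rewrite /y' -{1}ff; ncring.
  have Pf r : P y (f * r).
    have [b [Bb eb]] := e1.
    have -> : f * r = (f * r * a0) * y + f * r * b by rewrite -[LHS]mulr1 -eb; ncring.
    by apply: PD (Pfz _ _ Bb); exists (f * r * a0), 0; rewrite addr0.
  (* Iterating [Pf] puts [f] in [f F y^j + rad] for every [j]. As [f y] lies in [rad] and the
     kernels of [y^j] modulo [rad] become stationary, [f] itself falls into [rad]. *)
  have tower j : exists e', rad (f - f * e' * y ^+ j).
    elim: j => [|j [e' re']]; first by exists 1; rewrite !mulr1 subrr.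
    have [e2 [r [rr er]]] := Pf e'; exists e2.
    have -> : f - f * e2 * y ^+ j.+1 = (f - f * f * e' * y ^+ j) + f * r * y ^+ j.
      by rewrite -(mulrA f f e') er exprS; ncring.
    by rewrite ff; apply: radD => //; apply: radMr; apply: radM.
  have [j sj] : exists j,
      [set t | rad (t * y ^+ j.+1)] `<=` [set t | rad (t * y ^+ j)].
    apply: (@ascending_stable (fun j => [set t | rad (t * y ^+ j)])) => j.
      apply: submod_left; split=> [|t u rt ru|a t rt] /=.
      - by rewrite mul0r.
      - by rewrite mulrDl; apply: radD.
      - by rewrite -mulrA; apply: radM.
    by move=> t rt /=; rewrite exprSr mulrA; apply: radMr.
  have [e' re'] := tower j.
  have [r0 rD _] := rad_left.
  apply: nrf; have -> : f = (f - f * e' * y ^+ j) + f * e' * y ^+ j by ncring.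
  apply: (rD) => //; apply: sj => /=.
  have -> : f * e' * y ^+ j.+1 = f * y - (f - f * e' * y ^+ j) * y.
    by rewrite exprSr; ncring.
  by apply: rD => //; apply: radN; apply: radMr.
(* Stationarity gives [(1 - c y) y^j] in [rad]; cancelling [y^j] by injectivity leaves [1 - c y] in
   [rad]. *)
have [j /(_ (y ^+ j))[]] : exists j,
    P (y ^+ j) `<=` P (y ^+ j.+1).
  apply: (@descending_stable (fun j => P (y ^+ j))) => j.
    exact: submod_left.
  by move=> t [c [r [rr ->]]]; exists (c * y), r; rewrite exprS mulrA.
  by exists 1, 0; rewrite mul1r addr0.
move=> c [r [rr er]].
have inj_pow i p : rad (p * y ^+ i) -> rad p.
  elim: i p => [|i IH] p; first by rewrite mulr1.
  by rewrite exprS mulrA => /IH /inj.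
have /inj_pow /(_ 1) [g] : rad ((1 - c * y) * y ^+ j).
  rewrite mulrBl mul1r {1}er exprS.
  by have -> : c * (y * y ^+ j) + r - c * y * y ^+ j = r by ncring.
have -> : 1 - 1 * (1 - c * y) = c * y by ncring.
by rewrite mulrA => eg; exists (g * c).
Qed.
End Artinian.

Section LocalStableRank.
Variables (R : comPzRingType).

Definition is_maximal (m : set R) :=
  [/\ is_left_ideal m, ~ m 1 &
      forall r, ~ m r -> exists t u, m u /\ t * r + u = 1].

Variables (C : pzRingType) (psi : {rmorphism R -> C}).
Hypothesis psiC : forall r x, psi r * x = x * psi r.
Variables (d : nat) (v : 'I_d -> C).
Hypothesis span_v : forall x, exists c : 'I_d -> R, x = \sum_i psi (c i) * v i.
Variable m : set R.
Hypothesis max_m : is_maximal m.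

Let m0 : m 0. Proof. by case: max_m => -[]. Qed.
Let mD r s : m r -> m s -> m (r + s). Proof. by case: max_m => -[_ + _] _ _; apply. Qed.
Let mM r s : m s -> m (r * s). Proof. by case: max_m => -[_ _ +] _ _; apply. Qed.
Let m1 : ~ m 1. Proof. by case: max_m. Qed.
Let mV r : ~ m r -> exists t u, m u /\ t * r + u = 1.
Proof. by case: max_m => _ _; apply. Qed.

Definition comb (c : 'I_d -> R) : C := \sum_i psi (c i) * v i.

Lemma combD c e : comb c + comb e = comb (fun i => c i + e i).
Proof. by rewrite -big_split; apply: eq_bigr => i _; rewrite rmorphD mulrDl. Qed.
Lemma combZ r c : psi r * comb c = comb (fun i => r * c i).
Proof. by rewrite mulr_sumr; apply: eq_bigr => i _; rewrite rmorphM mulrA. Qed.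
Lemma comb0 : comb (fun=> 0) = 0.
Proof. by rewrite /comb big1 // => i _; rewrite rmorph0 mul0r. Qed.
Lemma comb_delta i r : comb (fun j => if j == i then r else 0) = psi r * v i.
Proof.
rewrite /comb (bigD1 i) //= eqxx big1 ?addr0 // => j /negPf ->.
by rewrite rmorph0 mul0r.
Qed.

Definition mC : set C := [set x | exists c, (forall i, m (c i)) /\ x = comb c].

Lemma mC_submod : is_submod psi mC.
Proof.
split=> [|x y [c [mc ->]] [e [me ->]]|r x [c [mc ->]]].
- by exists (fun=> 0); rewrite comb0.
- by exists (fun i => c i + e i); rewrite combD; split=> // i; apply: mD.
- by exists (fun i => r * c i); rewrite combZ; split=> // i; apply: mM.
Qed.

Lemma mC_psi r x : m r -> mC (psi r * x).
Proof.
move=> mr; have [c ->] := span_v x; exists (fun i => r * c i).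
by rewrite -combZ; split=> // i; rewrite mulrC; apply: mM.
Qed.

Lemma mC_ideal : is_ideal mC.
Proof.
have [C0 CD CZ] := mC_submod.
have CN x : mC x -> mC (- x) by move=> /(CZ (-1)); rewrite rmorphN1 mulN1r.
have sum (e : 'I_d -> C) : (forall i, mC (e i)) -> mC (\sum_i e i).
  by move=> Ce; apply: (big_ind mC) => // i _; apply: Ce.
split=> [//|x y Cx Cy|a x [c [mc ->]]|a x [c [mc ->]]].
- by apply: CD => //; apply: CN.
- rewrite mulr_sumr; apply: sum => i; rewrite mulrA -psiC -mulrA; exact: mC_psi.
- rewrite mulr_suml; apply: sum => i; rewrite -mulrA; exact: mC_psi.
Qed.

(* [i] counts for the length of [P] when [P] contains an element with leading
   coefficient [1] on [v i]; as [R / m] is a field this determines [P] among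
   the submodules between [mC] and a larger one. *)
Definition leads (P : set C) (i : 'I_d) := exists c : 'I_d -> R,
  [/\ c i = 1, forall j : 'I_d, (i < j)%N -> c j = 0 & P (comb c)].

Definition mod_len (P : set C) : nat := #|[set i | `[< leads P i >]]%SET|.

Lemma mod_len_le P : (mod_len P <= d)%N.
Proof. by rewrite -[X in (_ <= X)%N]card_ord; apply: max_card. Qed.

Lemma mod_len_eq P Q : is_submod psi P -> is_submod psi Q -> mC `<=` P ->
  P `<=` Q -> (mod_len Q <= mod_len P)%N -> Q `<=` P.
Proof.
move=> [P0 PD PZ] [Q0 QD QZ] CP PQ le.
have lead_eq i : leads Q i -> leads P i.
  have sub : [set i | `[< leads P i >]]%SET \subset [set i | `[< leads Q i >]]%SET.
    apply/fintype.subsetP=> j; rewrite !finset.inE => /asboolP Pj.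
    by apply/asboolP; have [c [c1 c0 Pc]] := Pj; exists c; split=> //; apply: PQ.
  have /eqP/finset.setP/(_ i) :
      [set i | `[< leads P i >]]%SET == [set i | `[< leads Q i >]]%SET.
    by rewrite eqEcard sub.
  by rewrite !finset.inE => e /asboolP; rewrite -e => /asboolP.
have PN x : P x -> P (- x) by move=> /(PZ (-1)); rewrite rmorphN1 mulN1r.
have QN x : Q x -> Q (- x) by move=> /(QZ (-1)); rewrite rmorphN1 mulN1r.
suff H k (c : 'I_d -> R) : (forall j : 'I_d, (k <= j)%N -> c j = 0) ->
    Q (comb c) -> P (comb c).
  by move=> x; have [c ->] := span_v x; apply: (H d) => j; rewrite leqNgt ltn_ord.
elim: k c => [|k IH] c c0 Qc.
  have -> : comb c = 0 by rewrite /comb big1 // => i _; rewrite c0 // rmorph0 mul0r.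
  exact: P0.
have [dk|kd] := leqP d k.
  by apply: IH => // j kj; have := leq_ltn_trans (leq_trans dk kj) (ltn_ord j); rewrite ltnn.
pose i := Ordinal kd.
(* It is enough to change the coefficient of [v i] within [P]. *)
have step y : P (comb y) -> y i = c i -> (forall j : 'I_d, (i < j)%N -> y j = 0) ->
    P (comb c).
  move=> Py yi y0; pose e j := c j + -1 * y j.
  have ee : comb e = comb c - comb y.
    by rewrite -mulN1r -(rmorphN1 psi) combZ combD.
  have -> : comb c = comb e + comb y by rewrite ee subrK.
  apply: PD => //; apply: IH => [j kj|]; last first.
    by rewrite ee; apply: QD => //; apply: QN; apply: PQ.
  rewrite /e; have [ij|] := eqVneq j i; first by rewrite ij yi mulN1r subrr.
  rewrite -val_eqE /= => jk; have kj' : (k < j)%N by rewrite ltn_neqAle eq_sym jk.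
  by rewrite y0 // mulr0 addr0 c0.
have [mi|/mV[t [u [mu tu]]]] := pselect (m (c i)).
  apply: (step (fun j => if j == i then c i else 0)) => [||j ij].
  - by rewrite comb_delta; apply/CP/mC_psi.
  - by rewrite eqxx.
  - by rewrite -val_eqE /= gtn_eqF.
(* Multiplying by [t] and adding [u * v i], an element of [mC], makes the leading coefficient
   exactly 1. *)
have /lead_eq[y [y1 y0 Py]] : leads Q i.
  exists (fun j => t * c j + (if j == i then u else 0)); split.
  - by rewrite eqxx.
  - move=> j ij; rewrite -val_eqE /= gtn_eqF // addr0 c0 ?mulr0 //.
  - by rewrite -combD -combZ comb_delta; apply: QD; [apply: QZ|apply/PQ/CP/mC_psi].
apply: (step (fun j => c i * y j)); rewrite -?combZ ?y1 ?mulr1 //; first exact: PZ.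
by move=> j /y0 ->; rewrite mulr0.
Qed.

Lemma det_unipotent (T : 'M[R]_d) :
  (forall i j, m (T i j - (i == j)%:R)) -> m (\det T - 1).
Proof.
move=> hT; pose e : perm.perm_of 'I_d := 1%g.
rewrite /determinant (bigD1 e) //= perm.odd_perm1 expr0 mul1r addrAC.
have prod1 : m (\prod_i T i (e i) - 1).
  apply: (big_ind (fun x => m (x - 1))) => [|x y mx my|i _].
  - by rewrite subrr.
  - have -> : x * y - 1 = x * (y - 1) + (x - 1) by ring.
    by apply: mD; [exact: mM|exact: mx].
  - by have := hT i i; rewrite eqxx perm.perm1.
apply: mD => //; apply: (big_ind m) => // s s1.
have [i si] : exists i, s i != i.
  apply: contrapT => /forallNP nsi; case/eqP: s1; apply/perm.permP => i.
  by rewrite perm.perm1; apply/eqP; apply: contrapT => /negP; exact: nsi.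
have mT : m (T i (s i)) by have := hT i (s i); rewrite eq_sym (negPf si) subr0.
by rewrite (bigD1 i) //= mulrCA mulrC; apply: mM.
Qed.

(* The determinant trick, for right multiplication by [1 + x]. *)
Lemma nakayama x : mC x -> exists q s, ~ m s /\ q * (1 + x) = psi s.
Proof.
move=> Cx; have [_ _ Cl _] := mC_ideal.
have [c hc] := choice (fun i => Cl (v i) x Cx).
pose T := \matrix_(i, j) ((i == j)%:R + c i j).
have vT i : v i * (1 + x) = \sum_j psi (T i j) * v j.
  have [_ ec] := hc i; rewrite mulrDr mulr1 ec /comb.
  rewrite [RHS](eq_bigr (fun j => psi ((i == j)%:R) * v j + psi (c i j) * v j)).
    rewrite big_split /= [X in _ = X + _](bigD1 i) //= eqxx rmorph1 mul1r.
    rewrite [X in _ = _ + X + _]big1 ?addr0 // => j /negPf ji.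
    by rewrite eq_sym ji rmorph0 mul0r.
  by move=> j _; rewrite mxE rmorphD mulrDl.
have vdet k : (\sum_i psi ((\adj T) k i) * v i) * (1 + x) = psi (\det T) * v k.
  rewrite mulr_suml.
  under eq_bigr => i _ do rewrite -mulrA vT mulr_sumr.
  rewrite exchange_big /=.
  transitivity (\sum_j psi ((\adj T *m T) k j) * v j).
    apply: eq_bigr => j _; rewrite mxE rmorph_sum mulr_suml.
    by apply: eq_bigr => i _; rewrite rmorphM mulrA.
  rewrite mul_adj_mx (bigD1 k) //= mxE eqxx mulr1n big1 ?addr0 // => j /negPf jk.
  by rewrite mxE eq_sym jk mulr0n rmorph0 mul0r.
have [e e1] := span_v 1.
exists (\sum_k psi (e k) * \sum_i psi ((\adj T) k i) * v i), (\det T); split.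
  move=> mdet; apply: m1; have -> : 1 = \det T + -1 * (\det T - 1) :> R by ring.
  apply: mD => //; apply/mM/det_unipotent => i j.
  by rewrite mxE addrAC subrr add0r; have [] := hc i.
have -> : psi (\det T) = \sum_k psi (\det T) * (psi (e k) * v k).
  by rewrite -mulr_sumr -e1 mulr1.
rewrite mulr_suml; apply: eq_bigr => k _.
by rewrite -mulrA vdet !mulrA -!rmorphM mulrC.
Qed.

Lemma local_sr1 (x : C) (B : set C) a b t : is_left_ideal B -> ~ m t ->
  B b -> a * x + b = psi t ->
  exists y, B (y - x) /\ exists q s, ~ m s /\ q * y = psi s.
Proof.
move=> lB mt Bb eab; have [B0 BD BM] := lB.
set I := ideal_set mC_ideal.
pose F : pzRingType := ideal_quot I; pose pi : {rmorphism C -> F} := quot_proj I.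
have piP z w : pi z = pi w <-> mC (z - w).
  split=> [/quot_projE h|h]; first exact/(ideal_predP mC_ideal).
  by apply/quot_projE; apply/(ideal_predP mC_ideal).
have pi_surj u : exists z, u = pi z by exists (repr u); apply/esym/quot_projK.
pose len (P : set F) := mod_len (pi @^-1` P).
have pre P : is_submod (pi \o psi) P -> is_submod psi (pi @^-1` P).
  case=> P0 PD PZ; split=> [|z w /= Pz Pw|r z /= Pz]; rewrite /preimage /=.
  - by rewrite rmorph0.
  - by rewrite rmorphD; apply: PD.
  - by rewrite rmorphM; apply: PZ.
have psiFC r u : (pi \o psi) r * u = u * (pi \o psi) r.
  by have [z ->] := pi_surj u; rewrite /= -!rmorphM psiC.
have len_eq P Q : is_submod (pi \o psi) P -> is_submod (pi \o psi) Q ->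
    P `<=` Q -> (len Q <= len P)%N -> Q `<=` P.
  move=> sP sQ PQ le u; have [z ->] := pi_surj u.
  apply: (mod_len_eq (pre _ sP) (pre _ sQ)) le z => [z Cz|z]; last exact: PQ.
  have : pi z = pi 0 by apply/piP; rewrite subr0.
  by rewrite /preimage /= => ->; rewrite rmorph0; case: sP.
have [y [By [z1 ezy]]] : exists y, [set pi b | b in B] (y - pi x) /\ exists z, z * y = 1.
  apply: (artinian_sr1 psiFC (fun P => mod_len_le _) len_eq).
    split; first by exists 0; rewrite ?rmorph0.
      by move=> _ _ [b' Bb' <-] [c Bc <-]; exists (b' + c); [apply: BD|rewrite rmorphD].
    move=> u _ [b' Bb' <-]; have [z ->] := pi_surj u.
    by exists (z * b'); [apply: BM|rewrite rmorphM].
  have [r [u [mu eru]]] := mV mt.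
  exists (pi (psi r * a)), (pi (psi r * b)); split.
    by exists (psi r * b) => //; apply: BM.
  rewrite -rmorphM -rmorphD -(rmorph1 pi); apply/piP.
  have -> : psi r * a * x + psi r * b - 1 = psi (- u) * 1.
    have <- : r * t - 1 = - u by rewrite -eru; ring.
    by rewrite mulr1 rmorphB rmorphM rmorph1 -eab mulrDr mulrA.
  by apply: mC_psi; rewrite -mulN1r; apply: mM.
have [b1 Bb1 eb1] := By; have [z ez] := pi_surj z1.
exists (x + b1); split; first by rewrite addrAC subrr add0r.
have ey : y = pi (x + b1) by rewrite rmorphD eb1 addrC subrK.
have Cx : mC (z * (x + b1) - 1).
  by apply/piP; rewrite rmorphM rmorph1 -ey -ez.
have [q [s [ms eq]]] := nakayama Cx.
exists (q * z), s; split=> //; rewrite -eq -mulrA; congr (q * _); ncring.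
Qed.
End LocalStableRank.

(** * Elimination and the local-global principle *)

Section Elimination.
Variables (R : comPzRingType) (D C : pzRingType).
Variables (phi : {rmorphism R -> D}) (psi : {rmorphism R -> C}) (iota : {rmorphism C -> D}).
Hypothesis phiC : forall r x, phi r * x = x * phi r.
Hypothesis psiC : forall r x, psi r * x = x * psi r.
Hypothesis iotaE : forall r, iota (psi r) = phi r.
Variables (M : R -> Prop) (J : set D).
Hypotheses (iJ : is_ideal J) (M1 : M 1).
Hypothesis MM : forall r s, M r -> M s -> M (r * s).
Hypothesis sr1 : forall (x : C) (B : set C) a b t, is_left_ideal B -> M t -> B b ->
  a * x + b = psi t ->
  exists y, B (y - x) /\ exists q s, M s /\ q * y = psi s.
Variable n' : nat.
Notation n := n'.+3.
Implicit Types (i j k l : 'I_n) (p q e w : 'M[C]_n) (r s t : R).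

Let n3 : (2 < n)%N. Proof. by []. Qed.
Definition idx0 : 'I_n := ord0.
Definition idx1 : 'I_n := lift ord0 ord0.

Local Notation mp := (map_mx iota).

Lemma map_sc r p : mp (sc psi r p) = sc phi r (mp p).
Proof. by apply/matrixP=> i j; rewrite !mxE rmorphM iotaE. Qed.

Lemma map_munit i j c : mp (munit i j c) = munit i j (iota c).
Proof.
by apply/matrixP=> k l; rewrite mxE !munitE; case: ifP; rewrite ?rmorph0.
Qed.

Definition elim_good p q t := good phi J M idx0 idx1 (mp p) (mp q) t.
(** [reachable] comes with a quasi-inverse assembled along products, [elim_target] accepts any given
    one; [good_ext] leads from the first to the second. *)
Definition reachable p := exists q t, elim_good p q t /\ inv_mod psi t p q.
Definition elim_target p := forall q t, M t -> inv_mod psi t p q -> elim_good p q t.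

Lemma map_inv_mod t p q : inv_mod psi t p q -> inv_mod phi t (mp p) (mp q).
Proof. by case=> pq qp; split; rewrite -map_mxM ?pq ?qp map_sc map_mx1. Qed.

Lemma reachable_target a b p q : M a -> M b -> reachable p -> sc psi a p = sc psi b q ->
  elim_target q.
Proof.
move=> Ma Mb [p' [t [gp _]]] e q' t' Mt' iq.
apply: (good_ext phiC iJ MM Ma Mb Mt' gp); first exact: map_inv_mod.
by rewrite -!map_sc e.
Qed.

Lemma reachable_mul p q : reachable p -> reachable q -> reachable (p *m q).
Proof.
case=> [p' [t [gp [pp' p'p]]]] [q' [t' [gq [qq' q'q]]]].
exists (q' *m p'), (t * t'); split.
  rewrite /elim_good !map_mxM; exact: (good_mul phiC iJ MM gp gq).
split.
  by rewrite -mulmxA (mulmxA q) qq' sc_mull mul1mx (sc_mulr psiC) pp' scA mulrC.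
by rewrite -mulmxA (mulmxA p') p'p sc_mull mul1mx (sc_mulr psiC) q'q scA.
Qed.

Definition psi_scE := (scDr, scN, sc_mull, sc_mulr psiC, scA, sc0).

Lemma elim_target_mul e e' t p : M t -> inv_mod psi t e e' -> reachable e' ->
  elim_target (e *m p) -> elim_target p.
Proof.
move=> Mt [ee' e'e] re' Tp q s Ms [pq qp].
have Mts : M (t * s) by apply: MM.
have iep : inv_mod psi (t * s) (e *m p) (q *m e').
  split.
    by rewrite -mulmxA (mulmxA p) pq !(mulE, psi_scE) ee' !psi_scE [s * t]mulrC.
  by rewrite -mulmxA (mulmxA e') e'e !(mulE, psi_scE) qp !psi_scE.
have : reachable (e' *m (e *m p)).
  by apply: reachable_mul => //; exists (q *m e'), (t * s); split=> //; apply: Tp.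
move=> /(reachable_target M1 Mt) H; apply: (H p) => //.
by rewrite mulmxA e'e !(mulE, psi_scE) mul1r.
Qed.

(** Entries only in rows of [S] and columns outside [S], so that such matrices multiply to zero and
    [r + w], [r - w] are quasi-inverse. *)
Definition block (S : pred 'I_n) w := forall i j, ~~ (S i && ~~ S j) -> w i j = 0.

Lemma blockM S w w' : block S w -> block S w' -> w *m w' = 0.
Proof.
move=> bw bw'; apply/matrixP=> i j; rewrite !mxE big1 // => k _.
have [Sk|Sk] := boolP (S k); first by rewrite bw ?mul0r // Sk andbF.
by rewrite bw' ?mulr0 // negb_and Sk.
Qed.

Lemma inv_mod_block S r w : block S w ->
  inv_mod psi (r * r) (sc psi r 1%:M + w) (sc psi r 1%:M - w).
Proof. by move=> bw; split; rewrite !(mulE, psi_scE) (blockM bw bw); ncring. Qed.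

Lemma blockN S w : block S w -> block S (- w).
Proof. by move=> bw i j ij; rewrite mxE bw // oppr0. Qed.

Lemma reachable_block S r w : M r -> block S w -> reachable (sc psi r 1%:M + w).
Proof.
move=> Mr bw.
have -> : w = \sum_(u : 'I_n * 'I_n) munit u.1 u.2 (w u.1 u.2).
  rewrite [LHS]matrix_sum_delta pair_bigA; apply: eq_bigr => u _.
  by rewrite munit.unlock.
pose K x := reachable (sc psi r 1%:M + x) /\ block S x.
suff [] : K (\sum_(u : 'I_n * 'I_n) munit u.1 u.2 (w u.1 u.2)) by [].
have el i j c : i != j -> reachable (sc psi r 1%:M + munit i j c).
  move=> ij; exists (sc psi r 1%:M - munit i j c), (r * r); split.
    rewrite /elim_good map_mxB map_mxD !map_sc map_munit map_mx1.
    exact: good_el.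
  exact: inv_mod_el.
apply: (big_rec K) => [|[i j] x _ [rx bx]].
  split; last by move=> i j _; rewrite mxE.
  by have := el idx0 idx1 0 isT; rewrite munit0.
have bu : block S (munit i j (w i j)).
  move=> k l kl; rewrite munitE; case: andP => // -[/eqP ek /eqP el'].
  by rewrite -ek -el' bw.
have bux : block S (munit i j (w i j) + x).
  by move=> k l kl; rewrite mxE bu // bx // addr0.
split=> //=; exists (sc psi r 1%:M - (munit i j (w i j) + x)), (r * r).
split; last exact: (inv_mod_block r bux).
have [ij|ij] := eqVneq i j.
  have -> : munit i j (w i j) = 0.
    by rewrite ij bw ?munit0 //; case: (S j).
  rewrite add0r; apply: (reachable_target M1 M1 rx) => //; first exact: MM.
  exact: (inv_mod_block r bx).
apply: (reachable_target M1 Mr (reachable_mul rx (el i j (w i j) ij))).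
- by rewrite sc1 !(mulE, psi_scE) (blockM bx bu); ncring.
- exact: MM.
- exact: (inv_mod_block r bux).
Qed.

Lemma elim_target_block S r w p : M r -> block S w ->
  elim_target ((sc psi r 1%:M + w) *m p) -> elim_target p.
Proof.
move=> Mr bw; apply: (elim_target_mul (MM Mr Mr) (inv_mod_block r bw)).
by apply: reachable_block => //; apply: blockN bw.
Qed.

Lemma sc_add_mulE r w p i j :
  ((sc psi r 1%:M + w) *m p) i j = psi r * p i j + (w *m p) i j.
Proof. by rewrite mulmxDl sc_mull mul1mx !mxE. Qed.

Definition reduced (m : nat) s p :=
  forall i j, (j < m)%N -> p i j = if i == j then psi s else 0.

Let lst : 'I_n := ord_max.

Let ne_lst i : (i < n'.+2)%N -> i != lst.
Proof. by move=> il; rewrite -val_eqE /= ltn_eqF. Qed.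
Let lst_ne i : i != lst -> (i < n'.+2)%N.
Proof. by rewrite -val_eqE /= ltn_neqAle => ->; rewrite -ltnS ltn_ord. Qed.

(** [s p] factors as diag(s, .., s, c) times [s + w], with [w] the last column above its bottom
    entry [c]. As [s] annihilates the rest of the last row of [q], the element [s q_ll] ([l] the
    last index) is a quasi-inverse of [c] on both sides. *)
Lemma reduced_target s p : M s -> reduced n'.+2 s p -> elim_target p.
Proof.
move=> Ms rp q t Mt ipq; have [pq qp] := ipq.
have p0 k : k != lst -> p lst k = 0.
  by move=> kl; rewrite rp ?lst_ne // eq_sym (negPf kl).
set c := p lst lst; set c' := psi s * q lst lst.
have cc' : c * c' = psi (s * t).
  have /matrixP/(_ lst lst) := pq.
  rewrite !mxE (bigD1 lst) //= big1 ?addr0 => [|k kl]; last by rewrite p0 // mul0r.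
  by rewrite eqxx mulr1n mulr1 => e; rewrite /c' mulrA -psiC -mulrA e rmorphM.
have q0 k : k != lst -> psi s * q lst k = 0.
  move=> kl; have /matrixP/(_ lst k) := qp.
  rewrite !mxE eq_sym (negPf kl) mulr0n mulr0 (bigD1 k) //= big1 ?addr0 => [|l lk].
    by rewrite rp ?lst_ne // eqxx psiC.
  by rewrite rp ?lst_ne // (negPf lk) mulr0.
have c'c : c' * c = psi (s * t).
  have /matrixP/(_ lst lst) := qp.
  rewrite !mxE eqxx mulr1n mulr1 rmorphM => <-.
  rewrite mulr_sumr (bigD1 lst) //= big1 ?addr0 ?mulrA // => k kl.
  by rewrite mulrA q0 // mul0r.
pose w : 'M[C]_n := \matrix_(i, j) (if (i != lst) && (j == lst) then p i lst else 0).
have bw : block (fun i => i != lst) w.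
  by move=> i j; rewrite mxE negbK => /negPf ->.
have rD : reachable (sc psi s 1%:M + munit lst lst (c - psi s)).
  exists (sc psi t 1%:M + munit lst lst (c' - psi t)), (s * t); split; last first.
    exact: (inv_mod_diag psiC).
  rewrite /elim_good !map_mxD !map_sc !map_munit !map_mx1 !rmorphB !iotaE.
  apply: (good_diag phiC n3) => //; first exact: MM.
    by rewrite -rmorphM cc' iotaE.
  by rewrite -rmorphM c'c iotaE.
apply: (reachable_target M1 Ms (reachable_mul rD (reachable_block Ms bw))) => //.
apply/matrixP=> i j; rewrite sc1 sc_add_mulE munit_mulE [RHS]mxE.
have XE k l : (sc psi s 1%:M + w) k l = psi s * (k == l)%:R + w k l by rewrite !mxE.
rewrite !XE !mxE; have [->|il] /= := eqVneq i lst; last first.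
  rewrite addr0; congr (_ * _); have [->|jl] := eqVneq j lst.
    by rewrite (negPf il) mulr0 add0r.
  rewrite rp ?lst_ne // addr0; case: (i == j); rewrite ?mulr0 ?mulr1 //.
rewrite eqxx /= !addr0 -mulrDl addrC subrK; have [->|jl] := eqVneq j lst.
  by rewrite mulr1 psiC.
by rewrite p0 // !mulr0.
Qed.

(* Column [r] is reduced by making its last entry invertible up to [M], using
   it to replace the diagonal entry by a scalar, and clearing the column. *)
Lemma elimination m : forall (r : nat) s p, (r + m)%N = n'.+2 -> M s -> reduced r s p ->
  elim_target p.
Proof.
elim: m => [|m IH] r s p rm Ms rp.
  by apply: (reduced_target Ms); rewrite -rm addn0.
have rl : (r < n'.+2)%N by rewrite -rm addnS ltnS leq_addr.
pose rr : 'I_n := Ordinal (ltnW rl : (r < n)%N).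
have rrl : rr != lst by apply: ne_lst.
move=> q t Mt ipq; have [pq qp] := ipq.
have q0 k : (k < r)%N -> psi s * q rr k = 0.
  move=> kr; have /matrixP/(_ rr k) := qp.
  rewrite !mxE -val_eqE /= gtn_eqF // mulr0n mulr0 (bigD1 k) //= big1 ?addr0 => [|l lk].
    by rewrite rp // eqxx psiC.
  by rewrite rp // (negPf lk) mulr0.
(* Only rows other than [lst] and from [r] on may be added to the last row; rows [k < r] would spoil
   the reduced columns. *)
pose off k := (k < r)%N || (k == lst).
pose B := [set x : C | exists d : 'I_n -> C,
  (forall k, off k -> d k = 0) /\ x = \sum_k d k * p k rr].
have lB : is_left_ideal B.
  split=> [|x y [d [d0 ->]] [e [e0 ->]]|a x [d [d0 ->]]].
  - by exists (fun=> 0); split=> //; rewrite big1 // => k _; rewrite mul0r.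
  - exists (fun k => d k + e k); split=> [k ok|]; first by rewrite d0 // e0 // addr0.
    by rewrite -big_split; apply: eq_bigr => k _; rewrite mulrDl.
  - exists (fun k => a * d k); split=> [k ok|]; first by rewrite d0 // mulr0.
    by rewrite mulr_sumr; apply: eq_bigr => k _; rewrite mulrA.
(* The relation needed is the diagonal entry of [q p = t] at [rr], multiplied by [s]: by [q0] the
   terms with [k < r] vanish. *)
have [y [[d [d0 ey]] [q1 [u [Mu eu]]]]] : exists y, B (y - p lst rr) /\
    exists (q : C) u, M u /\ q * y = psi u.
  apply: (sr1 (a := psi s * q rr lst) lB (MM Ms Mt)).
    exists (fun k => if off k then 0 else psi s * q rr k); split=> [k ->//|].
    by [].
  have /matrixP/(_ rr rr) := qp.
  rewrite !mxE eqxx mulr1n mulr1 rmorphM => <-.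
  rewrite mulr_sumr (bigD1 lst) //= [in RHS](bigD1 lst) //= /off eqxx orbT mul0r add0r mulrA.
  congr (_ + _); apply: eq_bigr => k kl.
  rewrite (negPf kl) orbF mulrA; case: ifP => // kr.
  by rewrite q0 // !mul0r.
suff: elim_target p by apply.
pose w1 : 'M[C]_n := \matrix_(i, k) (if i == lst then d k else 0).
have bw1 : block (fun i => i == lst) w1.
  move=> i k; rewrite mxE; case: eqP => //= _; rewrite negbK => kl.
  by rewrite d0 // /off kl orbT.
have w1E x i j : (w1 *m x) i j = if i == lst then \sum_k d k * x k j else 0.
  rewrite mxE; case: eqP => il; first by apply: eq_bigr => k _; rewrite mxE il eqxx.
  by rewrite big1 // => k _; rewrite mxE; case: eqP => //; rewrite mul0r.
apply: (elim_target_block M1 bw1); set p1 := _ *m p.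
have p1E i j : p1 i j = p i j + if i == lst then \sum_k d k * p k j else 0.
  by rewrite /p1 sc_add_mulE w1E rmorph1 mul1r.
have rp1 : reduced r s p1.
  move=> i j jr; rewrite p1E rp //; case: (i == lst); rewrite ?addr0 //.
  rewrite (bigD1 j) //= d0 ?mul0r ?add0r ?big1 ?addr0 // /off ?jr // => k kj.
  by rewrite rp // (negPf kj) mulr0.
have p1y : p1 lst rr = y by rewrite p1E eqxx -ey addrC subrK.
(* As [q1 * y = psi u], the diagonal entry becomes [u p1 + (s - p1) u = u s], the scalar that the
   reduced columns acquire as well. *)
pose c2 := (psi s - p1 rr rr) * q1.
have bw2 : block (fun i => i == rr) (munit rr lst c2).
  move=> i j; rewrite munitE; case: (i == rr) => //=; rewrite negbK => /eqP ->.
  by rewrite (negPf rrl).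
apply: (elim_target_block Mu bw2); set p2 := _ *m p1.
have p2E i j : p2 i j = psi u * p1 i j + if i == rr then c2 * p1 lst j else 0.
  by rewrite /p2 sc_add_mulE munit_mulE.
have rp2 : reduced r (u * s) p2.
  move=> i j jr; rewrite p2E !rp1 //.
  have /negPf -> : lst != j by rewrite eq_sym ne_lst // (ltn_trans jr).
  rewrite mulr0 if_same addr0 rmorphM; case: (i == j); rewrite ?mulr0 //.
have p2rr : p2 rr rr = psi (u * s).
  rewrite p2E eqxx p1y /c2 -mulrA eu rmorphM -[(_ - _) * psi u]psiC -mulrDr.
  by rewrite addrC subrK.
pose w3 : 'M[C]_n := \matrix_(i, j) (if (i != rr) && (j == rr) then - p2 i rr else 0).
have bw3 : block (fun i => i != rr) w3.
  by move=> i j; rewrite mxE negbK => /negPf ->.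
have w3E x i j : (w3 *m x) i j = if i == rr then 0 else - p2 i rr * x rr j.
  rewrite mxE (bigD1 rr) //= mxE eqxx andbT big1 ?addr0 => [|k /negPf kr].
    by case: (i == rr); rewrite //= mul0r.
  by rewrite mxE kr andbF mul0r.
apply: (elim_target_block (MM Mu Ms) bw3); set p3 := _ *m p2.
have p3E i j : p3 i j = psi (u * s) * p2 i j + if i == rr then 0 else - p2 i rr * p2 rr j.
  by rewrite /p3 sc_add_mulE w3E.
apply: (IH r.+1 (u * s * (u * s))); [by rewrite addSnnS|exact: (MM (MM Mu Ms) (MM Mu Ms))|].
move=> i j; rewrite ltnS leq_eqVlt => /orP[jr|jr].
  have -> : j = rr by apply/val_inj/eqP.
  rewrite p3E; case: (eqVneq i rr) => [->|_]; first by rewrite p2rr addr0 [RHS]rmorphM.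
  by rewrite p2rr psiC mulNr subrr.
have rj : rr != j by rewrite -val_eqE /= gtn_eqF.
have p20 : p2 rr j = 0 by rewrite rp2 // (negPf rj).
rewrite p3E p20 mulr0 if_same addr0 rp2 //.
by case: (i == j); rewrite ?mulr0 // [RHS]rmorphM.
Qed.

End Elimination.

Section MaximalIdeals.
Variable R : comPzRingType.
Implicit Types (Q : set R) (r s t : R).

Lemma exists_maximal_ideal Q : is_left_ideal Q -> ~ Q 1 ->
  exists2 m, is_maximal m & Q `<=` m.
Proof.
move=> iQ Q1.
(* Zorn's lemma is applied to sets whose union with [Q] is a proper ideal, so that the empty chain
   is covered too. *)
have [|A [[iA A1] maxA]] := @Zorn_bigcup R
    (fun A => is_left_ideal (A `|` Q) /\ ~ (A `|` Q) 1).
  move=> F FP totF; split; last by case=> // -[A FA A1]; case: (FP A FA) => _; apply; left.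
  have [Q0 QD QM] := iQ.
  have mem x A : F A -> (A `|` Q) x -> (\bigcup_(X in F) X `|` Q) x.
    by move=> FA [Ax|]; [left; exists A|right].
  have two x y : (\bigcup_(X in F) X `|` Q) x -> (\bigcup_(X in F) X `|` Q) y ->
      (exists2 A, F A & (A `|` Q) x /\ (A `|` Q) y) \/ (Q x /\ Q y).
    move=> [[A FA Ax]|Qx] [[B FB By]|Qy].
    - left; case: (totF A B FA FB) => AB.
        by exists B => //; split; left=> //; apply: AB.
      by exists A => //; split; left=> //; apply: AB.
    - by left; exists A => //; split; [left|right].
    - by left; exists B => //; split; [right|left].
    - by right.
  split; first by right.
    move=> x y hx hy; case: (two x y hx hy) => [[A FA [Ax Ay]]|[Qx Qy]].
      by case: (FP A FA) => -[_ AD _] _; apply: (mem _ A FA); apply: AD.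
    by right; apply: QD.
  move=> a x hx; case: (two x x hx hx) => [[A FA [Ax _]]|[Qx _]].
    by case: (FP A FA) => -[_ _ AM] _; apply: (mem _ A FA); apply: AM.
  by right; apply: QM.
exists (A `|` Q); last by move=> x; right.
split=> // r nr.
have [A0 AD AM] := iA.
pose B := [set x | exists y t, (A `|` Q) y /\ x = t * r + y].
have iB : is_left_ideal B.
  split=> [|x y [x' [t [Ax ->]]] [y' [t' [Ay ->]]]|a x [x' [t [Ax ->]]]].
  - by exists 0, 0; rewrite mul0r addr0.
  - by exists (x' + y'), (t + t'); split; [apply: AD|ring].
  - by exists (a * x'), (a * t); split; [apply: AM|ring].
have AB : A `|` Q `<=` B by move=> x Ax; exists x, 0; rewrite mul0r add0r.
have Br : B r by exists 0, 1; rewrite mul1r addr0.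
have BQ : B `|` Q = B.
  by apply/seteqP; split=> x; [case=> // Qx; apply: AB; right|left].
apply: contrapT => no1; apply: (maxA B).
  split; first by move=> x Ax; apply: AB; left.
  by move=> BA; apply: nr; left; apply: BA.
rewrite BQ; split=> // -[y [t [Ay e]]]; apply: no1.
by exists t, y.
Qed.

Lemma ideal_local Q : is_left_ideal Q ->
  (forall m, is_maximal m -> exists2 u, ~ m u & Q u) -> Q 1.
Proof.
move=> iQ loc; apply: contrapT => Q1.
have [m mm Qm] := exists_maximal_ideal iQ Q1.
by have [u mu /Qm] := loc m mm.
Qed.

Lemma maximal_mul m r s : is_maximal m -> ~ m r -> ~ m s -> ~ m (r * s).
Proof.
case=> -[_ mD mM] _ mV nr ns mrs; apply: ns; have [t [u [mu e]]] := mV r nr.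
have -> : s = t * (r * s) + s * u by rewrite -[LHS]mul1r -e; ring.
by apply: mD; apply: mM.
Qed.
End MaximalIdeals.

Lemma mulmx_commutator n (D : pzRingType) (u w : 'M[D]_n) :
  u *m u = 0 -> w *m w = 0 ->
  (1%:M + u) *m (1%:M + w) *m (1%:M - u) *m (1%:M - w) =
  1%:M + (u *m w + u *m w *m (u *m w) - u *m w *m u + w *m u *m w - w *m u).
Proof.
move=> uu ww; set rhs := RHS.
transitivity (rhs - u *m u - w *m w - u *m (w *m w) + u *m u *m w).
  by rewrite /rhs; ncring.
by rewrite uu ww mulmx0 mul0mx; ncring.
Qed.

Section LocalGlobal.
Variables (R : comPzRingType) (D C : pzRingType).
Variables (phi : {rmorphism R -> D}) (psi : {rmorphism R -> C}) (iota : {rmorphism C -> D}).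
Hypothesis phiC : forall r x, phi r * x = x * phi r.
Hypothesis psiC : forall r x, psi r * x = x * psi r.
Hypothesis iotaE : forall r, iota (psi r) = phi r.
Variables (d : nat) (v : 'I_d -> C).
Hypothesis span_v : forall x, exists c : 'I_d -> R, x = \sum_i psi (c i) * v i.
Variable n' : nat.
Notation n := n'.+3.
Notation i0 := (idx0 n').
Notation i1 := (idx1 n').
Variables (g : GL n D) (p q : 'M[C]_n).
Hypotheses (gp : map_mx iota p = GLmx g) (gq : map_mx iota q = GLmxV g).
Hypotheses (pq : p *m q = 1%:M) (qp : q *m p = 1%:M).

Let n3 : (2 < n)%N. Proof. by []. Qed.

Lemma local_good J m : is_ideal J -> is_maximal m ->
  good phi J (fun r => ~ m r) i0 i1 (GLmx g) (GLmxV g) 1.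
Proof.
move=> iJ mm; rewrite -gp -gq.
have M1 : ~ m 1 by case: mm.
have MM r s : ~ m r -> ~ m s -> ~ m (r * s) by apply: maximal_mul.
apply: (@elimination _ _ _ phi psi iota phiC psiC iotaE (fun r => ~ m r) J iJ M1
  MM (local_sr1 psiC span_v mm) n' n'.+2 0 1) => //.
by split; rewrite ?pq ?qp sc1.
Qed.

Lemma cj_el_rel_elem J i j x : is_ideal J -> i != j -> J x ->
  rel_elem J (cj g (el i j x)).
Proof.
move=> iJ ij Jx; have [o M V] := @rel_elem_group n D J.
pose Q := [set r | forall y, J y -> rel_elem J (cj g (el i j (phi r * y)))].
suff /(_ x Jx) : Q 1 by rewrite rmorph1 mul1r.
apply: ideal_local => [|m mm].
  split=> [y Jy|r s Qr Qs y Jy|r s Qs y Jy].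
  - by rewrite rmorph0 mul0r el0 cj1.
  - by rewrite rmorphD mulrDl -elD cjM; apply: M; [apply: Qr|apply: Qs].
  - by rewrite mulrC rmorphM -mulrA; apply: Qs; apply: tidealMl.
have M1 : ~ m 1 by case: mm.
have [u mu [H _]] := good_cj phiC iJ M1 (local_good iJ mm).
by exists u => // y Jy; apply: H.
Qed.

Lemma cj_rel_elem J : is_ideal J -> normalizes [set g] (rel_elem J).
Proof.
move=> iJ _ h -> Jh; have [o M V] := @rel_elem_group n D J.
apply: (@rel_elem_min _ _ _ (fun h => rel_elem J (cj g h))) Jh.
- split=> [|a b Ja Jb|a Ja]; rewrite ?cj1 ?cjM ?cjV //; [exact: M|exact: V].
- move=> k l c a kl Ja; rewrite cj_cj.
  apply: (En_normalizes (@rel_elem_group _ _ J) (@rel_elem_stable _ _ J)) => //.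
  (* The unit ideal shows that [g] conjugates elementary matrices into [En]. *)
  by apply: rel_elem_En; apply: (@cj_el_rel_elem setT).
- by move=> i j x ij Jx; apply: cj_el_rel_elem.
Qed.

Section Corner.
Variables (J K : set D) (b : D).
Hypotheses (iJ : is_ideal J) (Kphi : forall r a, K a -> K (phi r * a)).
Hypothesis KJ : forall a, K a -> J (a * b) /\ J (b * a).
Let y a : GL n D := commutator (el i0 i1 a) (el i1 i0 b).
Let i01 : i0 != i1. Proof. by []. Qed.
Let i10 : i1 != i0. Proof. by []. Qed.

(** Every term of the commutator beyond 1 contains the central factor [phi r], which is split off
    explicitly; the same is done for the inverse. *)
Lemma corner_commutator r a : K a -> exists2 z, corner_unit phi J i0 i1 r z &
  GLmx (y (phi r * a)) = lvl phi r z.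
Proof.
move=> Ka; have [Jab Jba] := KJ Ka.
have Jm s c : J (phi s * (a * b * c)).
  by apply: tidealMl => //; apply: tidealMr.
have Jm' s c : J (phi s * (b * a * c)).
  by apply: tidealMl => //; apply: tidealMr.
pose z : 'M[D]_n := munit i0 i0 (a * b + phi r * (a * b * (a * b))) -
  munit i0 i1 (phi r * (a * b * a)) + munit i1 i0 (b * a * b) - munit i1 i1 (b * a).
pose z' : 'M[D]_n := munit i1 i1 (b * a + phi r * (b * a * (b * a))) -
  munit i1 i0 (b * a * b) + munit i0 i1 (phi r * (a * b * a)) - munit i0 i0 (a * b).
have cornerP w00 w01 w10 w11 : J w00 -> J w01 -> J w10 -> J w11 ->
   corner J i0 i1 (munit i0 i0 w00 + munit i0 i1 w01 + munit i1 i0 w10 + munit i1 i1 w11).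
  move=> J00 J01 J10 J11; split=> k l.
    rewrite !mxE !munitE; do !apply: tidealD => //; case: ifP => // _; exact: tideal0.
  rewrite !mxE !munitE !inE.
  by case: (k == i0); case: (k == i1); case: (l == i0); case: (l == i1) => //= _;
    rewrite ?addr0.
set f := phi r in z z' *.
have e0 : f * a * b = f * (a * b) by rewrite mulrA.
have e1 : f * (a * b) * (f * (a * b)) = f * (f * (a * b * (a * b))).
  by rewrite !mulrA -(phiC r (f * a * b)) !mulrA.
have e2 : f * (a * b) * (f * a) = f * (f * (a * b * a)).
  by rewrite !mulrA -(phiC r (f * a * b)) !mulrA.
have e3 : b * (f * a) = f * (b * a) by rewrite !mulrA -(phiC r b).
have e4 : f * (b * a) * (f * (b * a)) = f * (f * (b * a * (b * a))).
  by rewrite !mulrA -(phiC r (f * b * a)) !mulrA.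
have ey : GLmx (y (f * a)) = lvl phi r z.
  rewrite /y /commutator !GLmxM -!elN !GLmx_el // !munitN.
  rewrite mulmx_commutator ?munit_sq // /lvl !munitM !eqxx; congr (_ + _).
  by rewrite !(scDr, scN, sc_munit) -/f e0 e3 e1 e2 mulrDr munitD -(mulrA f _ b).
have ey' : GLmxV (y (f * a)) = lvl phi r z'.
  rewrite -[LHS]/(GLmx (y (f * a))^-1%g) /y commutatorV /commutator.
  rewrite !GLmxM -!elN !GLmx_el // !munitN.
  rewrite mulmx_commutator ?munit_sq // /lvl !munitM !eqxx; congr (_ + _).
  by rewrite !(scDr, scN, sc_munit) -/f e0 e3 e4 e2 mulrDr munitD -(mulrA f _ b).
exists z => //; split; last exists z'; rewrite -?ey -?ey' ?GLmxK ?GLmxVK.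
- have -> : z = munit i0 i0 (a * b + f * (a * b * (a * b))) +
    munit i0 i1 (- (f * (a * b * a))) + munit i1 i0 (b * a * b) +
    munit i1 i1 (- (b * a)) by rewrite !munitN.
  apply: cornerP; [|apply: tidealN|apply: tidealMr|apply: tidealN] => //.
    by apply: tidealD => //; apply: Jm.
  exact: Jm.
- split=> //.
  have -> : z' = munit i0 i0 (- (a * b)) + munit i0 i1 (f * (a * b * a)) +
    munit i1 i0 (- (b * a * b)) + munit i1 i1 (b * a + f * (b * a * (b * a))).
    by rewrite !munitN /z'; ncring.
  apply: cornerP; [apply: tidealN| |apply: tidealN|apply: tidealD] => //.
  - exact: Jm.
  - exact: tidealMr.
  - exact: Jm'.
Qed.

(** [K] is only a set closed under scalars: in the double it will be the diagonal copy of an ideal,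
    which is not an ideal there. *)
Lemma cj_corner_commutator a : K a ->
  exists2 e, rel_elem J e & cj g (y a) = (e * y a)%g.
Proof.
have [J1 M V] := @rel_elem_group n D J.
have nJ := En_normalizes (@rel_elem_group _ _ J) (@rel_elem_stable _ _ J).
have Ey c : @En n D (y c).
  have [_ EM EV] := @En_group n D.
  by apply: (EM); [apply: (EM); [apply: EM|]|]; try apply: EV; apply: mem_En.
pose Q := [set r | forall a, K a ->
  exists2 e, rel_elem J e & cj g (y (phi r * a)) = (e * y (phi r * a))%g].
move=> Ka; suff /(_ a Ka) : Q 1 by rewrite rmorph1 mul1r.
apply: ideal_local => [|m mm].
  split=> [c Kc|r s Qr Qs c Kc|r s Qs c Kc].
  - exists 1%g => //; rewrite rmorph0 mul0r /y el0.
    by rewrite /commutator !gsimpE cj1.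
  - have [e Je ee] := Qr c Kc; have [e' Je' ee'] := Qs c Kc.
    (* [y (a + a')] is [cj (el i0 i1 a) (y a') * y a]. The conjugation is absorbed into [rel_elem J]
       by goodness of elementary matrices, taken with 1 as the only denominator. *)
    have [e0 Je0 ee0] : exists2 e, rel_elem J e &
        cj (el i0 i1 (phi r * c)) (y (phi s * c)) = (e * y (phi s * c))%g.
      have M11 : (1 : R) = 1 by [].
      have MM (u w : R) : u = 1 -> w = 1 -> u * w = 1 by move=> -> ->; rewrite mulr1.
      have := good_el phiC n3 i0 i1 iJ (M := fun u => u = 1) M11 MM (phi r * c) i01 M11.
      rewrite !sc1 mulr1 -munitN -!GLmx_el // elN.
      move=> /(good_cj phiC iJ M11)[u -> [_ H]].
      have [z cz ez] := corner_commutator 1 (Kphi s Kc).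
      by apply: (H z) => //; rewrite -ez rmorph1 mul1r.
    have yD : y (phi (r + s) * c) = (e0 * y (phi s * c) * y (phi r * c))%g.
      rewrite -ee0 rmorphD mulrDl /y -elD /commutator /cj.
      by rewrite !gsimpE.
    exists (cj g e0 * e' * cj (y (phi s * c)) e * e0^-1)%g.
      apply: (M); last exact: V.
      by apply: (M); [apply: (M) => //; apply: (cj_rel_elem iJ)|apply: nJ].
    rewrite yD (cjM g (e0 * y (phi s * c))%g) (cjM g e0) ee ee'.
    by rewrite /cj !gsimpE.
  - by rewrite mulrC rmorphM -mulrA; apply: Qs; apply: Kphi.
have M1 : ~ m 1 by case: mm.
have [u mu [_ H]] := good_cj phiC iJ M1 (local_good iJ mm).
exists u => // c Kc; have [z cz ez] := corner_commutator u Kc.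
exact: H cz ez.
Qed.
End Corner.
End LocalGlobal.

(** * The double of a ring along an ideal *)

Section Subring.
Variables (B : pzRingType) (S : set B).

Definition is_subring :=
  [/\ S 1, forall x y, S x -> S y -> S (x - y) & forall x y, S x -> S y -> S (x * y)].

Definition subring_pred of is_subring : pred B := fun x => `[< S x >].

Variable hS : is_subring.

Lemma subring_predP x : reflect (S x) (x \in subring_pred hS).
Proof. exact: asboolP. Qed.

Lemma subring_pred_closed : subring_closed (subring_pred hS).
Proof.
case: (hS) => S1 SB SM; split=> [|x y|x y]; first exact/subring_predP.
  by move=> /subring_predP Sx /subring_predP Sy; apply/subring_predP; apply: SB.
by move=> /subring_predP Sx /subring_predP Sy; apply/subring_predP; apply: SM.
Qed.
HB.instance Definition _ :=
  GRing.isSubringClosed.Build B (subring_pred hS) subring_pred_closed.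

Definition subring_of : Type := {x : B | x \in subring_pred hS}.
HB.instance Definition _ := SubChoice.on subring_of.
HB.instance Definition _ :=
  GRing.SubChoice_isSubPzRing.Build B (subring_pred hS) subring_of subring_pred_closed.

Definition subring_val : {rmorphism subring_of -> B} := val.

Lemma subring_valP (u : subring_of) : S (subring_val u).
Proof. by apply/subring_predP; apply: valP. Qed.

Lemma subring_val_inj : injective subring_val.
Proof. exact: val_inj. Qed.

Lemma subring_mk x : S x -> exists u, subring_val u = x.
Proof. by move=> /subring_predP Sx; exists (exist _ x Sx). Qed.

Section Lift.
Variables (R : pzRingType) (f : {rmorphism R -> B}).
Hypothesis fS : forall r, S (f r).
Definition subring_lift_fun (r : R) : subring_of :=
  exist _ (f r) (introT (subring_predP _) (fS r)).
Lemma subring_lift_zmod : zmod_morphism subring_lift_fun.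
Proof. by move=> x y; apply: val_inj; rewrite /= rmorphB. Qed.
Lemma subring_lift_monoid : monoid_morphism subring_lift_fun.
Proof.
by split=> [|x y]; apply: val_inj; rewrite /= ?rmorph1 ?rmorphM.
Qed.
HB.instance Definition _ :=
  GRing.isZmodMorphism.Build R subring_of subring_lift_fun subring_lift_zmod.
HB.instance Definition _ :=
  GRing.isMonoidMorphism.Build R subring_of subring_lift_fun subring_lift_monoid.
Definition subring_lift : {rmorphism R -> subring_of} := subring_lift_fun.
End Lift.
End Subring.

Section GLmapTheory.
Variables (n : nat) (A B : pzRingType) (f : {rmorphism A -> B}).
Implicit Types g h : GL n A.

Lemma GLmx_map g : GLmx (GLmap f g) = map_mx f (GLmx g).
Proof. by []. Qed.
Lemma GLmapM g h : GLmap f (g * h)%g = (GLmap f g * GLmap f h)%g.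
Proof. by apply: GLmx_inj; rewrite GLmx_map !GLmxM map_mxM. Qed.
Lemma GLmap1 : GLmap f 1%g = 1%g :> GL n B.
Proof. by apply: GLmx_inj; rewrite GLmx_map map_mx1. Qed.
Lemma GLmapV g : GLmap f (g^-1)%g = ((GLmap f g)^-1)%g.
Proof. by apply: GLmx_inj. Qed.
Lemma GLmap_cj g h : GLmap f (cj g h) = cj (GLmap f g) (GLmap f h).
Proof. by rewrite /cj !GLmapM GLmapV. Qed.
Lemma GLmap_commutator g h :
  GLmap f (commutator g h) = commutator (GLmap f g) (GLmap f h).
Proof. by rewrite !commutatorE GLmapM GLmap_cj GLmapV. Qed.
Lemma GLmap_el (i j : 'I_n) a : GLmap f (el i j a) = el i j (f a).
Proof.
have [->|ij] := eqVneq i j; first by rewrite !el_diag GLmap1.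
apply: GLmx_inj; rewrite GLmx_map !GLmx_el // map_mxD map_mx1; congr (_ + _).
by apply/matrixP=> k l; rewrite mxE !munitE; case: ifP => _ //; rewrite raddf0.
Qed.
End GLmapTheory.

Section Circle.
Variable A : pzRingType.
Implicit Types X Y : set A.

Definition circle X Y : set A :=
  smallest (@is_ideal A) [set z | exists x y, [/\ X x, Y y & z = x * y \/ z = y * x]].

Lemma circle_ideal X Y : is_ideal (circle X Y).
Proof.
split=> [I [iI _]|x y hx hy I II|a x hx I II|a x hx I II].
- exact: tideal0.
- by have [iI _] := II; apply: tidealB; [|apply: hx|apply: hy].
- by have [iI _] := II; apply: tidealMl; [|apply: hx].
- by have [iI _] := II; apply: tidealMr; [|apply: hx].
Qed.

Lemma circle_l X Y x y : X x -> Y y -> circle X Y (x * y).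
Proof. by move=> Xx Yy; apply: sub_gen_smallest; exists x, y; split=> //; left. Qed.
Lemma circle_r X Y x y : X x -> Y y -> circle X Y (y * x).
Proof. by move=> Xx Yy; apply: sub_gen_smallest; exists x, y; split=> //; right. Qed.

Lemma circle_min X Y (Z : set A) : is_ideal Z ->
  (forall x y, X x -> Y y -> Z (x * y) /\ Z (y * x)) -> circle X Y `<=` Z.
Proof.
move=> iZ hZ; apply: smallest_sub => // z [x [y [Xx Yy]]].
by have [] := hZ x y Xx Yy => ? ? [->|->].
Qed.

(** The [z] with all [el i j z] in the commutator subgroup form an ideal: multiplying [z] by a ring
    element is a commutator with an elementary matrix, under which that subgroup is stable. *)
Lemma circle_rel_elem n X Y : (2 < n)%N -> is_ideal X -> is_ideal Y ->
  rel_elem (circle X Y) `<=` commutator_subgroup (@rel_elem n A X) (rel_elem Y).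
Proof.
move=> n3 iX iY; set N := commutator_subgroup _ _.
have gN : is_subgroup N by apply: commutator_group.
have [N1 NM NV] := gN.
have sN : elem_stable N.
  move=> p q c g pq; apply: (@commutator_norm _ [set el p q c]) => // h x -> hx;
  exact: rel_elem_stable.
apply: rel_elem_min => // i j z ij Cz.
suff : forall i j, i != j -> N (el i j z) by apply.
move: z Cz {i j ij}.
apply: circle_min.
  have ring_mul z a : (forall i j, i != j -> N (el i j z)) ->
      (forall i j, i != j -> N (el i j (a * z)) /\ N (el i j (z * a))).
    move=> Nz i j ij; have [h [hi hj]] := third_index i j n3.
    have ih : i != h by rewrite eq_sym.
    rewrite -(comm_el a z ih hj ij) -(comm_el z a ih hj ij); split.
      by rewrite commutatorE; apply: (NM); [apply: sN => //; apply: Nz|apply: (NV); apply: Nz].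
    rewrite -commutatorV; apply: (NV).
    by rewrite commutatorE; apply: (NM); [apply: sN => //; apply: Nz|apply: (NV); apply: Nz].
  split=> [i j _|z w Nz Nw i j ij|a z Nz i j ij|a z Nz i j ij].
  - by rewrite el0.
  - by rewrite -elD elN; apply: (NM); [apply: Nz|apply: (NV); apply: Nw].
  - by have [] := ring_mul z a Nz i j ij.
  - by have [] := ring_mul z a Nz i j ij.
move=> x y Xx Yy; split=> i j ij; have [h [hi hj]] := third_index i j n3.
  have ih : i != h by rewrite eq_sym.
  by rewrite -(comm_el x y ih hj ij); apply: mem_commutator; apply: mem_rel_elem.
have ih : i != h by rewrite eq_sym.
rewrite -(comm_el y x ih hj ij) -commutatorV; apply: (NV).
by apply: mem_commutator; apply: mem_rel_elem.
Qed.
End Circle.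

Section Double.
Variables (A : pzRingType) (J : set A).
Hypothesis iJ : is_ideal J.

(* The double of [A] along [J]: if [g] is congruent to [1] modulo [J], then
   [(g, 1)] is an invertible matrix over this ring. *)
Definition double_set : set (A * A)%type := [set u | J (u.1 - u.2)].

Lemma double_subring : is_subring double_set.
Proof.
split=> [|u w|u w]; rewrite /double_set /=.
- by rewrite subrr; apply: tideal0.
- move=> Ju Jw; have -> : u.1 - w.1 - (u.2 - w.2) = (u.1 - u.2) - (w.1 - w.2).
    by ncring.
  exact: tidealB.
- move=> Ju Jw; have -> : u.1 * w.1 - u.2 * w.2 =
    (u.1 - u.2) * w.1 + u.2 * (w.1 - w.2) by ncring.
  by apply: tidealD => //; [apply: tidealMr|apply: tidealMl].
Qed.

Definition double_ring := subring_of double_subring.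
HB.instance Definition _ := GRing.PzRing.on double_ring.

Definition dfst : {rmorphism double_ring -> A} := (fst \o subring_val double_subring).
Definition dsnd : {rmorphism double_ring -> A} := (snd \o subring_val double_subring).

Lemma double_eq u w : dfst u = dfst w -> dsnd u = dsnd w -> u = w.
Proof.
move=> e1 e2; apply: (@subring_val_inj _ _ double_subring).
by rewrite [LHS]surjective_pairing [RHS]surjective_pairing; congr pair.
Qed.

Lemma double_mem u : J (dfst u - dsnd u).
Proof. exact: (subring_valP (u : subring_of double_subring)). Qed.

Definition mk_double x y : double_ring :=
  match pselect (J (x - y)) with
  | left h => sval (cid (subring_mk double_subring (h : double_set (x, y))))
  | right _ => 0
  end.

Lemma mk_doubleP x y : J (x - y) -> dfst (mk_double x y) = x /\ dsnd (mk_double x y) = y.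
Proof.
rewrite /mk_double; case: pselect => // h _; case: cid => u /= e.
by rewrite /dfst /dsnd /= e.
Qed.

Section DoubleElementary.
Variables (n : nat) (X : set A).
Hypotheses (n3 : (2 < n)%N) (iX : is_ideal X).
Notation N := (commutator_subgroup (@rel_elem n A X) (rel_elem J)).

(** Contains the diagonal copy of [X]. Multiplication by (c, c') adds to the difference a term of
    the form (c - c') x, which lies in [circle X J]. *)
Definition double_ideal : set double_ring :=
  [set u | [/\ X (dfst u), X (dsnd u) & circle X J (dfst u - dsnd u)]].

Lemma double_idealP : is_ideal double_ideal.
Proof.
have iC := circle_ideal X J.
split=> [|u w [X1 X2 X12] [Y1 Y2 Y12]|c u [X1 X2 X12]|c u [X1 X2 X12]].
- by split; rewrite !rmorph0 ?subrr; apply: tideal0.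
- split; rewrite !rmorphB; try exact: tidealB.
  have -> : dfst u - dfst w - (dsnd u - dsnd w) = (dfst u - dsnd u) - (dfst w - dsnd w).
    by ncring.
  exact: (tidealB iC).
- split; rewrite !rmorphM; try exact: tidealMl.
  have -> : dfst c * dfst u - dsnd c * dsnd u =
    (dfst c - dsnd c) * dfst u + dsnd c * (dfst u - dsnd u) by ncring.
  apply: (tidealD iC) => //; last exact: (tidealMl iC).
  by apply: circle_r => //; apply: double_mem.
- split; rewrite !rmorphM; try exact: tidealMr.
  have -> : dfst u * dfst c - dsnd u * dsnd c =
    (dfst u - dsnd u) * dfst c + dsnd u * (dfst c - dsnd c) by ncring.
  apply: (tidealD iC) => //; first exact: (tidealMr iC).
  by apply: circle_l => //; apply: double_mem.
Qed.

Lemma commutator_rel_norm Y Z : normalizes (@En n A)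
  (commutator_subgroup (@rel_elem n A Y) (rel_elem Z)).
Proof.
apply: commutator_norm; apply: En_normalizes;
  by [apply: rel_elem_group|apply: rel_elem_stable].
Qed.

(** On a generator the components differ by [el i j] of an element of [circle X J]. Conjugation by
    an elementary matrix of the double contributes a commutator of [rel_elem J] with [rel_elem X],
    which is why the second component is tracked too. *)
Lemma double_rel_elem (e : GL n double_ring) : rel_elem double_ideal e ->
  rel_elem X (GLmap dsnd e) /\ N (GLmap dfst e * (GLmap dsnd e)^-1)%g.
Proof.
have [N1 NM NV] : is_subgroup N by apply: commutator_group.
have [X1 XM XV] := @rel_elem_group n A X.
have nN : normalizes (@En n A) N := @commutator_rel_norm X J.
move: e; apply: rel_elem_min.
- split=> [|e h [Xe Ne] [Xh Nh]|e [Xe Ne]].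
  + by rewrite !GLmap1 !gsimpE.
  + rewrite !GLmapM; split; first exact: XM.
    have -> : (GLmap dfst e * GLmap dfst h * (GLmap dsnd e * GLmap dsnd h)^-1)%g =
      (GLmap dfst e * (GLmap dsnd e)^-1 *
       cj (GLmap dsnd e) (GLmap dfst h * (GLmap dsnd h)^-1))%g.
      by rewrite /cj !gsimpE.
    by apply: (NM) => //; apply: nN => //; apply: rel_elem_En Xe.
  + rewrite !GLmapV; split; first exact: XV.
    have -> : ((GLmap dfst e)^-1 * (GLmap dsnd e)^-1^-1)%g =
      (cj (GLmap dsnd e)^-1 (GLmap dfst e * (GLmap dsnd e)^-1)^-1)%g.
      by rewrite /cj !gsimpE.
    by apply: (nN); [apply: rel_elem_En (XV _ Xe)|apply: NV].
- move=> p q c e pq [Xe Ne]; rewrite !GLmap_cj !GLmap_el.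
  split; first exact: rel_elem_stable.
  have -> : dfst c = dfst c - dsnd c + dsnd c by rewrite subrK.
  rewrite -elD; set ej := el p q (dfst c - dsnd c); set e2 := el p q (dsnd c).
  have Jej : rel_elem J ej by apply: mem_rel_elem => //; apply: double_mem.
  set x := GLmap dfst e in Ne *; set y := GLmap dsnd e in Xe Ne *.
  have -> : (cj (ej * e2) x * (cj e2 y)^-1)%g =
      (cj ej (cj e2 (x * y^-1)) * commutator ej (cj e2 y))%g.
    by rewrite /commutator /cj !gsimpE.
  apply: NM.
    by apply: (nN); [apply: rel_elem_En Jej|apply: (nN) => //; apply: mem_En].
  by apply: commutator_subC; apply: mem_commutator => //; apply: rel_elem_stable.
- move=> i j x ij [x1 x2 x12]; rewrite !GLmap_el; split; first exact: mem_rel_elem.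
  rewrite -elN elD; apply: circle_rel_elem => //.
  exact: mem_rel_elem.
Qed.
End DoubleElementary.

End Double.

(** * Congruence subgroups of ideals *)

Section CongruenceSubgroup.
Variables (n : nat) (A : pzRingType) (J : set A).
Hypothesis iJ : is_ideal J.
Implicit Types (P Q : 'M[A]_n) (g h : GL n A).

Definition mx_in P := forall i j, J (P i j).

Lemma mx_inD P Q : mx_in P -> mx_in Q -> mx_in (P + Q).
Proof. by move=> hP hQ i j; rewrite mxE; apply: tidealD. Qed.
Lemma mx_inMl P Q : mx_in Q -> mx_in (P *m Q).
Proof.
move=> hQ i j; rewrite mxE; apply: (big_ind J) => [||k _].
- exact: tideal0.
- exact: tidealD.
- exact: tidealMl.
Qed.
Lemma mx_inMr P Q : mx_in P -> mx_in (P *m Q).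
Proof.
move=> hP i j; rewrite mxE; apply: (big_ind J) => [||k _].
- exact: tideal0.
- exact: tidealD.
- exact: tidealMr.
Qed.
Lemma mx_inN P : mx_in P -> mx_in (- P).
Proof. by move=> hP i j; rewrite mxE; apply: tidealN. Qed.

Definition congruence : set (GL n A) := [set g | mx_in (GLmx g - 1%:M)].

Lemma congruenceV g : congruence g -> mx_in (GLmxV g - 1%:M).
Proof.
move=> hg; have -> : GLmxV g - 1%:M = GLmxV g *m - (GLmx g - 1%:M).
  by rewrite !mulE GLmxVK; ncring.
by apply: mx_inMl; apply: mx_inN.
Qed.

Lemma congruence_group : is_subgroup congruence.
Proof.
split=> [i j|g h hg hh|g hg].
- by rewrite subrr mxE; apply: tideal0.
- rewrite /congruence /= GLmxM.
  have -> : GLmx g *m GLmx h - 1%:M = (GLmx g - 1%:M) *m GLmx h + (GLmx h - 1%:M).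
    by rewrite !mulE; ncring.
  by apply: mx_inD => //; apply: mx_inMr.
- exact: congruenceV.
Qed.

Lemma congruence_cj h g : congruence g -> congruence (cj h g).
Proof.
move=> hg; rewrite /congruence /= /cj !GLmxM.
have -> : GLmx h *m GLmx g *m GLmx (h^-1)%g - 1%:M =
    GLmx h *m (GLmx g - 1%:M) *m GLmxV h.
  by rewrite -[GLmx (h^-1)%g]/(GLmxV h) !mulE GLmxK.
by apply: mx_inMr; apply: mx_inMl.
Qed.

Lemma rel_elem_congruence : rel_elem J `<=` congruence.
Proof.
apply: rel_elem_min => [|p q c g _|i j x ij Jx k l]; first exact: congruence_group.
  exact: congruence_cj.
rewrite GLmx_el // addrAC subrr add0r munitE; case: ifP => // _; exact: tideal0.
Qed.
End CongruenceSubgroup.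

Lemma commutator_congruence n (A : pzRingType) (X Y : set A) :
  commutator_subgroup (@congruence n A X) (congruence Y) `<=`
  congruence (circle X Y).
Proof.
have iC := circle_ideal X Y.
apply: commutator_min => [|g h hg hh]; first exact: congruence_group.
rewrite /congruence /= /commutator !GLmxM.
set P := GLmx g in hg *; set Q := GLmx h in hh *.
have -> : P *m Q *m GLmx (g^-1)%g *m GLmx (h^-1)%g - 1%:M =
  ((P - 1%:M) *m (Q - 1%:M) - (Q - 1%:M) *m (P - 1%:M)) *m GLmxV g *m GLmxV h.
  rewrite -[GLmx (h^-1)%g]/(GLmxV h) -[GLmx (g^-1)%g]/(GLmxV g).
  have -> : (P - 1%:M) *m (Q - 1%:M) - (Q - 1%:M) *m (P - 1%:M) = P *m Q - Q *m P.
    by ncring.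
  by rewrite !mulE -(mulmxA Q P) GLmxK mulmx1 GLmxK.
apply: mx_inMr => //; apply: mx_inMr => //; apply: mx_inD => //.
  move=> i j; rewrite mxE; apply: (big_ind (circle X Y)) => [||k _].
  - exact: tideal0.
  - exact: tidealD.
  - by apply: circle_l.
apply: mx_inN => // i j; rewrite mxE; apply: (big_ind (circle X Y)) => [||k _].
- exact: tideal0.
- exact: tidealD.
- by apply: circle_r.
Qed.

Lemma GL_relE n (A : pzRingType) (I : twoSidedIdeal A) :
  GL_rel n I = congruence [set a | a \in I].
Proof.
apply/seteqP; split=> g.
  move=> /(congr1 (@GLmx _ _)) /matrixP e i j; rewrite /= !mxE.
  apply/quot_projE; have := e i j; rewrite !mxE => eij; apply: (etrans eij).
  by case: (i == j); rewrite /= ?mulr1n ?mulr0n ?rmorph1 ?rmorph0.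
move=> hg; apply: GLmx_inj; apply/matrixP=> i j.
have := hg i j; rewrite /= !mxE => /quot_projE eij; apply: (etrans eij).
by case: (i == j); rewrite /= ?mulr1n ?mulr0n ?rmorph1 ?rmorph0.
Qed.

Section QuasiFiniteDouble.
Variables (R : comPzRingType) (A : algebra R).
Hypothesis qfA : quasi_finite A.
Variable J : set A.
Hypothesis iJ : is_ideal J.

Lemma quasi_finite_seq (s : seq A) : exists B : set A,
  [/\ is_subalgebra B, module_finite B & forall x, x \in s -> B x].
Proof.
have [I [le [B [[[i0] lerefl letrans ledir] hB mB UB]]]] := qfA.
have mem x : exists i, B i x.
  by have : [set: A] x by []; rewrite -UB => -[i _ Bx]; exists i.
suff [i Bi] : exists i, forall x, x \in s -> B i x.
  by exists (B i); have [? ?] := hB i.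
elim: s => [|x s [i Bi]]; first by exists i0.
have [j Bj] := mem x; have [k [ik jk]] := ledir i j; exists k => y.
rewrite in_cons => /orP[/eqP ->|/Bi]; first exact: (mB _ _ jk).
exact: (mB _ _ ik).
Qed.

Notation D := (double_ring iJ).

Definition diag_alg (r : R) : (A * A)%type := (alg_map A r, alg_map A r).
Lemma diag_alg_zmod : zmod_morphism diag_alg.
Proof. by move=> x y; rewrite /diag_alg rmorphB. Qed.
Lemma diag_alg_monoid : monoid_morphism diag_alg.
Proof. by split=> [|x y]; rewrite /diag_alg ?rmorph1 ?rmorphM. Qed.
HB.instance Definition _ :=
  GRing.isZmodMorphism.Build R (A * A)%type diag_alg diag_alg_zmod.
HB.instance Definition _ :=
  GRing.isMonoidMorphism.Build R (A * A)%type diag_alg diag_alg_monoid.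

Lemma diag_alg_double r : double_set J (diag_alg r).
Proof. by rewrite /double_set /= subrr; apply: tideal0. Qed.

Definition double_alg : {rmorphism R -> D} :=
  subring_lift (double_subring iJ) diag_alg_double.

Lemma dfst_alg r : dfst iJ (double_alg r) = alg_map A r. Proof. by []. Qed.
Lemma dsnd_alg r : dsnd iJ (double_alg r) = alg_map A r. Proof. by []. Qed.

Lemma double_algC r (x : D) : double_alg r * x = x * double_alg r.
Proof. by apply: double_eq; rewrite !rmorphM ?dfst_alg ?dsnd_alg alg_mapC. Qed.

Definition double_inl x : D := mk_double iJ x 0.
Lemma dfst_inl x : J x -> dfst iJ (double_inl x) = x.
Proof. by move=> Jx; have [] := @mk_doubleP _ _ iJ x 0; rewrite ?subr0. Qed.
Lemma dsnd_inl x : J x -> dsnd iJ (double_inl x) = 0.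
Proof. by move=> Jx; have [] := @mk_doubleP _ _ iJ x 0; rewrite ?subr0. Qed.

(* For a module finite subalgebra spanned by [v] and finitely many [x t] in it
   and in [J], [R + sum R (v_a x_t v_b, 0)] is a module finite subring of [D]. *)
Section Span.
Variables (T : finType) (x : T -> A) (B : set A) (d : nat) (v : 'I_d -> A).
Hypotheses (sB : is_subalgebra B) (Jx : forall t, J (x t)) (Bx : forall t, B (x t)).
Hypothesis Bv : B = [set y | exists c : 'I_d -> R, y = \sum_(i < d) alg_map A (c i) * v i].

Let Tw : finType := option ('I_d * T * 'I_d).
Definition span_gen (u : Tw) : D := match u with
  | None => 1
  | Some (a, t, b) => double_inl (v a * x t * v b)
  end.

Definition span_set : set D :=
  [set u | exists c : Tw -> R, u = \sum_t double_alg (c t) * span_gen t].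

Let Jv a t b : J (v a * x t * v b).
Proof. by apply: tidealMr => //; apply: tidealMl. Qed.

Let Bv1 i : B (v i).
Proof.
rewrite Bv; exists (fun j => if j == i then 1 else 0).
rewrite (bigD1 i) //= eqxx rmorph1 mul1r big1 ?addr0 // => j /negPf ->.
by rewrite rmorph0 mul0r.
Qed.

Lemma span_set0 : span_set 0.
Proof. by exists (fun=> 0); rewrite big1 // => t _; rewrite rmorph0 mul0r. Qed.
Lemma span_setD u w : span_set u -> span_set w -> span_set (u + w).
Proof.
move=> [c ->] [e ->]; exists (fun t => c t + e t).
by rewrite -big_split; apply: eq_bigr => t _; rewrite rmorphD mulrDl.
Qed.
Lemma span_setZ r u : span_set u -> span_set (double_alg r * u).
Proof.
move=> [c ->]; exists (fun t => r * c t).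
by rewrite mulr_sumr; apply: eq_bigr => t _; rewrite rmorphM mulrA.
Qed.
Lemma span_set_sum (I : finType) (F : I -> D) :
  (forall i, span_set (F i)) -> span_set (\sum_i F i).
Proof. by move=> hF; apply: (big_ind span_set) => //; [exact: span_set0|exact: span_setD]. Qed.
Lemma span_set_gen t : span_set (span_gen t).
Proof.
exists (fun u => if u == t then 1 else 0).
rewrite (bigD1 t) //= eqxx rmorph1 mul1r big1 ?addr0 // => j /negPf ->.
by rewrite rmorph0 mul0r.
Qed.

Lemma span_set_inl a t y : B y -> span_set (double_inl (v a * x t * y)).
Proof.
rewrite {1}Bv => -[c ey].
have -> : double_inl (v a * x t * y) =
    \sum_b double_alg (c b) * double_inl (v a * x t * v b).
  have Jy : J (v a * x t * y) by apply: tidealMr => //; apply: tidealMl.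
  apply: double_eq; rewrite rmorph_sum ?dfst_inl ?dsnd_inl //.
    rewrite {1}ey mulr_sumr; apply: eq_bigr => b _.
    by rewrite rmorphM dfst_alg dfst_inl // [LHS]mulrA -alg_mapC !mulrA.
  by rewrite big1 // => b _; rewrite rmorphM dsnd_inl // mulr0.
apply: span_set_sum => b; apply: span_setZ.
exact: (span_set_gen (Some (a, t, b))).
Qed.

Lemma span_subring : is_subring span_set.
Proof.
have [B1 BB BM BZ] := sB.
split; first exact: (span_set_gen None).
  move=> u w hu hw; apply: span_setD => //; rewrite -mulN1r -(rmorphN1 double_alg).
  exact: span_setZ.
move=> _ _ [c ->] [e ->]; rewrite mulr_suml; apply: span_set_sum => t.
rewrite mulr_sumr; apply: span_set_sum => t'.
have -> : double_alg (c t) * span_gen t * (double_alg (e t') * span_gen t') =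
  double_alg (c t * e t') * (span_gen t * span_gen t').
  by rewrite rmorphM -!mulrA; congr (_ * _); rewrite mulrA -double_algC !mulrA.
apply: span_setZ; case: t => [[[a t] b]|]; last by rewrite mul1r; apply: span_set_gen.
case: t' => [[[a' t'] b']|]; last by rewrite mulr1; apply: span_set_gen.
(* The right-hand bracket lies in [B], as the [x t] do, so the product is again of the shape handled
   by [span_set_inl]. *)
have -> : span_gen (Some (a, t, b)) * span_gen (Some (a', t', b')) =
    double_inl (v a * x t * (v b * (v a' * x t' * v b'))).
  have Jy : J (v a * x t * (v b * (v a' * x t' * v b'))).
    by apply: tidealMr => //; apply: tidealMl.
  by apply: double_eq; rewrite rmorphM ?dfst_inl ?dsnd_inl ?mul0r // !mulrA.
apply: span_set_inl; exact: (BM _ _ (Bv1 b) (BM _ _ (BM _ _ (Bv1 a') (Bx t')) (Bv1 b'))).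
Qed.

Lemma span_set_mem t : span_set (double_inl (x t)).
Proof.
have [B1 _ _ _] := sB; have := B1; rewrite {1}Bv => -[c e1].
have -> : double_inl (x t) = \sum_a double_alg (c a) * double_inl (v a * x t * 1).
  have Jy a : J (v a * x t * 1) by rewrite mulr1; apply: tidealMl.
  apply: double_eq; rewrite rmorph_sum ?dfst_inl ?dsnd_inl //.
    rewrite -[LHS]mul1r {1}e1 mulr_suml; apply: eq_bigr => a _.
    by rewrite rmorphM dfst_alg dfst_inl // mulr1 mulrA.
  by rewrite big1 // => b _; rewrite rmorphM dsnd_inl // mulr0.
by apply: span_set_sum => a; apply: span_setZ; apply: span_set_inl.
Qed.
End Span.

Section Lift.
Variable n' : nat.
Notation n := n'.+3.
Notation y a b := (commutator (el (idx0 n') (idx1 n') a) (el (idx1 n') (idx0 n') b)).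

Lemma dmx_eq m (P Q : 'M[D]_m) : map_mx (dfst iJ) P = map_mx (dfst iJ) Q ->
  map_mx (dsnd iJ) P = map_mx (dsnd iJ) Q -> P = Q.
Proof.
move=> /matrixP e1 /matrixP e2; apply/matrixP=> i j; apply: double_eq.
  by have := e1 i j; rewrite !mxE.
by have := e2 i j; rewrite !mxE.
Qed.

Lemma double_lift (g : GL n A) : congruence J g -> exists h : GL n D,
  [/\ GLmap (dfst iJ) h = g, GLmap (dsnd iJ) h = 1%g,
      forall Y, is_ideal Y -> normalizes [set h] (rel_elem Y) &
      forall (Y K : set D) b, is_ideal Y ->
        (forall r a, K a -> K (double_alg r * a)) ->
        (forall a, K a -> Y (a * b) /\ Y (b * a)) -> forall a, K a ->
        exists2 e, rel_elem Y e & cj h (y a b) = (e * y a b)%g].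
Proof.
move=> Jg; have Jg' := congruenceV iJ Jg.
(* Entries of both [g - 1] and [g^-1 - 1], so that the span also contains the inverse of (g, 1). *)
pose x (t : bool * 'I_n * 'I_n) : A :=
  (if t.1.1 then GLmx g else GLmxV g) t.1.2 t.2 - (1%:M : 'M[A]_n) t.1.2 t.2.
have Jx t : J (x t).
  case: t => [[[] i] j]; rewrite /x /=; [have := Jg i j|have := Jg' i j];
  by rewrite !mxE.
have [B [sB [d [v Bv]] Bx]] := quasi_finite_seq [seq x t | t <- enum {: bool * 'I_n * 'I_n}].
have {}Bx t : B (x t) by apply: Bx; apply: map_f; rewrite mem_enum.
have sW := span_subring sB Jx Bx Bv.
pose entry b i j : D := ((1%:M : 'M[D]_n) i j) + double_inl (x (b, i, j)).
have dentry b i j : dfst iJ (entry b i j) = (if b then GLmx g else GLmxV g) i j.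
  rewrite rmorphD dfst_inl // /x /= !mxE.
  by case: (i == j); rewrite ?rmorph1 ?rmorph0 addrC subrK.
have sentry b i j : dsnd iJ (entry b i j) = (1%:M : 'M[A]_n) i j.
  rewrite rmorphD dsnd_inl // addr0 !mxE.
  by case: (i == j); rewrite ?rmorph1 ?rmorph0.
have Wentry b i j : span_set x v (entry b i j).
  apply: span_setD; last exact: (span_set_mem sB Jx Bv).
  rewrite mxE; case: (i == j); last exact: span_set0.
  exact: (span_set_gen _ _ None).
pose C : pzRingType := subring_of sW.
pose iota : {rmorphism C -> D} := subring_val sW.
have Walg r : span_set x v (double_alg r).
  by rewrite -[double_alg r]mulr1; apply: span_setZ; apply: (span_set_gen _ _ None).
pose psi : {rmorphism R -> C} := subring_lift sW Walg.
have iotaE r : iota (psi r) = double_alg r by [].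
have psiC r (z : C) : psi r * z = z * psi r.
  by apply: (@subring_val_inj _ _ sW); rewrite !rmorphM; apply: double_algC.
pose lift u (h : span_set x v u) : C := sval (cid (subring_mk sW h)).
have liftE u h : iota (@lift u h) = u by rewrite /lift; case: cid.
pose Tw : finType := option ('I_d * (bool * 'I_n * 'I_n) * 'I_d).
pose vC (k : 'I_#|Tw|) : C := lift _ (span_set_gen x v (enum_val k)).
have span_vC (z : C) : exists c : 'I_#|Tw| -> R, z = \sum_i psi (c i) * vC i.
  have [c ec] := subring_valP z.
  exists (fun k => c (enum_val k)); apply: (@subring_val_inj _ _ sW).
  rewrite ec rmorph_sum; rewrite (big_enum_val (fun u => double_alg (c u) * span_gen x v u)).
  apply: eq_bigr => k _; rewrite -[RHS]/(iota (psi (c (enum_val k)) * vC k)).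
  by rewrite rmorphM iotaE liftE.
pose mx b : 'M[C]_n := \matrix_(i, j) lift _ (Wentry b i j).
pose P b : 'M[D]_n := map_mx iota (mx b).
have PE b i j : P b i j = entry b i j by rewrite !mxE liftE.
have P1 b : map_mx (dfst iJ) (P b) = if b then GLmx g else GLmxV g.
  by apply/matrixP=> i j; rewrite mxE PE dentry.
have P2 b : map_mx (dsnd iJ) (P b) = 1%:M.
  by apply/matrixP=> i j; rewrite mxE PE sentry.
have PQ : P true *m P false = 1%:M.
  by apply: dmx_eq; rewrite map_mxM !(P1, P2) map_mx1 ?mulmx1 ?GLmxK.
have QP : P false *m P true = 1%:M.
  by apply: dmx_eq; rewrite map_mxM !(P1, P2) map_mx1 ?mulmx1 ?GLmxVK.
have mapI (M N : 'M[C]_n) : map_mx iota M = map_mx iota N -> M = N.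
  move=> /matrixP e; apply/matrixP=> i j; apply: (@subring_val_inj _ _ sW).
  by have := e i j; rewrite !mxE.
have pq : mx true *m mx false = 1%:M by apply: mapI; rewrite map_mxM map_mx1.
have qp : mx false *m mx true = 1%:M by apply: mapI; rewrite map_mxM map_mx1.
exists (GLmake PQ QP); split.
- by apply: GLmx_inj; rewrite GLmx_map; apply: P1.
- by apply: GLmx_inj; rewrite GLmx_map; apply: P2.
- move=> Y iY.
  exact: (@cj_rel_elem _ _ _ double_alg psi iota double_algC psiC iotaE _ vC span_vC
    n' (GLmake PQ QP) (mx true) (mx false) erefl erefl pq qp Y iY).
- move=> Y K b iY Kphi KY a Ka.
  exact: (@cj_corner_commutator _ _ _ double_alg psi iota double_algC psiC iotaE _ vC span_vC
    n' (GLmake PQ QP) (mx true) (mx false) erefl erefl pq qp Y K b iY Kphi KY a Ka).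
Qed.
End Lift.
End QuasiFiniteDouble.

(** * Commutator formulas and arrangements *)

Section CommutatorFormulas.
Variables (R : comPzRingType) (A : algebra R).
Hypothesis qfA : quasi_finite A.
Variable n' : nat.
Notation n := n'.+3.
Notation G := (GL n A).
Implicit Types (X Y J K L : set A).
Let n3 : (2 < n)%N. Proof. by []. Qed.

Definition rel_comm X Y : set G := commutator_subgroup (rel_elem X) (rel_elem Y).

Definition commuting_mod J (N : set G) : set G :=
  [set x | @En n A x /\ forall g, congruence J g -> N (commutator x g)].

Lemma commuting_mod_group J N : is_subgroup N -> normalizes (@En n A) N ->
  is_subgroup (commuting_mod J N).
Proof.
move=> gN nN; have gE := @En_group n A; have [E1 EM EV] := gE.
split=> [|x z [Ex Nx] [Ez Nz]|x [Ex Nx]]; split=> //.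
- by move=> g _; rewrite /commutator !gsimpE; case: gN.
- exact: EM.
- by move=> g Jg; apply: (commute_modMl gN nN) => //; [apply: Nx|apply: Nz].
- exact: EV.
- by move=> g Jg; apply: (commute_modVl gE gN nN) => //; apply: Nx.
Qed.

Lemma commuting_mod_norm J N : is_ideal J -> is_subgroup N ->
  normalizes (@En n A) N -> normalizes (@En n A) (commuting_mod J N).
Proof.
move=> iJ gN nN h x Eh [Ex Nx]; split.
  exact: (subgroup_normalizes (@En_group n A)).
move=> g Jg; apply: (commute_mod_cjl nN) => //; apply: Nx.
exact: congruence_cj.
Qed.

Lemma commuting_mod_stable J N : is_ideal J -> is_subgroup N ->
  normalizes (@En n A) N -> elem_stable (commuting_mod J N).
Proof.
move=> iJ gN nN p q c g pq; apply: commuting_mod_norm => //; exact: mem_En.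
Qed.

Lemma rel_comm_group X Y : is_subgroup (rel_comm X Y).
Proof. exact: commutator_group. Qed.
Lemma rel_comm_norm X Y : normalizes (@En n A) (rel_comm X Y).
Proof. exact: commutator_rel_norm. Qed.

(** Formula (1). Conjugating the pair (e, e) by (g, 1) gives (g e g^-1, e), and its components
    differ by [[g, e]]. *)
Lemma rel_elem_commuting X J : is_ideal X -> is_ideal J ->
  rel_elem X `<=` commuting_mod J (rel_comm X J).
Proof.
move=> iX iJ; have gN := rel_comm_group X J; have nN := @rel_comm_norm X J.
have [_ _ NV] := gN.
apply: rel_elem_min => [||i j x ij Xx]; first exact: commuting_mod_group.
  exact: commuting_mod_stable.
split=> [|g Jg]; first exact: mem_En.
have [h [h1 h2 hn _]] := double_lift qfA iJ Jg.
have J0 : J (x - x) by rewrite subrr; apply: tideal0.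
have [d1 d2] := @mk_doubleP A J iJ x x J0; set u := mk_double iJ x x in d1 d2.
have Yu : @double_ideal A J iJ X u.
  by split; rewrite ?d1 ?d2 ?subrr //; apply: tideal0; apply: circle_ideal.
have := hn _ (double_idealP iJ iX) h (el i j u) erefl (mem_rel_elem ij Yu).
move=> /(double_rel_elem n3 iX)[_].
rewrite !GLmap_cj !GLmap_el h1 h2 d1 d2 cj1g -commutatorE -commutatorV => Nc.
by rewrite -[commutator _ _]ginvK; apply: NV.
Qed.

Notation y i j a b := (commutator (el i j a) (el j i b) : G).

Lemma corner_commuting K L J a b : is_ideal K -> is_ideal L -> is_ideal J ->
  K a -> L b ->
  commuting_mod J (rel_comm (circle K L) J) (y (idx0 n') (idx1 n') a b).
Proof.
move=> iK iL iJ Ka Lb; have iX := circle_ideal K L.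
have gN := rel_comm_group (circle K L) J; have [_ _ NV] := gN.
split=> [|g Jg].
  have [_ EM EV] := @En_group n A; rewrite commutatorE.
  by apply: EM; [apply: (subgroup_normalizes (@En_group n A))|apply: EV];
    apply: mem_En.
have [h [h1 h2 _ hc]] := double_lift qfA iJ Jg.
have J0 x : J (x - x) by rewrite subrr; apply: tideal0.
have [a1 a2] := @mk_doubleP A J iJ a a (J0 a); set a' := mk_double iJ a a in a1 a2.
have [b1 b2] := @mk_doubleP A J iJ b b (J0 b); set b' := mk_double iJ b b in b1 b2.
(* The diagonal copy of [K]. Products with the diagonal [b'] have equal components, so they satisfy
   the difference condition of [double_ideal]. *)
pose K' := [set u | K (dfst iJ u) /\ dsnd iJ u = dfst iJ u].
have [||u [Ku eu]||e Ye ee] := hc (@double_ideal A J iJ (circle K L)) K' b' _ _ _ a' _.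
- exact: double_idealP.
- move=> r u [Ku eu]; split; rewrite !rmorphM; first exact: tidealMl.
  by rewrite eu dsnd_alg dfst_alg.
- by split; split; rewrite !rmorphM ?eu ?b1 ?b2 ?subrr;
    by [apply: circle_l|apply: circle_r|apply: tideal0; apply: circle_ideal].
- by split; rewrite ?a1 ?a2.
have [_ Ne] := double_rel_elem n3 iX Ye.
have e1 := congr1 (GLmap (dfst iJ)) ee; have e2 := congr1 (GLmap (dsnd iJ)) ee.
move: e1 e2; rewrite !GLmap_cj !GLmap_commutator.
rewrite ![GLmap _ (_ * commutator _ _)%g]GLmapM !GLmap_commutator !GLmap_el h1 h2.
rewrite a1 a2 b1 b2 cj1g => e1 e2.
(* [h] is trivial in the second component, hence so is [e]; its first component is then the
   commutator of [g] with the corner element. *)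
have s1 : GLmap (dsnd iJ) e = 1%g.
  by rewrite -[LHS](mulgK (y (idx0 n') (idx1 n') a b)) -e2 mulgV.
move: Ne; rewrite s1 invg1 mulg1 -[GLmap _ e](mulgK (y (idx0 n') (idx1 n') a b)) -e1.
by rewrite -commutatorE => /NV; rewrite commutatorV.
Qed.
End CommutatorFormulas.

Section WeylElements.
Variables (n : nat) (A : pzRingType).
Hypothesis n3 : (2 < n)%N.
Notation G := (GL n A).
Implicit Types (i j k l : 'I_n) (a b : A).
Local Open Scope group_scope.

(** A signed transposition matrix: conjugation by it exchanges the indices [k] and [l] up to
    sign. *)
Definition weyl k l : G := el k l 1%R * el l k (- 1)%R * el k l 1%R.

Lemma el_comm_same i p q b c : p != i -> q != i ->
  el i p b * el i q c = el i q c * el i p b :> G.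
Proof.
move=> pi qi; have ip : i != p by rewrite eq_sym.
have iq : i != q by rewrite eq_sym.
have [->|pq] := eqVneq p q; first by rewrite !elD addrC.
by rewrite -{2}(@cj_el_id n A i p i q b c) // /cj !gsimpE.
Qed.

Lemma el_comm_same_r j p q b c : p != j -> q != j ->
  el p j b * el q j c = el q j c * el p j b :> G.
Proof.
move=> pi qi; have jp : j != p by rewrite eq_sym.
have jq : j != q by rewrite eq_sym.
have [->|pq] := eqVneq p q; first by rewrite !elD addrC.
by rewrite -{2}(@cj_el_id n A p j q j b c) // /cj !gsimpE.
Qed.

Lemma weyl_l k l j a : k != l -> l != j -> k != j ->
  cj (weyl k l) (el k j a) = el l j (- a)%R.
Proof.
move=> kl lj kj; have lk : l != k by rewrite eq_sym.
rewrite /weyl !cjMl (@cj_el_id _ _ k l k j) // cj_el_l // mulN1r cjM.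
rewrite (@cj_el_id _ _ k l k j) // cj_el_l // mul1r el_comm_same_r //.
by rewrite -mulgA elD addNr el0 mulg1.
Qed.

Lemma weyl_r k l j b : k != l -> l != j -> k != j ->
  cj (weyl k l) (el j k b) = el j l (- b)%R.
Proof.
move=> kl lj kj; have lk : l != k by rewrite eq_sym.
have jk : j != k by rewrite eq_sym.
have jl : j != l by rewrite eq_sym.
rewrite /weyl !cjMl cj_el_r // mulr1 el_comm_same // [cj _ (el j l _ * _)]cjM.
rewrite (@cj_el_id _ _ l k j k) // cj_el_r // mulrN1 opprK -mulgA elD addNr.
by rewrite el0 mulg1 cj_el_id.
Qed.

Lemma weyl_stable (Q : set G) k l g : elem_stable Q -> k != l -> Q g ->
  Q (cj (weyl k l) g).
Proof.
move=> sQ kl Qg; have lk : l != k by rewrite eq_sym.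
by rewrite /weyl !cjMl; do 3 apply: (sQ) => //.
Qed.

(** Goodness speaks of the fixed corner [i0], [i1] only. Weyl elements replace one index of a pair
    at a time, and a third index serves when the new first index is [q]. *)
Lemma opposite_pair_transfer (Q : set G) (K L : set A) p q :
  elem_stable Q -> is_ideal K -> is_ideal L -> p != q ->
  (forall a b, K a -> L b -> Q (commutator (el p q a) (el q p b))) ->
  forall i j a b, i != j -> K a -> L b -> Q (commutator (el i j a) (el j i b)).
Proof.
move=> sQ iK iL; pose P i j := forall a b, K a -> L b ->
  Q (commutator (el i j a) (el j i b)).
have step1 l k j : k != l -> l != j -> k != j -> P l j -> P k j.
  move=> kl lj kj Plj a b Ka Lb; have lk : l != k by rewrite eq_sym.
  rewrite -[a]opprK -[b]opprK -(@weyl_l l k j) // -(@weyl_r l k j) // -cj_comm.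
  by apply: weyl_stable => //; apply: Plj; apply: tidealN.
have step2 l k j : k != l -> l != j -> k != j -> P j l -> P j k.
  move=> kl lj kj Pjl a b Ka Lb; have lk : l != k by rewrite eq_sym.
  rewrite -[a]opprK -[b]opprK -(@weyl_l l k j) // -(@weyl_r l k j) // -cj_comm.
  by apply: weyl_stable => //; apply: Pjl; apply: tidealN.
move=> pq Ppq; suff : forall i j, i != j -> P i j by move=> h i j a b /h; apply.
have off i j : i != q -> i != j -> P i j.
  move=> iq ij; have Piq : P i q.
    by have [->//|ip] := eqVneq i p; apply: (step1 p) => //.
  have [->//|jq] := eqVneq j q.
  by apply: (step2 q) => //; rewrite 1?eq_sym.
move=> i j ij; have [iq|iq] := eqVneq i q; last exact: off.
have [h [hi hj]] := third_index i j n3.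
apply: (step1 h) => //; first by rewrite eq_sym.
by apply: off => //; rewrite -iq.
Qed.

End WeylElements.

(** * Induction on the arrangement of brackets *)

Section Arrangements.
Variables (R : comPzRingType) (A : algebra R).
Hypothesis qfA : quasi_finite A.
Variable n' : nat.
Notation n := n'.+3.
Notation G := (GL n A).
Implicit Types (J K L : set A).
Let n3 : (2 < n)%N. Proof. by []. Qed.
Notation rel_comm := (@rel_comm R A n').

(** Formula (2). [commuting_mod] is itself a subgroup stable under elementary conjugation, so it can
    be the target of [commutator_rel_elem]; formula (1) covers the products [a * b] and [b * a]. *)
Lemma rel_comm_commuting K L J : is_ideal K -> is_ideal L -> is_ideal J ->
  rel_comm K L `<=` commuting_mod J (rel_comm (circle K L) J).
Proof.
move=> iK iL iJ; have iC := circle_ideal K L.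
have gN := @rel_comm_group R A n' (circle K L) J.
have nN := @rel_comm_norm R A n' (circle K L) J.
have gQ := commuting_mod_group J gN nN.
have sQ := commuting_mod_stable iJ gN nN.
apply: commutator_min => // u v; move: u v.
apply: (commutator_rel_elem n3 iK iL gQ sQ) => i j a b ij Ka Lb; split.
- by apply: rel_elem_commuting => //; apply: mem_rel_elem => //; apply: circle_l.
- by apply: rel_elem_commuting => //; apply: mem_rel_elem => //; apply: circle_r.
- move: i j a b ij Ka Lb.
  apply: (@opposite_pair_transfer n A n3 _ K L (idx0 n') (idx1 n')) => // a b Ka Lb.
  exact: corner_commuting.
Qed.

Fixpoint circle_of p (t : bracketing p) : ('I_p -> set A) -> set A :=
  match t in bracketing p return ('I_p -> set A) -> set A with
  | Entry => fun X => X ord0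
  | Bracket p q t1 t2 => fun X =>
      circle (circle_of t1 (fun i => X (lshift q i)))
             (circle_of t2 (fun i => X (rshift p i)))
  end.

Notation rel X := (fun i => @rel_elem n A (X i)).

Lemma circle_of_ideal p (t : bracketing p) X :
  (forall i, is_ideal (X i)) -> is_ideal (circle_of t X).
Proof. by case: t X => [X iX|p1 p2 t1 t2 X iX] /=; [|exact: circle_ideal]. Qed.

Lemma multicommutatorS (T : groupType) p (t : bracketing p)
    (H H' : 'I_p -> set T) :
  (forall i, H i `<=` H' i) -> multicommutator t H `<=` multicommutator t H'.
Proof.
elim: t H H' => [|p1 p2 t1 IH1 t2 IH2] H H' sH /=; first exact: sH.
by apply: commutatorS; [apply: IH1|apply: IH2] => i; apply: sH.
Qed.

Lemma rel_elem_circle_of p (t : bracketing p) X : (forall i, is_ideal (X i)) ->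
  rel_elem (circle_of t X) `<=` multicommutator t (rel X).
Proof.
elim: t X => [|p1 p2 t1 IH1 t2 IH2] X iX //=.
apply: subset_trans; first by apply: circle_rel_elem => //; apply: circle_of_ideal.
by apply: commutatorS; [apply: IH1|apply: IH2].
Qed.

Lemma multicommutator_congruence p (t : bracketing p) X (H : 'I_p -> set G) :
  (forall i, is_ideal (X i)) -> (forall i, H i `<=` congruence (X i)) ->
  multicommutator t H `<=` congruence (circle_of t X).
Proof.
elim: t X H => [|p1 p2 t1 IH1 t2 IH2] X H iX sH /=; first exact: sH.
apply: subset_trans; last exact: commutator_congruence.
by apply: commutatorS; [apply: IH1|apply: IH2].
Qed.

Lemma multicommutator_commuting p (t : bracketing p) X J :
  (forall i, is_ideal (X i)) -> is_ideal J ->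
  multicommutator t (rel X) `<=`
    commuting_mod J (rel_comm (circle_of t X) J).
Proof.
elim: t X J => [|p1 p2 t1 IH1 t2 IH2] X J iX iJ /=.
  exact: rel_elem_commuting.
have iC1 : is_ideal (circle_of t1 (fun i => X (lshift p2 i))).
  exact: circle_of_ideal.
have iC2 : is_ideal (circle_of t2 (fun i => X (rshift p1 i))).
  exact: circle_of_ideal.
apply: subset_trans; last exact: rel_comm_commuting.
apply: commutator_min => [|u v]; first exact: rel_comm_group.
(* The ideal of the second part takes the place of [J] in the induction hypothesis for the first,
   while the second part enters through its congruence subgroup. *)
move=> /(IH1 _ _ _ iC2)[//|_ Nu] hv; apply: Nu; move: hv.
by apply: multicommutator_congruence => // i; apply: rel_elem_congruence.
Qed.

Lemma multicommutator_rel_sub p (t : bracketing p) X (H : 'I_p -> set G) :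
  (forall i, is_ideal (X i)) -> (forall i, H i `<=` congruence (X i)) ->
  (exists j, H j = rel_elem (X j)) ->
  multicommutator t H `<=` multicommutator t (rel X).
Proof.
elim: t X H => [|p1 p2 t1 IH1 t2 IH2] X H iX sH [j Hj] /=.
  by have <- : j = ord0 by [apply: ord1]; rewrite Hj.
set X1 := fun i => X (lshift p2 i); set X2 := fun i => X (rshift p1 i).
have iX1 i : is_ideal (X1 i) by apply: iX.
have iX2 i : is_ideal (X2 i) by apply: iX.
have iC1 : is_ideal (circle_of t1 X1) by apply: circle_of_ideal.
have iC2 : is_ideal (circle_of t2 X2) by apply: circle_of_ideal.
have sub : rel_comm (circle_of t1 X1) (circle_of t2 X2) `<=`
    commutator_subgroup (multicommutator t1 (rel X1)) (multicommutator t2 (rel X2)).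
  by apply: commutatorS; apply: rel_elem_circle_of.
apply: (subset_trans _ sub).
have gN := @rel_comm_group R A n' (circle_of t1 X1) (circle_of t2 X2).
have c1 : multicommutator t1 (fun i => H (lshift p2 i)) `<=` congruence (circle_of t1 X1).
  by apply: multicommutator_congruence => // i; apply: sH.
have c2 : multicommutator t2 (fun i => H (rshift p1 i)) `<=` congruence (circle_of t2 X2).
  by apply: multicommutator_congruence => // i; apply: sH.
apply: commutator_min => // u v hu hv.
case: (split_ordP j) => k jk; rewrite jk in Hj.
  have /multicommutator_commuting-/(_ _ iX1 iC2)[_ Nu] :
      multicommutator t1 (rel X1) u.
    by apply: (IH1 _ _ iX1 _ _ u hu) => [i|]; [apply: sH|exists k].
  by apply: Nu; apply: c2.
have /multicommutator_commuting-/(_ _ iX2 iC1)[_ Nv] :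
    multicommutator t2 (rel X2) v.
  by apply: (IH2 _ _ iX2 _ _ v hv) => [i|]; [apply: sH|exists k].
have [_ _ NV] := gN; rewrite -commutatorV; apply: NV.
by apply: commutator_subC; apply: Nv; apply: c1.
Qed.

End Arrangements.

Theorem theorem17 (n m : nat) (R : comPzRingType) (A : algebra R)
    (I : 'I_m.+1 -> twoSidedIdeal A) (G : 'I_m.+1 -> set (GL n A)) :
  (3 <= n)%N ->
  quasi_finite A ->
  (forall i, is_subgroup (G i)) ->
  (forall i, En_rel n (I i) `<=` G i /\ G i `<=` GL_rel n (I i)) ->
  (exists j, G j = En_rel n (I j)) ->
  forall t : bracketing m.+1,
    multicommutator t G = multicommutator t (fun i => En_rel n (I i)).
Proof.
move=> n3 qfA gG EG GE t; apply/seteqP; split; last first.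
  by apply: multicommutatorS => i; case: (EG i).
case: n n3 G gG EG GE => [|[|[|n']]] // _ G gG EG [j Gj].
pose X i := [set a | a \in I i]; have iX i : is_ideal (X i) by apply: ideal_of.
have -> : (fun i => En_rel n'.+3 (I i)) = (fun i => rel_elem (X i)).
  by apply/funext => i; rewrite En_relE.
apply: multicommutator_rel_sub => //.
  by move=> i; rewrite -GL_relE; case: (EG i).
by exists j; rewrite Gj En_relE.
Qed.
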